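(* Let $\varphi(\tau,z)$ be a meromorphic Jacobi form of weight $k$ and index $m$ (with $k\in\mathbb Z$ and $m$ a positive integer) whose only singularities are simple poles at $z=z_s=\alpha\tau+\beta$ for $s=(\alpha,\beta)\in S\subset\mathbb Q^2$. Let $h_\ell(\tau)$ be its canonical Fourier coefficients and let $D_s(\tau)$ be its normalized residues, both as defined in the context. Then $$\varphi(\tau,z)=\varphi^F(\tau,z)+\varphi^P(\tau,z),$$ where $$\varphi^F(\tau,z)=\sum_{\ell\in\mathbb Z/2m\mathbb Z}h_\ell(\tau)\,\vartheta_{m,\ell}(\tau,z),\qquad \varphi^P(\tau,z)=\sum_{s\in S/\mathbb Z^2}D_s(\tau)\,\mathcal A_m^s(\tau,z).$$
   Context: Notation: $\tau\in\mathbb H$ (upper half-plane), $z\in\mathbb C$, $\mathbf e(x)=e^{2\pi i x}$, $q=\mathbf e(\tau)$, $y=\mathbf e(z)$. A meromorphic Jacobi form of weight $k$ and index $m$ is a meromorphic function $\varphi$ on $\mathbb H\times\mathbb C$ satisfying $\varphi\bigl(\frac{a\tau+b}{c\tau+d},\frac z{c\tau+d}\bigr)=(c\tau+d)^k\,\mathbf e\bigl(\frac{mcz^2}{c\tau+d}\bigr)\varphi(\tau,z)$ for all $\begin{pmatrix}a&b\\c&d\end{pmatrix}\in SL(2,\mathbb Z)$ and $\varphi(\tau,z+\lambda\tau+\mu)=\mathbf e(-m(\lambda^2\tau+2\lambda z))\,\varphi(\tau,z)$ for all $\lambda,\mu\in\mathbb Z$, such that for every $\tau$ the function $z\mapsto\varphi(\tau,z)$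 has poles only at points $z_s=\alpha\tau+\beta$ with $s=(\alpha,\beta)$ in some fixed subset $S\subset\mathbb Q^2$. The set $S$ is invariant under translation by $\mathbb Z^2$ and under $SL(2,\mathbb Z)$, and $S/\mathbb Z^2$ is finite. Theta functions: $\vartheta_{m,\ell}(\tau,z)=\sum_{r\in\mathbb Z,\ r\equiv\ell\ (\mathrm{mod}\ 2m)}q^{r^2/4m}y^r$. Canonical Fourier coefficients: for $\ell\in\mathbb Z$, $$h_\ell(\tau)=q^{\ell^2/4m}\int_{\mathbb R/\mathbb Z}\varphi\bigl(\tau,z-\tfrac{\ell\tau}{2m}\bigr)\,\mathbf e(-\ell z)\,dz .$$ If the integrand has poles on the real line, the integral is defined as the average of the integral over a path deformed to pass just above these poles and the integral over a path deformed to pass just below them. The function $h_\ell$ depends only on $\ell$ modulo $2m$. Residues: $D_s(\tau)=2\pi i\,\mathbf e(m\alpha z_s)\,\mathrm{Res}_{z=z_s}\varphi(\tau,z)$ for $s=(\alpha,\beta)\in S$. Averaging operator: $\mathrm{Av}^{(m)}[F(y)]=\sum_{\lambda\in\mathbb Z}q^{m\lambda^2}y^{2m\lambda}F(q^\lambda y)$. Rational functions: for $c\in\mathbb R$, $\mathcal R_c(y)=\frac12\,y^c\,\frac{y+1}{y-1}$ if $c\in\mathbb Z$ and $\mathcal R_c(y)=y^{\lceil c\rceil}\frac1{y-1}$ if $c\notin\mathbb Z$. Appell-Lerch sums: for $s=(\alpha,\beta)\in\mathbb Q^2$, $\mathcal A_m^s(\tau,z)=\mathbf e(-m\alpha z_s)\,\mathrm{Av}^{(m)}\bigl[\mathcal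 R_{-2m\alpha}(y/y_s)\bigr]$ with $y_s=\mathbf e(z_s)$. The product $D_s\mathcal A_m^s$ depends only on the class of $s$ in $S/\mathbb Z^2$. *)

(* Defs.v *)
(* Stdlib real numbers and Coquelicot. *)
From Stdlib Require Import Reals ZArith List ClassicalEpsilon Qreals Zfloor.
From Coquelicot Require Import Coquelicot.

Open Scope C_scope.

(* A meromorphic function is represented by a total function; its values at
   its poles are arbitrary and never used. *)

Definition holomorphic_at (f : C -> C) (z : C) : Prop :=
  locally (T := C_UniformSpace) z
    (fun w => ex_derive (K := C_AbsRing) (V := C_NormedModule) f w).

Definition pole_of_order (n : nat) (f : C -> C) (z : C) : Prop :=
  exists g : C -> C,
    holomorphic_at g z /\ g z <> 0 /\
    locally' (T := C_UniformSpace) z (fun w => f w = g w / (w - z) ^ n).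

Definition is_pole (f : C -> C) (z : C) : Prop :=
  exists n : nat, (1 <= n)%nat /\ pole_of_order n f z.

Definition simple_pole (f : C -> C) (z : C) : Prop := pole_of_order 1 f z.

Definition C2 : NormedModule C_AbsRing :=
  prod_NormedModule C_AbsRing C_NormedModule C_NormedModule.

Definition holomorphic2_at (f : C2 -> C) (p : C2) : Prop :=
  locally p (fun p' =>
    ex_filterdiff (K := C_AbsRing) (U := C2) (V := C_NormedModule)
      f (locally p')).

(* Locally a quotient of holomorphic functions of two variables, with a
   denominator that is not the zero germ. *)
Definition meromorphic2_at (f : C2 -> C) (p : C2) : Prop :=
  exists g h : C2 -> C,
    holomorphic2_at g p /\ holomorphic2_at h p /\
    ~ locally p (fun p' => h p' = 0) /\
    locally p (fun p' => h p' <> 0 -> f p' = g p' / h p').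

Definition e (x : C) : C :=
  RtoC (exp (- (2 * PI * Im x))) *
  (cos (2 * PI * Re x), sin (2 * PI * Re x)).

Definition Cpowz (y : C) (n : Z) : C :=
  match n with
  | Z0 => 1
  | Zpos p => y ^ Pos.to_nat p
  | Zneg p => / (y ^ Pos.to_nat p)
  end.

Definition in_H (tau : C) : Prop := (0 < Im tau)%R.

Definition Csum {A : Type} (l : list A) (f : A -> C) : C :=
  fold_right (fun a acc => f a + acc) (RtoC 0) l.

Definition CSeries (a : nat -> C) : C :=
  iota (T := C_R_CompleteNormedModule)
    (fun l => is_series (K := R_AbsRing) (V := C_R_NormedModule) a l).

Definition ZSeries (a : Z -> C) : C :=
  CSeries (fun n => a (Z.of_nat n)) + CSeries (fun n => a (- Z.of_nat (S n))%Z).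

(* The point z_s = alpha tau + beta for s = (alpha, beta). *)
Definition zpt (s : R * R) (tau : C) : C := RtoC (fst s) * tau + RtoC (snd s).

Definition eqmodZ2 (s t : R * R) : Prop :=
  exists lambda mu : Z,
    fst t = (fst s + IZR lambda)%R /\ snd t = (snd s + IZR mu)%R.

(* SL(2,Z) acts on row vectors from the right: with tau' = (a tau + b)/(c tau + d),
   alpha tau' + beta = (alpha'' tau + beta'') / (c tau + d)
   for (alpha'', beta'') = (alpha, beta) (a b; c d). *)
Record pole_set (S : R * R -> Prop) : Prop := {
  ps_rational : forall s, S s ->
    exists p q : Q, fst s = Q2R p /\ snd s = Q2R q;
  ps_translation : forall s t, S s -> eqmodZ2 s t -> S t;
  ps_SL2 : forall (a b c d : Z) s, (a * d - b * c = 1)%Z -> S s ->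
    S ((IZR a * fst s + IZR c * snd s)%R, (IZR b * fst s + IZR d * snd s)%R);
  ps_finite : exists l : list (R * R),
    forall s, S s -> exists t, In t l /\ eqmodZ2 s t
}.

(* A list with exactly one element in every class of S / Z^2. *)
Definition representatives (S : R * R -> Prop) (reps : list (R * R)) : Prop :=
  (forall s, In s reps -> S s) /\ NoDup reps /\
  (forall s, S s -> exists! t, In t reps /\ eqmodZ2 s t).

(* The transformation laws are identities between meromorphic functions, hence
   are imposed off the poles.  [mjf_holomorphic] and [mjf_slices] also say that
   [phi] takes the right value wherever z |-> phi(tau,z) has no pole. *)
Record meromorphic_Jacobi_form (k : Z) (m : nat) (S : R * R -> Prop)
    (phi : C -> C -> C) : Prop := {
  mjf_set : pole_set S;
  mjf_meromorphic : forall tau z, in_H tau ->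
    meromorphic2_at (fun p => phi (fst p) (snd p)) (tau, z);
  mjf_holomorphic : forall tau z, in_H tau ->
    (forall s, S s -> z <> zpt s tau) ->
    holomorphic2_at (fun p => phi (fst p) (snd p)) (tau, z);
  mjf_slices : forall tau z, in_H tau ->
    holomorphic_at (phi tau) z \/
    (is_pole (phi tau) z /\ exists s, S s /\ z = zpt s tau);
  mjf_modular : forall (a b c d : Z) tau z,
    (a * d - b * c = 1)%Z -> in_H tau -> ~ is_pole (phi tau) z ->
    phi ((RtoC (IZR a) * tau + RtoC (IZR b)) / (RtoC (IZR c) * tau + RtoC (IZR d)))
        (z / (RtoC (IZR c) * tau + RtoC (IZR d))) =
    Cpowz (RtoC (IZR c) * tau + RtoC (IZR d)) k *
    e (RtoC (INR m) * RtoC (IZR c) * z ^ 2 /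
       (RtoC (IZR c) * tau + RtoC (IZR d))) *
    phi tau z;
  mjf_elliptic : forall (lambda mu : Z) tau z,
    in_H tau -> ~ is_pole (phi tau) z ->
    phi tau (z + RtoC (IZR lambda) * tau + RtoC (IZR mu)) =
    e (- (RtoC (INR m) *
          (RtoC (IZR lambda) ^ 2 * tau + 2 * RtoC (IZR lambda) * z))) *
    phi tau z
}.

(* q^(r^2/4m) y^r is e(r^2 tau / 4m) e(r z). *)
Definition theta (m : nat) (l : Z) (tau z : C) : C :=
  ZSeries (fun r =>
    if Z.eqb ((r - l) mod (2 * Z.of_nat m)) 0
    then e (RtoC (IZR r) ^ 2 * tau / (4 * RtoC (INR m))) * e (RtoC (IZR r) * z)
    else 0).

(* The integral of F over [0, 1] + i eps. *)
Definition shifted_integral (F : C -> C) (eps : R) : C :=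
  RInt (V := C_R_CompleteNormedModule)
    (fun x : R => F (RtoC x + RtoC eps * Ci)) 0 1.

(* For F of period 1, meromorphic near the real line, R/Z + i eps with a small
   eps > 0 (eps < 0) is a deformation of R/Z passing just above (below) the real
   poles; the integral over it does not depend on such an eps, so that the
   limits below are eventually constant. *)
Definition integral_above (F : C -> C) : C :=
  iota (T := C_R_CompleteNormedModule)
    (fun v => filterlim (shifted_integral F) (at_right 0)
                (locally (T := C_UniformSpace) v)).

Definition integral_below (F : C -> C) : C :=
  iota (T := C_R_CompleteNormedModule)
    (fun v => filterlim (shifted_integral F) (at_left 0)
                (locally (T := C_UniformSpace) v)).

Definition period_integral (F : C -> C) : C :=
  if excluded_middle_informative (exists x : R, is_pole F (RtoC x))
  then (integral_above F + integral_below F) / 2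
  else RInt (V := C_R_CompleteNormedModule) (fun x : R => F (RtoC x)) 0 1.

Definition fourier_coeff (m : nat) (phi : C -> C -> C) (l : Z) (tau : C) : C :=
  e (RtoC (IZR l) ^ 2 * tau / (4 * RtoC (INR m))) *
  period_integral (fun z =>
    phi tau (z - RtoC (IZR l) * tau / (2 * RtoC (INR m))) *
    e (- (RtoC (IZR l) * z))).

Definition circle_integral (f : C -> C) (z : C) (r : R) : C :=
  RInt (V := C_R_CompleteNormedModule)
    (fun t : R => f (z + RtoC r * e (RtoC t)) *
                  (2 * RtoC PI * Ci * RtoC r * e (RtoC t))) 0 1.

(* The limit is eventually constant at an isolated singularity. *)
Definition residue (f : C -> C) (z : C) : C :=
  iota (T := C_R_CompleteNormedModule)
    (fun v => filterlim (fun r => circle_integral f z r / (2 * RtoC PI * Ci))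
                (at_right 0) (locally (T := C_UniformSpace) v)).

Definition D (m : nat) (phi : C -> C -> C) (s : R * R) (tau : C) : C :=
  2 * RtoC PI * Ci * e (RtoC (INR m) * RtoC (fst s) * zpt s tau) *
  residue (phi tau) (zpt s tau).

Definition Av (m : nat) (q : C) (F : C -> C) (y : C) : C :=
  ZSeries (fun lambda =>
    Cpowz q (Z.of_nat m * lambda ^ 2) * Cpowz y (2 * Z.of_nat m * lambda) *
    F (Cpowz q lambda * y)).

Definition Rc (c : R) (y : C) : C :=
  if Req_dec_T c (IZR (Zceil c))
  then / 2 * Cpowz y (Zceil c) * ((y + 1) / (y - 1))
  else Cpowz y (Zceil c) * (1 / (y - 1)).

Definition appell (m : nat) (s : R * R) (tau z : C) : C :=
  e (- (RtoC (INR m) * RtoC (fst s) * zpt s tau)) *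
  Av m (e tau)
    (fun y => Rc (- (2 * INR m * fst s))%R (y / e (zpt s tau))) (e z).

Definition phiF (m : nat) (phi : C -> C -> C) (tau z : C) : C :=
  Csum (map Z.of_nat (seq 0 (2 * m)))
    (fun l => fourier_coeff m phi l tau * theta m l tau z).

Definition phiP (m : nat) (phi : C -> C -> C) (reps : list (R * R))
    (tau z : C) : C :=
  Csum reps (fun s => D m phi s tau * appell m s tau z).

(* Main.v *)
Require Import Defs.
From Stdlib Require Import Reals ZArith List.
From Stdlib Require Import Lra Lia ClassicalEpsilon Zfloor.
From Coquelicot Require Import Coquelicot.

(** For fixed tau put f = phi(tau, .) and, with q = e(tau), y = e(z),
      K(w) = sum_l q^(m l^2) y^(2 m l) / (q^l y / e(w) - 1).
    The elliptic law of f and u^(2m) / (u - 1) = 1 / (u - 1) + 1 + ... + u^(2m-1) give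
      f(w + tau) K(w + tau) = f(w) K(w) + f(w) sum_(0 <= j < 2m) q^(-j^2/4m) theta_j(z) e(-j w),
    so the residue theorem on a period parallelogram writes f(z) as
      sum_j q^(-j^2/4m) theta_j(z) int_L f(w) e(-j w) dw + sum_s 2 pi i Res_(z_s) f . K(z_s),
    where L is the bottom edge. It is placed so that the strip contains the lines
    Im w = - j Im tau / 2m, 0 <= j < 2m, on which the canonical coefficients live. Moving
    each integral from L to its own line adds the residues crossed, those on the line
    with weight 1/2, and by
      R_c(u) = 1 / (u - 1) + sum_(0 <= j < c) u^j (+ u^c / 2 if c is an integer)
    this turns K(z_s) into the Appell-Lerch sum.

    The residue theorem is applied to each term of K. For 1-periodic functions it says
    that the integral over a horizontal period jumps at each pole; after subtracting
    multiples of 1 / (e(w - p) - 1) it follows from Goursat's theorem. *)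

Open Scope C_scope.

(** At a pole the regular part is only known to extend continuously. Instead of proving the
    extension holomorphic, one shows that its period integral depends continuously on the height and
    is constant between the finitely many heights of poles, hence constant.

    The kernel is never summed under the integral sign. Its l-th term has in the parallelogram,
    besides the poles of f, at most the pole at z + l tau, which contributes f(z), and this happens
    for exactly one l. Summing the identities over l leaves f(z) once, and the integrals over the
    bottom edge telescope.

    The level a of the bottom edge, in units of Im tau, is taken in [-1, -1 + 1/2m]: the coefficient
    lines have levels from -1 + 1/2m to 0, and the indices c = -2 m alpha of the poles translated
    into the parallelogram then satisfy -1 < c < 2m, the range in which R_c is 1 / (u - 1) plus a
    weighted sum of the u^j with 0 <= j < 2m. A margin d around a is free of the levels of z and of
    the poles modulo 1. *)

(** * Neighbourhoods in the complex plane *)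

Definition near (z : C) (P : C -> Prop) : Prop :=
  exists d : R, (0 < d)%R /\ forall w, (Cmod (w - z) < d)%R -> P w.

Lemma near_imp z (P Q : C -> Prop) : (forall w, P w -> Q w) -> near z P -> near z Q.
Proof. intros H [d [Hd HP]]. exists d; split; auto. Qed.

Lemma near_and z P Q : near z P -> near z Q -> near z (fun w => P w /\ Q w).
Proof.
intros [d [Hd HP]] [d' [Hd' HQ]]. exists (Rmin d d'). split.
- now apply Rmin_glb_lt.
- intros w Hw. pose proof (Rmin_l d d'). pose proof (Rmin_r d d').
  split; [apply HP | apply HQ]; lra.
Qed.

Lemma near_all z (P : C -> Prop) : (forall w, P w) -> near z P.
Proof. intros H. exists 1%R; split; [lra | auto]. Qed.

Lemma near_self z P : near z P -> P z.
Proof.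
intros [d [Hd HP]]. apply HP. replace (z - z) with (RtoC 0) by ring.
now rewrite Cmod_0.
Qed.

Lemma near_near z P : near z P -> near z (fun w => near w P).
Proof.
intros [d [Hd HP]]. exists d; split; auto. intros w Hw.
exists (d - Cmod (w - z))%R. split; [lra |]. intros v Hv. apply HP.
replace (v - z) with ((v - w) + (w - z)) by ring.
pose proof (Cmod_triangle (v - w) (w - z)). lra.
Qed.

Lemma near_shift z a (P : C -> Prop) :
  near z P -> near (z + a) (fun w => P (w - a)).
Proof.
intros [d [Hd HP]]. exists d; split; auto. intros w Hw. apply HP.
now replace (w - a - z) with (w - (z + a)) by ring.
Qed.

(** The balls of [C_UniformSpace] are squares, those of [near] are discs; hence the factor
    [sqrt 2]. *)
Lemma near_locally z (P : C -> Prop) : locally (T := C_UniformSpace) z P <-> near z P.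
Proof.
split.
- intros [d Hd]. exists d; split; [apply cond_pos |]. intros w Hw. apply Hd.
  now apply C_NormedModule_mixin_compat1.
- intros [d [Hd HP]].
  assert (Hs : (0 < sqrt 2)%R) by (apply sqrt_lt_R0; lra).
  assert (Hd' : (0 < d / sqrt 2)%R) by now apply Rdiv_lt_0_compat.
  exists (mkposreal _ Hd'). intros w Hw. apply HP.
  pose proof (C_NormedModule_mixin_compat2 z w (mkposreal _ Hd') Hw) as H.
  simpl in H. replace (sqrt 2 * (d / sqrt 2))%R with d in H by (field; lra).
  exact H.
Qed.

Lemma near_neq z a : z <> a -> near z (fun w => w <> a).
Proof.
intros H. exists (Cmod (z - a)). split.
- apply Cmod_gt_0. intros H0. apply H. now apply Ceq_minus.
- intros w Hw E. subst w. rewrite <- Cmod_opp in Hw.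
  replace (- (a - z)) with (z - a) in Hw by ring. lra.
Qed.

Lemma near_Im z A B :
  (A < Im z < B)%R -> near z (fun w => A < Im w < B)%R.
Proof.
intros H. exists (Rmin (Im z - A) (B - Im z)). split.
- apply Rmin_glb_lt; lra.
- intros w Hw. pose proof (Rmin_l (Im z - A) (B - Im z)).
  pose proof (Rmin_r (Im z - A) (B - Im z)).
  assert (Hi : (Rabs (Im (w - z)) <= Cmod (w - z))%R).
  { eapply Rle_trans; [apply Rmax_r | apply Rmax_Cmod]. }
  replace (Im (w - z)) with (Im w - Im z)%R in Hi by reflexivity.
  apply Rabs_le_between in Hi. lra.
Qed.

Lemma near_pt (z : C) (P : C -> Prop) d :
  (0 < d)%R -> near z P -> exists v : C, v <> z /\ (Cmod (v - z) < d)%R /\ P v.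
Proof.
intros Hd [d' [Hd' HP]].
assert (Hm : (0 < Rmin d d')%R) by now apply Rmin_glb_lt.
pose proof (Rmin_l d d'). pose proof (Rmin_r d d').
set (h := (Rmin d d' / 2)%R). assert (Hh : (0 < h < Rmin d d')%R) by (unfold h; lra).
assert (E : Cmod (z + RtoC h - z) = h).
{ assert (X : forall c, z + c - z = c) by (intros c; ring). rewrite X, Cmod_R.
  apply Rabs_pos_eq. lra. }
exists (z + RtoC h). split; [| split].
- intros H1. rewrite H1 in E. replace (z - z) with (RtoC 0) in E by ring.
  rewrite Cmod_0 in E. lra.
- lra.
- apply HP. lra.
Qed.

(** * Continuity and complex differentiability *)

Definition ccont (f : C -> C) (z : C) : Prop :=
  forall eps : R, (0 < eps)%R -> near z (fun w => Cmod (f w - f z) < eps)%R.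

Lemma ccont_ext f g z : near z (fun w => f w = g w) -> ccont f z -> ccont g z.
Proof.
intros H Hf eps He. pose proof (near_self _ _ H) as E.
generalize (near_and _ _ _ H (Hf eps He)). apply near_imp.
intros w [E1 E2]. now rewrite <- E1, <- E.
Qed.

Lemma ccont_const c z : ccont (fun _ => c) z.
Proof.
intros eps He. apply near_all. intros _.
replace (c - c) with (RtoC 0) by ring. now rewrite Cmod_0.
Qed.

Lemma ccont_id z : ccont (fun w => w) z.
Proof. intros eps He. exists eps. auto. Qed.

Lemma ccont_plus f g z : ccont f z -> ccont g z -> ccont (fun w => f w + g w) z.
Proof.
intros Hf Hg eps He.
assert (He2 : (0 < eps / 2)%R) by lra.
generalize (near_and _ _ _ (Hf _ He2) (Hg _ He2)). apply near_imp.
intros w [H1 H2].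
replace (f w + g w - (f z + g z)) with ((f w - f z) + (g w - g z)) by ring.
pose proof (Cmod_triangle (f w - f z) (g w - g z)). lra.
Qed.

Lemma ccont_mult f g z : ccont f z -> ccont g z -> ccont (fun w => f w * g w) z.
Proof.
intros Hf Hg eps He.
set (M := (1 + Cmod (f z) + Cmod (g z))%R).
assert (HM : (1 <= M)%R).
{ unfold M. pose proof (Cmod_ge_0 (f z)). pose proof (Cmod_ge_0 (g z)). lra. }
assert (He2 : (0 < Rmin 1 (eps / (2 * M)))%R).
{ apply Rmin_glb_lt; [lra |]. apply Rdiv_lt_0_compat; lra. }
generalize (near_and _ _ _ (Hf _ He2) (Hg _ He2)). apply near_imp.
intros w [H1 H2].
pose proof (Rmin_l 1 (eps / (2 * M))) as L1.
pose proof (Rmin_r 1 (eps / (2 * M))) as L2.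
replace (f w * g w - f z * g z)
  with ((f w - f z) * (g w - g z) + ((f w - f z) * g z + f z * (g w - g z))) by ring.
pose proof (Cmod_triangle ((f w - f z) * (g w - g z))
   ((f w - f z) * g z + f z * (g w - g z))) as T1.
pose proof (Cmod_triangle ((f w - f z) * g z) (f z * (g w - g z))) as T2.
rewrite !Cmod_mult in T1, T2.
pose proof (Cmod_ge_0 (f w - f z)) as P1. pose proof (Cmod_ge_0 (g w - g z)) as P2.
pose proof (Cmod_ge_0 (f z)) as P3. pose proof (Cmod_ge_0 (g z)) as P4.
set (a := Cmod (f w - f z)) in *. set (b := Cmod (g w - g z)) in *.
set (d := (eps / (2 * M))%R) in *.
assert (Ed : (2 * M * d = eps)%R) by (unfold d; field; lra).
rewrite Cmod_mult in T2.
assert ((a * b <= d * 1)%R) by (apply Rmult_le_compat; lra).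
assert ((a * Cmod (g z) <= d * Cmod (g z))%R) by (apply Rmult_le_compat_r; lra).
assert ((Cmod (f z) * b <= Cmod (f z) * d)%R) by (apply Rmult_le_compat_l; lra).
assert ((0 < d)%R) by (unfold d; apply Rdiv_lt_0_compat; lra).
assert (Hs : (d * 1 + (d * Cmod (g z) + Cmod (f z) * d) = d * M)%R) by (unfold M; ring).
assert ((d * M < eps)%R) by nra.
rewrite <- !Cmod_mult in *. unfold a, b in *. rewrite ?Cmod_mult in *. lra.
Qed.

Lemma ccont_bounded_away f z :
  ccont f z -> f z <> 0 -> near z (fun w => Cmod (f z) / 2 < Cmod (f w))%R.
Proof.
intros Hf Hz. apply Cmod_gt_0 in Hz.
assert (H2 : (0 < Cmod (f z) / 2)%R) by lra.
generalize (Hf _ H2). apply near_imp. intros w Hw.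
pose proof (Cmod_triangle (f w) (f z - f w)) as T.
replace (f w + (f z - f w)) with (f z) in T by ring.
rewrite <- (Cmod_opp (f z - f w)) in T.
replace (- (f z - f w)) with (f w - f z) in T by ring. lra.
Qed.

Lemma near_nonzero f z : ccont f z -> f z <> 0 -> near z (fun w => f w <> 0).
Proof.
intros Hf Hz. generalize (ccont_bounded_away f z Hf Hz). apply near_imp.
intros w Hw E. rewrite E, Cmod_0 in Hw. pose proof (Cmod_ge_0 (f z)). lra.
Qed.

Lemma ccont_inv f z : ccont f z -> f z <> 0 -> ccont (fun w => / f w) z.
Proof.
intros Hf Hz eps He. pose proof Hz as Hz'. apply Cmod_gt_0 in Hz'.
set (a := Cmod (f z)) in *.
assert (H2 : (0 < eps * (a * a / 2))%R) by (apply Rmult_lt_0_compat; nra).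
generalize (near_and _ _ _ (near_nonzero _ _ Hf Hz)
  (near_and _ _ _ (ccont_bounded_away f z Hf Hz) (Hf _ H2))). apply near_imp.
intros w [Hw [H3 H4]]. fold a in H3.
replace (/ f w - / f z) with (- (f w - f z) / (f w * f z)) by (field; auto).
rewrite Cmod_div by (apply Cmult_neq_0; auto).
rewrite Cmod_opp, Cmod_mult. fold a. apply Rlt_div_l.
- apply Rlt_gt, Rmult_lt_0_compat; lra.
- eapply Rlt_le_trans; [apply H4 |]. apply Rmult_le_compat_l; nra.
Qed.

Lemma ccont_comp f g z : ccont g z -> ccont f (g z) -> ccont (fun w => f (g w)) z.
Proof.
intros Hg Hf eps He. destruct (Hf eps He) as [d [Hd H]].
generalize (Hg d Hd). apply near_imp. intros w Hw. now apply H.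
Qed.

(** Carathéodory's form of the derivative. The product, inverse and chain rules become algebra with
    continuous functions, and [phi] is the continuous extension of the difference quotient, which
    [regular_part_removable] exploits. *)
Definition cder (f : C -> C) (z l : C) : Prop :=
  exists phi : C -> C,
    ccont phi z /\ phi z = l /\ forall w, f w = f z + (w - z) * phi w.

Definition cdiff (f : C -> C) (z : C) : Prop := exists l, cder f z l.

Lemma cdiff_ccont f z : cdiff f z -> ccont f z.
Proof.
intros [l [p [Hp [_ E]]]].
apply (ccont_ext (fun w => f z + (w - z) * p w)).
- apply near_all. intros w. now rewrite <- E.
- apply ccont_plus; [apply ccont_const |]. apply ccont_mult; auto.
  apply (ccont_plus (fun w => w) (fun _ => - z)); [apply ccont_id | apply ccont_const].
Qed.

Lemma cder_eps f z l :
  (forall eps : R, (0 < eps)%R ->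
     near z (fun w => Cmod (f w - f z - l * (w - z)) <= eps * Cmod (w - z))%R) ->
  cder f z l.
Proof.
intros H.
exists (fun w => if Ceq_dec w z then l else (f w - f z) / (w - z)).
destruct (Ceq_dec z z) as [_ | n]; [| now elim n].
split; [| split; [auto |]].
- intros eps He. destruct (Ceq_dec z z) as [_ | n]; [| now elim n].
  assert (He2 : (0 < eps / 2)%R) by lra.
  generalize (H _ He2). apply near_imp. intros w Hw.
  destruct (Ceq_dec w z) as [e1 | n].
  + replace (l - l) with (RtoC 0) by ring. now rewrite Cmod_0.
  + assert (Hn : w - z <> 0) by (intros E; apply n, Ceq_minus, E).
    replace ((f w - f z) / (w - z) - l)
      with ((f w - f z - l * (w - z)) / (w - z)) by (field; auto).
    rewrite Cmod_div by auto. apply Cmod_gt_0 in Hn.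
    apply Rlt_div_l; nra.
- intros w. destruct (Ceq_dec w z) as [-> | n]; [ring |].
  assert (Hn : w - z <> 0) by (intros E; apply n, Ceq_minus, E).
  field; auto.
Qed.

Lemma cder_small f z l : cder f z l ->
  forall eps : R, (0 < eps)%R ->
  near z (fun w => Cmod (f w - f z - l * (w - z)) <= eps * Cmod (w - z))%R.
Proof.
intros [p [Hp [E1 E2]]] eps He. generalize (Hp _ He). apply near_imp. intros w Hw.
rewrite (E2 w). rewrite E1 in Hw.
replace (f z + (w - z) * p w - f z - l * (w - z)) with ((p w - l) * (w - z)) by ring.
rewrite Cmod_mult. apply Rmult_le_compat_r; [apply Cmod_ge_0 | lra].
Qed.

Lemma cder_ext f g z l : near z (fun w => f w = g w) -> cder f z l -> cder g z l.
Proof.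
intros H Hf. apply cder_eps. intros eps He.
pose proof (near_self _ _ H) as E.
generalize (near_and _ _ _ H (cder_small _ _ _ Hf eps He)). apply near_imp.
intros w [E1 E2]. now rewrite <- E1, <- E.
Qed.

Lemma cdiff_ext f g z : near z (fun w => f w = g w) -> cdiff f z -> cdiff g z.
Proof. intros H [l Hl]. exists l. now apply (cder_ext f). Qed.

Lemma cdiff_const c z : cdiff (fun _ => c) z.
Proof.
exists 0, (fun _ => RtoC 0). split; [apply ccont_const |]. split; auto.
intros w. ring.
Qed.

Lemma cdiff_id z : cdiff (fun w => w) z.
Proof.
exists 1, (fun _ => RtoC 1). split; [apply ccont_const |]. split; auto.
intros w. ring.
Qed.

Lemma cdiff_plus f g z : cdiff f z -> cdiff g z -> cdiff (fun w => f w + g w) z.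
Proof.
intros [l [p [Hp [E1 E2]]]] [l' [p' [Hp' [E1' E2']]]].
exists (l + l'), (fun w => p w + p' w). split; [now apply ccont_plus |]. split.
- now rewrite E1, E1'.
- intros w. rewrite (E2 w), (E2' w). ring.
Qed.

Lemma cdiff_mult f g z : cdiff f z -> cdiff g z -> cdiff (fun w => f w * g w) z.
Proof.
intros Hf Hg. pose proof (cdiff_ccont _ _ Hg) as Cg. revert Hf Hg.
intros [l [p [Hp [E1 E2]]]] [l' [p' [Hp' [E1' E2']]]].
exists (l * g z + f z * l'), (fun w => p w * g w + f z * p' w). split; [| split].
- apply ccont_plus; apply ccont_mult; auto. apply ccont_const.
- now rewrite E1, E1'.
- intros w. rewrite (E2 w). rewrite (E2' w) at 1. rewrite (E2' w). ring.
Qed.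

Lemma cdiff_inv f z : cdiff f z -> f z <> 0 -> cdiff (fun w => / f w) z.
Proof.
intros Hf Hz. pose proof (cdiff_ccont _ _ Hf) as Cf.
assert (Hn := near_nonzero _ _ Cf Hz). revert Hf.
intros [l [p [Hp [E1 E2]]]].
apply (cdiff_ext (fun w => / f z + (w - z) * (- p w * / f w * / f z))).
- revert Hn. apply near_imp. intros w Hw.
  assert (E : (w - z) * p w = f w - f z) by (rewrite (E2 w); ring).
  replace ((w - z) * (- p w * / f w * / f z))
    with (- ((w - z) * p w) * / f w * / f z) by ring.
  rewrite E. field; auto.
- exists (- p z * / f z * / f z), (fun w => - p w * / f w * / f z).
  split; [| split; auto].
  + apply ccont_mult; [| apply ccont_const]. apply ccont_mult; [| now apply ccont_inv].
    apply (ccont_ext (fun w => (- (1)) * p w)).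
    * apply near_all. intros; ring.
    * apply ccont_mult; auto. apply ccont_const.
  + intros w. ring.
Qed.

Lemma cdiff_comp f g z : cdiff g z -> cdiff f (g z) -> cdiff (fun w => f (g w)) z.
Proof.
intros Hg. pose proof (cdiff_ccont _ _ Hg) as Cg. revert Hg.
intros [l [p [Hp [E1 E2]]]] [l' [p' [Hp' [E1' E2']]]].
exists (l * l'), (fun w => p w * p' (g w)). split; [| split].
- apply ccont_mult; auto. now apply ccont_comp.
- now rewrite E1, E1'.
- intros w. rewrite (E2' (g w)). rewrite (E2 w) at 1. ring.
Qed.

Lemma cdiff_lin a b z : cdiff (fun w => a * w + b) z.
Proof.
apply cdiff_plus; [| apply cdiff_const].
apply cdiff_mult; [apply cdiff_const | apply cdiff_id].
Qed.

Lemma ex_derive_cdiff f z :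
  ex_derive (K := C_AbsRing) (V := C_NormedModule) f z -> cdiff f z.
Proof.
intros [l [_ Hl]]. exists l. apply cder_eps. intros eps He.
specialize (Hl z (fun P HP => HP) (mkposreal eps He)).
apply (proj2 (locally_C _ _)) in Hl. apply near_locally in Hl.
revert Hl. apply near_imp. intros w Hw. simpl in Hw.
change (Cmod (f w - f z - (w - z) * l) <= eps * Cmod (w - z))%R in Hw.
now replace (l * (w - z)) with ((w - z) * l) by ring.
Qed.

Lemma cdiff_ex_derive f z :
  cdiff f z -> ex_derive (K := C_AbsRing) (V := C_NormedModule) f z.
Proof.
intros [l Hl]. exists l. split; [apply is_linear_scal_l |].
intros x Hx.
assert (E : x = z).
{ symmetry. now apply (is_filter_lim_locally_unique (V := AbsRing_NormedModule C_AbsRing)). }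
subst x. intros eps. pose proof (cder_small _ _ _ Hl eps (cond_pos eps)) as H.
apply near_locally in H. apply locally_C in H. revert H. apply filter_imp.
intros w Hw.
change (Cmod (f w - f z - (w - z) * l) <= eps * Cmod (w - z))%R.
now replace ((w - z) * l) with (l * (w - z)) by ring.
Qed.

Lemma holomorphic_at_near f z :
  holomorphic_at f z <-> near z (fun w => cdiff f w).
Proof.
unfold holomorphic_at. rewrite near_locally. split; apply near_imp; intros w.
- apply ex_derive_cdiff.
- apply cdiff_ex_derive.
Qed.

(** * The exponential [e] and its expansion at 0 *)

Definition tpi : C := 2 * RtoC PI * Ci.

Lemma C_eq (a b : C) : Re a = Re b -> Im a = Im b -> a = b.
Proof. destruct a, b; unfold Re, Im; simpl; congruence. Qed.

Lemma Cmod_le_Re_Im (a : C) : (Cmod a <= Rabs (Re a) + Rabs (Im a))%R.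
Proof.
assert (E : a = RtoC (Re a) + RtoC (Im a) * Ci).
{ apply C_eq; unfold Re, Im; simpl; ring. }
rewrite E at 1. eapply Rle_trans; [apply Cmod_triangle |].
rewrite Cmod_mult, Cmod_Ci, !Cmod_R. lra.
Qed.

Lemma Im_le_Cmod (a : C) : (Rabs (Im a) <= Cmod a)%R.
Proof. eapply Rle_trans; [apply Rmax_r | apply Rmax_Cmod]. Qed.

Lemma e_plus a b : e (a + b) = e a * e b.
Proof.
assert (E1 : Im (a + b) = (Im a + Im b)%R) by reflexivity.
assert (E2 : Re (a + b) = (Re a + Re b)%R) by reflexivity.
unfold e. rewrite E1, E2.
replace (- (2 * PI * (Im a + Im b)))%R
  with (- (2 * PI * Im a) + - (2 * PI * Im b))%R by ring.
replace (2 * PI * (Re a + Re b))%R with (2 * PI * Re a + 2 * PI * Re b)%R by ring.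
rewrite exp_plus, cos_plus, sin_plus.
apply C_eq; unfold Re, Im; simpl; ring.
Qed.

Lemma e_0 : e 0 = 1.
Proof.
unfold e, Re, Im; simpl. rewrite !Rmult_0_r, Ropp_0, exp_0, cos_0, sin_0.
apply C_eq; unfold Re, Im; simpl; ring.
Qed.

Lemma Cmod_e z : Cmod (e z) = exp (- (2 * PI * Im z)).
Proof.
unfold e. rewrite Cmod_mult, Cmod_R.
rewrite Rabs_pos_eq by (left; apply exp_pos).
unfold Cmod. simpl fst; simpl snd.
pose proof (sin2_cos2 (2 * PI * Re z)) as H. unfold Rsqr in H.
replace (cos (2 * PI * Re z) ^ 2 + sin (2 * PI * Re z) ^ 2)%R with 1%R by (simpl; lra).
rewrite sqrt_1. ring.
Qed.

Lemma e_neq_0 z : e z <> 0.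
Proof.
intros H. apply (f_equal Cmod) in H. rewrite Cmod_e, Cmod_0 in H.
pose proof (exp_pos (- (2 * PI * Im z))). lra.
Qed.

Lemma e_opp z : e (- z) = / e z.
Proof.
assert (H : e z * e (- z) = 1).
{ rewrite <- e_plus. replace (z + - z) with (RtoC 0) by ring. apply e_0. }
rewrite <- (Cmult_1_l (e (- z))), <- (Cinv_l (e z)) by apply e_neq_0.
rewrite <- Cmult_assoc, H. ring.
Qed.

Lemma e_1 : e 1 = 1.
Proof.
unfold e, Re, Im; simpl. rewrite !Rmult_0_r, Ropp_0, exp_0, Rmult_1_r, cos_2PI, sin_2PI.
apply C_eq; unfold Re, Im; simpl; ring.
Qed.

Lemma e_nat_mult (n : nat) z : e (RtoC (INR n) * z) = e z ^ n.
Proof.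
induction n as [| n IH].
- change (RtoC (INR 0)) with (RtoC 0). replace (0 * z) with (RtoC 0) by ring.
  rewrite e_0. reflexivity.
- rewrite S_INR, RtoC_plus. replace ((INR n + 1) * z) with (z + INR n * z) by ring.
  rewrite e_plus, IH. now rewrite Cpow_S.
Qed.

Lemma e_Z_mult (n : Z) z : e (RtoC (IZR n) * z) = Cpowz (e z) n.
Proof.
destruct n as [| p | p]; simpl Cpowz.
- replace (RtoC 0 * z) with (RtoC 0) by ring. apply e_0.
- rewrite <- e_nat_mult. now rewrite INR_IPR.
- rewrite <- e_nat_mult, <- e_opp. f_equal.
  change (Z.neg p) with (- Z.pos p)%Z. rewrite opp_IZR, RtoC_opp, INR_IPR.
  change (IZR (Z.pos p)) with (IPR p). ring.
Qed.

Lemma Cpowz_1 n : Cpowz 1 n = 1.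
Proof.
destruct n as [| p | p]; simpl; rewrite ?Cpow_1_l; auto.
field.
Qed.

Lemma e_IZR n : e (RtoC (IZR n)) = 1.
Proof.
replace (RtoC (IZR n)) with (RtoC (IZR n) * 1) by ring.
now rewrite e_Z_mult, e_1, Cpowz_1.
Qed.

Lemma e_eq_1 x : e x = 1 -> exists n : Z, x = RtoC (IZR n).
Proof.
intros H. pose proof PI_RGT_0 as HPI.
assert (HI : Im x = 0%R).
{ pose proof (f_equal Cmod H) as H1. rewrite Cmod_e, Cmod_1, <- exp_0 in H1.
  apply exp_inv in H1. nra. }
assert (HR : cos (2 * PI * Re x) = 1%R).
{ apply (f_equal Re) in H. unfold e in H. rewrite HI, Rmult_0_r, Ropp_0, exp_0 in H.
  unfold Re in H; simpl in H. unfold Re. lra. }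
assert (Hs : sin (PI * Re x) = 0%R).
{ replace (2 * PI * Re x)%R with (2 * (PI * Re x))%R in HR by ring.
  rewrite cos_2a_sin in HR. nra. }
apply sin_eq_0_0 in Hs. destruct Hs as [k Hk]. exists k.
assert (Re x = IZR k) by nra.
apply C_eq; [exact H0 | exact HI].
Qed.

Lemma derivable_small (f : R -> R) l : derivable_pt_lim f 0 l ->
  forall eps : R, (0 < eps)%R -> exists d : R, (0 < d)%R /\
  forall h, (Rabs h < d)%R -> (Rabs (f h - f 0 - l * h) <= eps * Rabs h)%R.
Proof.
intros H eps He. destruct (H eps He) as [d Hd]. exists d. split; [apply cond_pos |].
intros h Hh. destruct (Req_dec h 0) as [-> | n].
- replace (f 0 - f 0 - l * 0)%R with 0%R by ring. rewrite Rabs_R0. lra.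
- specialize (Hd h n Hh). rewrite Rplus_0_l in Hd.
  replace (f h - f 0 - l * h)%R with (((f h - f 0) / h - l) * h)%R by (field; auto).
  rewrite Rabs_mult. apply Rmult_le_compat_r; [apply Rabs_pos | lra].
Qed.

Lemma e_small : forall eps : R, (0 < eps)%R ->
  near 0 (fun v => Cmod (e v - 1 - tpi * v) <= eps * Cmod v)%R.
Proof.
intros eps He. pose proof PI_RGT_0 as HPI.
(* The errors below add up to at most 7 E T with T = 2 pi |v|, that is 14 pi E |v|; E <= 1/2 gives
   exp Y <= 2. *)
set (E := Rmin (1 / 2) (eps / (20 * PI))).
assert (HE : (0 < E)%R).
{ apply Rmin_glb_lt; [lra |]. apply Rdiv_lt_0_compat; lra. }
assert (HE1 : (E <= 1 / 2)%R) by apply Rmin_l.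
assert (HE2 : (E * (20 * PI) <= eps)%R).
{ apply Rle_trans with (eps / (20 * PI) * (20 * PI))%R.
  - apply Rmult_le_compat_r; [lra | apply Rmin_r].
  - right; field; lra. }
clearbody E.
destruct (derivable_small exp 1 derivable_pt_lim_exp_0 E HE) as [d1 [P1 H1]].
assert (Hs : derivable_pt_lim sin 0 1) by (rewrite <- cos_0; apply derivable_pt_lim_sin).
assert (Hc : derivable_pt_lim cos 0 0).
{ pose proof (derivable_pt_lim_cos 0) as Hc. now rewrite sin_0, Ropp_0 in Hc. }
destruct (derivable_small sin 1 Hs E HE) as [d2 [P2 H2]].
destruct (derivable_small cos 0 Hc E HE) as [d3 [P3 H3]].
set (dd := Rmin (Rmin d1 E) (Rmin d2 d3)).
assert (Hd : (0 < dd)%R) by (repeat apply Rmin_glb_lt; auto).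
assert (B1 : (dd <= d1)%R) by (eapply Rle_trans; [apply Rmin_l | apply Rmin_l]).
assert (B4 : (dd <= E)%R) by (eapply Rle_trans; [apply Rmin_l | apply Rmin_r]).
assert (B2 : (dd <= d2)%R) by (eapply Rle_trans; [apply Rmin_r | apply Rmin_l]).
assert (B3 : (dd <= d3)%R) by (eapply Rle_trans; [apply Rmin_r | apply Rmin_r]).
exists (dd / (2 * PI))%R. split; [apply Rdiv_lt_0_compat; lra |].
intros v Hv. replace (v - 0) with v in Hv by ring.
apply Rlt_div_r in Hv; [| lra].
set (X := (2 * PI * Re v)%R). set (Y := (- (2 * PI * Im v))%R).
assert (HX : (Rabs X <= 2 * PI * Cmod v)%R).
{ unfold X. rewrite Rabs_mult, (Rabs_pos_eq (2 * PI)) by lra.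
  apply Rmult_le_compat_l; [lra | apply re_le_Cmod]. }
assert (HY : (Rabs Y <= 2 * PI * Cmod v)%R).
{ unfold Y. rewrite Rabs_Ropp, Rabs_mult, (Rabs_pos_eq (2 * PI)) by lra.
  apply Rmult_le_compat_l; [lra | apply Im_le_Cmod]. }
specialize (H1 Y ltac:(lra)). specialize (H2 X ltac:(lra)). specialize (H3 X ltac:(lra)).
rewrite exp_0 in H1. rewrite sin_0 in H2. rewrite cos_0 in H3.
assert (ER : Re (e v - 1 - tpi * v) =
  (exp Y * (cos X - 1 - 0 * X) + (exp Y - 1 - 1 * Y))%R).
{ unfold e, tpi. fold X Y. unfold X, Y, Re, Im; simpl; ring. }
assert (EI : Im (e v - 1 - tpi * v) =
  (exp Y * (sin X - 0 - 1 * X) + ((exp Y - 1 - 1 * Y) + Y) * X)%R).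
{ unfold e, tpi. fold X Y. unfold X, Y, Re, Im; simpl; ring. }
eapply Rle_trans; [apply Cmod_le_Re_Im |]. rewrite ER, EI.
set (A := (exp Y - 1 - 1 * Y)%R) in *. set (B := (sin X - 0 - 1 * X)%R) in *.
set (G := (cos X - 1 - 0 * X)%R) in *.
set (T := (2 * PI * Cmod v)%R) in *.
assert (T0 : (0 <= T)%R) by (pose proof (Rabs_pos X); lra).
assert (TE : (T < E)%R) by (unfold T; lra).
assert (HA : (Rabs A <= E * T)%R).
{ eapply Rle_trans; [apply H1 |]. apply Rmult_le_compat_l; lra. }
assert (HB : (Rabs B <= E * T)%R).
{ eapply Rle_trans; [apply H2 |]. apply Rmult_le_compat_l; lra. }
assert (HG : (Rabs G <= E * T)%R).
{ eapply Rle_trans; [apply H3 |]. apply Rmult_le_compat_l; lra. }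
assert (HexpY : (exp Y <= 2)%R).
{ replace (exp Y) with (A + 1 + Y)%R by (unfold A; ring).
  pose proof (Rle_abs A). pose proof (Rle_abs Y). nra. }
pose proof (exp_pos Y).
eapply Rle_trans; [apply Rplus_le_compat; apply Rabs_triang |].
rewrite !Rabs_mult, (Rabs_pos_eq (exp Y)) by lra.
assert (HAY : (Rabs (A + Y) <= 2 * E)%R).
{ eapply Rle_trans; [apply Rabs_triang |]. nra. }
assert (L1 : (exp Y * Rabs G <= 2 * (E * T))%R).
{ apply Rmult_le_compat; try lra. apply Rabs_pos. }
assert (L2 : (exp Y * Rabs B <= 2 * (E * T))%R).
{ apply Rmult_le_compat; try lra. apply Rabs_pos. }
assert (L3 : (Rabs (A + Y) * Rabs X <= 2 * E * T)%R).
{ apply Rmult_le_compat; try lra; apply Rabs_pos. }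
assert (L4 : (7 * E * T <= eps * Cmod v)%R).
{ unfold T. replace (7 * E * (2 * PI * Cmod v))%R
    with ((E * (14 * PI)) * Cmod v)%R by ring.
  apply Rmult_le_compat_r; [apply Cmod_ge_0 |]. nra. }
lra.
Qed.

Lemma cdiff_e z : cdiff e z.
Proof.
assert (H0 : cder e 0 tpi).
{ apply cder_eps. intros eps He. generalize (e_small eps He). apply near_imp.
  intros w Hw. rewrite e_0. now replace (w - 0) with w by ring. }
apply (cdiff_ext (fun w => e z * e (1 * w + - z))).
- apply near_all. intros w. rewrite <- e_plus. f_equal. ring.
- apply cdiff_mult; [apply cdiff_const |].
  apply (cdiff_comp e); [apply cdiff_lin |].
  replace (1 * z + - z) with (RtoC 0) by ring. now exists tpi.
Qed.

Lemma cdiff_e_lin a b z : cdiff (fun w => e (a * w + b)) z.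
Proof. apply (cdiff_comp e); [apply cdiff_lin | apply cdiff_e]. Qed.

(* The error term vanishes at 0 and its derivative along the segment from 0 to
   [v] is [tpi v] times the first-order error. *)
Lemma e_small2 : forall eps : R, (0 < eps)%R ->
  near 0 (fun v => Cmod (e v - 1 - tpi * v - (tpi * v) ^ 2 / 2) <=
                   eps * (Cmod v * Cmod v))%R.
Proof.
intros eps He. pose proof PI_RGT_0 as HPI.
(* As |tpi v| = 2 pi |v|, this first-order error bounds the derivative by eps/2 |v|^2; the real and
   imaginary parts take half of eps each. *)
assert (He' : (0 < eps / (4 * PI))%R) by (apply Rdiv_lt_0_compat; lra).
destruct (e_small _ He') as [d [Hd H]]. exists d. split; auto.
intros v Hv. replace (v - 0) with v in Hv by ring.
set (X := (2 * PI * Re v)%R). set (Y := (- (2 * PI * Im v))%R).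
assert (Ev : tpi * v = (Y, X)).
{ unfold tpi, X, Y. apply C_eq; unfold Re, Im; simpl; ring. }
assert (ME : Cmod (Y, X) = (2 * PI * Cmod v)%R).
{ rewrite <- Ev. unfold tpi. rewrite !Cmod_mult, Cmod_Ci, !Cmod_R.
  rewrite !Rabs_pos_eq by lra. ring. }
assert (Et : forall t : R, e (t * v) =
  (exp (t * Y) * cos (t * X), exp (t * Y) * sin (t * X))%R).
{ intros t. unfold e.
  replace (- (2 * PI * Im (t * v)))%R with (t * Y)%R by (unfold Y, Im; simpl; ring).
  replace (2 * PI * Re (t * v))%R with (t * X)%R by (unfold X, Re; simpl; ring).
  apply C_eq; unfold Re, Im; simpl; ring. }
set (D t := (tpi * v) * (e (RtoC t * v) - 1 - tpi * (RtoC t * v))).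
assert (HD : forall t : R, (Rabs (t - 0) <= Rabs (1 - 0))%R ->
  (Cmod (D t) <= eps / 2 * (Cmod v * Cmod v))%R).
{ intros t Ht. rewrite !Rminus_0_r, Rabs_R1 in Ht.
  assert (Htv : (Cmod (t * v) <= Cmod v)%R).
  { rewrite Cmod_mult, Cmod_R. pose proof (Cmod_ge_0 v). nra. }
  unfold D. rewrite Cmod_mult, Ev, ME.
  assert (Hb := H (t * v)). replace (t * v - 0) with (t * v) in Hb by ring.
  specialize (Hb ltac:(lra)).
  replace (eps / 2 * (Cmod v * Cmod v))%R
    with (2 * PI * Cmod v * (eps / (4 * PI) * Cmod v))%R by (field; lra).
  apply Rmult_le_compat_l.
  - pose proof (Cmod_ge_0 v). nra.
  - rewrite <- Ev in *. eapply Rle_trans; [apply Hb |]. apply Rmult_le_compat_l; lra. }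
set (hr t := (exp (t * Y) * cos (t * X) - 1 - t * Y - t * t * (Y * Y - X * X) / 2)%R).
set (hi t := (exp (t * Y) * sin (t * X) - t * X - t * t * (Y * X))%R).
assert (DR : forall t, is_derive hr t (Re (D t))).
{ intros t. unfold hr. auto_derive; auto.
  unfold D. rewrite Ev. replace ((Y, X) : C) with (tpi * v) at 2 by exact Ev.
  replace (tpi * (t * v)) with (t * (tpi * v)) by ring. rewrite Ev, Et.
  unfold Re; simpl; field. }
assert (DI : forall t, is_derive hi t (Im (D t))).
{ intros t. unfold hi. auto_derive; auto.
  unfold D. 
  replace (tpi * (t * v)) with (t * (tpi * v)) by ring. rewrite Ev, Et.
  unfold Im; simpl; field. }
assert (B1 := bounded_variation hr (fun t => Re (D t)) (eps / 2 * (Cmod v * Cmod v)) 0 1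
  (fun t Ht => conj (DR t) (Rle_trans _ _ _ (re_le_Cmod _) (HD t Ht)))).
assert (B2 := bounded_variation hi (fun t => Im (D t)) (eps / 2 * (Cmod v * Cmod v)) 0 1
  (fun t Ht => conj (DI t) (Rle_trans _ _ _ (Im_le_Cmod _) (HD t Ht)))).
rewrite Rminus_0_r, Rabs_R1, Rmult_1_r in B1, B2.
assert (E0 : hr 0%R = 0%R).
{ unfold hr. rewrite !Rmult_0_l, exp_0, cos_0. field. }
assert (E1 : hi 0%R = 0%R).
{ unfold hi. rewrite !Rmult_0_l, exp_0, sin_0. ring. }
rewrite E0, Rminus_0_r in B1. rewrite E1, Rminus_0_r in B2.
eapply Rle_trans; [apply Cmod_le_Re_Im |].
assert (Ee := Et 1%R). replace (1 * v) with v in Ee by ring. rewrite Ee, Ev.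
replace (Re _) with (hr 1%R) by (unfold hr, Re; simpl; field).
replace (Im _) with (hi 1%R) by (unfold hi, Im; simpl; field).
lra.
Qed.

(** Passes between a pole in [v - w] and the periodic [/ (e (v - w) - 1)]. The differentiability of
    the quotient at 0 is where the second-order expansion of [e] enters. *)
Lemma e_factor : exists k : C -> C, cdiff k 0 /\ k 0 = tpi /\
  forall v, e v - 1 = v * k v.
Proof.
exists (fun v => if Ceq_dec v 0 then tpi else (e v - 1) / v).
destruct (Ceq_dec 0 0) as [_ | n]; [| now elim n].
split; [| split; auto].
- exists (tpi ^ 2 / 2). apply cder_eps. intros eps He.
  destruct (Ceq_dec 0 0) as [_ | n]; [| now elim n].
  generalize (e_small2 eps He). apply near_imp. intros v Hv.
  replace (v - 0) with v by ring.
  destruct (Ceq_dec v 0) as [-> | n].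
  + replace (tpi - tpi - tpi ^ 2 / 2 * 0) with (RtoC 0) by ring.
    rewrite Cmod_0. lra.
  + replace ((e v - 1) / v - tpi - tpi ^ 2 / 2 * v)
      with ((e v - 1 - tpi * v - (tpi * v) ^ 2 / 2) / v)
      by (field; auto).
    rewrite Cmod_div by auto. apply Cmod_gt_0 in n.
    apply Rle_div_l; [lra |]. lra.
- intros v. destruct (Ceq_dec v 0) as [-> | n].
  + rewrite e_0. ring.
  + field; auto.
Qed.

(** * Integrals of complex functions of a real variable *)

Definition rcont (p : R -> C) (t : R) : Prop :=
  forall eps : R, (0 < eps)%R -> exists d : R, (0 < d)%R /\
  forall s, (Rabs (s - t) < d)%R -> (Cmod (p s - p t) < eps)%R.

(** Taken componentwise, so that real integration theory applies; for continuous integrands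
    [RInt_cint] identifies it with the complex [RInt] of the definitions. *)
Definition cint (p : R -> C) (a b : R) : C :=
  (RInt (fun t => Re (p t)) a b, RInt (fun t => Im (p t)) a b).

Lemma rcont_line f (P d : C) t :
  Cmod d = 1%R -> ccont f (P + RtoC t * d) -> rcont (fun s => f (P + RtoC s * d)) t.
Proof.
intros Hd Hf eps He. destruct (Hf eps He) as [r [Hr H]]. exists r. split; auto.
intros s Hs. apply H.
replace (P + s * d - (P + t * d)) with ((s - t) * d) by ring.
now rewrite <- RtoC_minus, Cmod_mult, Hd, Cmod_R, Rmult_1_r.
Qed.

Lemma rcont_component (g : C -> R) p t :
  (forall a b : C, Rabs (g a - g b) <= Cmod (a - b))%R ->
  rcont p t -> continuous (fun s => g (p s)) t.
Proof.
intros Hg H. apply continuity_pt_filterlim. intros eps He.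
destruct (H eps He) as [d [Hd H']]. exists d. split; auto.
intros s [_ Hs]. unfold dist in *; simpl in *; unfold R_dist in *.
eapply Rle_lt_trans; [apply Hg | now apply H'].
Qed.

Lemma rcont_Re p t : rcont p t -> continuous (fun s => Re (p s)) t.
Proof. apply rcont_component. intros a b. apply (re_le_Cmod (a - b)). Qed.

Lemma rcont_Im p t : rcont p t -> continuous (fun s => Im (p s)) t.
Proof. apply rcont_component. intros a b. apply (Im_le_Cmod (a - b)). Qed.

Section Integral.

Variables (a b : R).
Hypothesis (Hab : (a <= b)%R).

Let cont_on p := forall t, (a <= t <= b)%R -> rcont p t.

Lemma ex_RInt_Re p : cont_on p -> ex_RInt (fun t => Re (p t)) a b.
Proof.
intros H. apply (ex_RInt_continuous (V := R_CompleteNormedModule)).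
rewrite Rmin_left, Rmax_right by auto. intros t Ht. now apply rcont_Re, H.
Qed.

Lemma ex_RInt_Im p : cont_on p -> ex_RInt (fun t => Im (p t)) a b.
Proof.
intros H. apply (ex_RInt_continuous (V := R_CompleteNormedModule)).
rewrite Rmin_left, Rmax_right by auto. intros t Ht. now apply rcont_Im, H.
Qed.

Lemma RInt_cint p : cont_on p ->
  RInt (V := C_R_CompleteNormedModule) p a b = cint p a b.
Proof.
intros H. apply (is_RInt_unique (V := C_R_CompleteNormedModule)).
apply (is_RInt_fct_extend_pair (U := R_NormedModule) (V := R_NormedModule)).
- apply (RInt_correct (V := R_CompleteNormedModule)). now apply ex_RInt_Re.
- apply (RInt_correct (V := R_CompleteNormedModule)). now apply ex_RInt_Im.
Qed.

Lemma cint_ext p p' :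
  (forall t, (a <= t <= b)%R -> p t = p' t) -> cint p a b = cint p' a b.
Proof.
intros H. unfold cint. f_equal; apply RInt_ext;
rewrite Rmin_left, Rmax_right by auto; intros t Ht; rewrite H; auto; lra.
Qed.

Lemma cint_plus p p' : cont_on p -> cont_on p' ->
  cint (fun t => p t + p' t) a b = cint p a b + cint p' a b.
Proof.
intros H H'. unfold cint. apply C_eq; simpl.
- apply (RInt_plus (V := R_CompleteNormedModule)); now apply ex_RInt_Re.
- apply (RInt_plus (V := R_CompleteNormedModule)); now apply ex_RInt_Im.
Qed.

Lemma cint_scal c p : cont_on p ->
  cint (fun t => c * p t) a b = c * cint p a b.
Proof.
intros H. pose proof (ex_RInt_Re p H) as E1. pose proof (ex_RInt_Im p H) as E2.
assert (S1 : forall k, is_RInt (fun t => k * Re (p t))%R a b (k * RInt (fun t => Re (p t)) a b)%R).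
{ intros k. apply (is_RInt_scal (V := R_NormedModule)).
  now apply (RInt_correct (V := R_CompleteNormedModule)). }
assert (S2 : forall k, is_RInt (fun t => k * Im (p t))%R a b (k * RInt (fun t => Im (p t)) a b)%R).
{ intros k. apply (is_RInt_scal (V := R_NormedModule)).
  now apply (RInt_correct (V := R_CompleteNormedModule)). }
unfold cint. apply C_eq; simpl; apply is_RInt_unique.
- apply (is_RInt_minus (V := R_NormedModule) _ _ _ _ _ _ (S1 (fst c)) (S2 (snd c))).
- apply (is_RInt_plus (V := R_NormedModule) _ _ _ _ _ _ (S2 (fst c)) (S1 (snd c))).
Qed.

(** Real and imaginary parts are bounded separately, at the price of a harmless factor 2. *)
Lemma cint_bound p M : cont_on p ->
  (forall t, (a <= t <= b)%R -> (Cmod (p t) <= M)%R) ->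
  (Cmod (cint p a b) <= 2 * M * (b - a))%R.
Proof.
intros H HM. eapply Rle_trans; [apply Cmod_le_Re_Im |].
assert (X : forall g : R -> R, ex_RInt g a b ->
  (forall t, (a <= t <= b)%R -> (Rabs (g t) <= M)%R) ->
  (Rabs (RInt g a b) <= M * (b - a))%R).
{ intros g Hg Hb. rewrite Rmult_comm. now apply abs_RInt_le_const. }
assert (X1 := X _ (ex_RInt_Re p H)
  (fun t Ht => Rle_trans _ _ _ (re_le_Cmod _) (HM t Ht))).
assert (X2 := X _ (ex_RInt_Im p H)
  (fun t Ht => Rle_trans _ _ _ (Im_le_Cmod _) (HM t Ht))).
change (Rabs (RInt (fun t => Re (p t)) a b) +
  Rabs (RInt (fun t => Im (p t)) a b) <= 2 * M * (b - a))%R. lra.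
Qed.

Lemma cint_affine A B :
  cint (fun t => A + RtoC t * B) a b =
  RtoC (b - a) * A + RtoC ((b * b - a * a) / 2) * B.
Proof.
assert (X : forall u v : R, is_RInt (fun t => u + t * v)%R a b
  ((b - a) * u + (b * b - a * a) / 2 * v)%R).
{ intros u v.
  replace ((b - a) * u + (b * b - a * a) / 2 * v)%R
    with (minus (b * u + b * b / 2 * v) (a * u + a * a / 2 * v))%R
    by (unfold minus, plus, opp; simpl; field).
  apply (is_RInt_derive (fun t => t * u + t * t / 2 * v)%R).
  - intros t _. auto_derive; auto. field.
  - intros t _. apply (ex_derive_continuous (V := R_NormedModule)). auto_derive; auto. }
unfold cint. apply C_eq; unfold Re, Im; simpl; apply is_RInt_unique.
- replace (_ + _)%R with ((b - a) * fst A + (b * b - a * a) / 2 * fst B)%R by ring.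
  generalize (X (fst A) (fst B)). apply is_RInt_ext. intros t _. simpl. ring.
- replace (_ + _)%R with ((b - a) * snd A + (b * b - a * a) / 2 * snd B)%R by ring.
  generalize (X (snd A) (snd B)). apply is_RInt_ext. intros t _. simpl. ring.
Qed.

End Integral.

Lemma cint_Chasles p a b c : (a <= b <= c)%R ->
  (forall t, (a <= t <= c)%R -> rcont p t) ->
  cint p a c = cint p a b + cint p b c.
Proof.
intros Hb H. unfold cint. apply C_eq; simpl; symmetry;
apply (RInt_Chasles (V := R_CompleteNormedModule)).
- apply ex_RInt_Re; [lra | intros t Ht; apply H; lra].
- apply ex_RInt_Re; [lra | intros t Ht; apply H; lra].
- apply ex_RInt_Im; [lra | intros t Ht; apply H; lra].
- apply ex_RInt_Im; [lra | intros t Ht; apply H; lra].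
Qed.

Lemma cint_shift p a b c : (a <= b)%R ->
  (forall t, (a + c <= t <= b + c)%R -> rcont p t) ->
  cint (fun t => p (t + c)%R) a b = cint p (a + c) (b + c).
Proof.
intros Hb H.
assert (X : forall g : R -> R, ex_RInt g (a + c) (b + c) ->
  RInt (fun t => g (t + c)%R) a b = RInt g (a + c) (b + c)).
{ intros g Hg. pose proof (RInt_comp_lin (V := R_CompleteNormedModule) g 1 c a b) as X.
  rewrite !Rmult_1_l in X. rewrite <- X by exact Hg. apply RInt_ext.
  intros t _. change (g (t + c) = 1 * g (1 * t + c))%R. now rewrite !Rmult_1_l. }
unfold cint. f_equal.
- apply (X (fun t => Re (p t))). apply ex_RInt_Re; auto. lra.
- apply (X (fun t => Im (p t))). apply ex_RInt_Im; auto. lra.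
Qed.

(** * Integrals over rectangles and Goursat's theorem *)

(** For a unit direction [d] this integrates with respect to arc length: the factor [d] of dw is
    left out, and [rect_int] restores it as [Ci] on the vertical sides. *)
Definition path_int (f : C -> C) (P d : C) (L : R) : C :=
  cint (fun t => f (P + RtoC t * d)) 0 L.

Lemma path_int_split f P d L1 L2 :
  Cmod d = 1%R -> (0 <= L1)%R -> (0 <= L2)%R ->
  (forall t, (0 <= t <= L1 + L2)%R -> ccont f (P + RtoC t * d)) ->
  path_int f P d (L1 + L2) = path_int f P d L1 + path_int f (P + RtoC L1 * d) d L2.
Proof.
intros Hd H1 H2 Hf. unfold path_int.
assert (Hr : forall t, (0 <= t <= L1 + L2)%R -> rcont (fun s => f (P + RtoC s * d)) t).
{ intros t Ht. apply rcont_line; auto. }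
rewrite (cint_Chasles _ 0 L1) by (auto; lra). f_equal.
pose proof (cint_shift (fun s => f (P + RtoC s * d)) 0 L2 L1 H2) as X.
rewrite Rplus_0_l, (Rplus_comm L2) in X. rewrite <- X.
- apply cint_ext; auto. intros t _. f_equal. rewrite RtoC_plus. ring.
- intros t Ht. apply Hr. lra.
Qed.

Definition rect_int (f : C -> C) (P : C) (W H : R) : C :=
  path_int f P 1 W + Ci * path_int f (P + RtoC W) Ci H
  - path_int f (P + RtoC H * Ci) 1 W - Ci * path_int f P Ci H.

Definition in_rect (P : C) (W H : R) (w : C) : Prop :=
  (Re P <= Re w <= Re P + W /\ Im P <= Im w <= Im P + H)%R.

Ltac inrect := unfold in_rect, Re, Im in *; simpl in *; lra.

Lemma rect_int_split f P W H : (0 <= W)%R -> (0 <= H)%R ->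
  (forall w, in_rect P (W + W) (H + H) w -> ccont f w) ->
  rect_int f P (W + W) (H + H) =
  rect_int f P W H + rect_int f (P + RtoC W) W H +
  rect_int f (P + RtoC H * Ci) W H + rect_int f (P + RtoC W + RtoC H * Ci) W H.
Proof.
intros HW HH Hf.
assert (S1 : forall k, (k = 0 \/ k = H + H)%R ->
  path_int f (P + RtoC k * Ci) 1 (W + W) = path_int f (P + RtoC k * Ci) 1 W +
    path_int f (P + RtoC k * Ci + RtoC W * 1) 1 W).
{ intros k Hk. apply path_int_split; auto using Cmod_1.
  intros t Ht. apply Hf. destruct P. inrect. }
assert (S2 : forall k, (k = 0 \/ k = W + W)%R ->
  path_int f (P + RtoC k) Ci (H + H) = path_int f (P + RtoC k) Ci H +
    path_int f (P + RtoC k + RtoC H * Ci) Ci H).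
{ intros k Hk. apply path_int_split; auto using Cmod_Ci.
  intros t Ht. apply Hf. destruct P. inrect. }
unfold rect_int.
pose proof (S1 0%R ltac:(auto)) as A1. pose proof (S1 (H + H)%R ltac:(auto)) as A2.
pose proof (S2 0%R ltac:(auto)) as A3. pose proof (S2 (W + W)%R ltac:(auto)) as A4.
replace (P + 0 * Ci) with P in A1 by ring.
replace (P + 0) with P in A3 by ring.
rewrite A1, A2, A3, A4. rewrite !RtoC_plus.
replace (P + RtoC W * 1) with (P + RtoC W) by ring.
replace (P + (W + W)) with (P + W + W) by ring.
replace (P + (H + H) * Ci) with (P + H * Ci + H * Ci) by ring.
replace (P + H * Ci + H * Ci + W * 1) with (P + W + H * Ci + H * Ci) by ring.
replace (P + H * Ci + W) with (P + W + H * Ci) by ring.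
replace (P + W + H * Ci + W) with (P + W + W + H * Ci) by ring.
ring.
Qed.

Lemma rect_int_affine A B P W H : (0 <= W)%R -> (0 <= H)%R ->
  rect_int (fun w => A + B * w) P W H = 0.
Proof.
intros HW HH.
assert (X : forall Q d L, (0 <= L)%R -> path_int (fun w => A + B * w) Q d L =
  RtoC L * (A + B * Q) + RtoC (L * L / 2) * (B * d)).
{ intros Q d L HL. unfold path_int.
  rewrite (cint_ext _ _ HL _ (fun t => (A + B * Q) + RtoC t * (B * d)))
    by (intros; ring).
  rewrite cint_affine by auto. rewrite Rminus_0_r, Rmult_0_r, Rminus_0_r. reflexivity. }
unfold rect_int. rewrite !X by auto.
apply C_eq; unfold Re, Im; simpl; field.
Qed.

Lemma rect_int_plus f g P W H : (0 <= W)%R -> (0 <= H)%R ->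
  (forall w, in_rect P W H w -> ccont f w) ->
  (forall w, in_rect P W H w -> ccont g w) ->
  rect_int (fun w => f w + g w) P W H = rect_int f P W H + rect_int g P W H.
Proof.
intros HW HH Hf Hg. unfold rect_int.
assert (X : forall Q d L, (0 <= L)%R -> Cmod d = 1%R ->
  (forall t, (0 <= t <= L)%R -> in_rect P W H (Q + RtoC t * d)) ->
  path_int (fun w => f w + g w) Q d L = path_int f Q d L + path_int g Q d L).
{ intros Q d L HL Hd Hin. unfold path_int. apply cint_plus; auto;
  intros t Ht; apply rcont_line; auto. }
rewrite !X; auto using Cmod_1, Cmod_Ci; try ring;
intros t Ht; destruct P; inrect.
Qed.

Lemma rect_int_bound f P W H M : (0 <= W)%R -> (0 <= H)%R ->
  (forall w, in_rect P W H w -> ccont f w) ->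
  (forall w, in_rect P W H w -> Cmod (f w) <= M)%R ->
  (Cmod (rect_int f P W H) <= 4 * M * (W + H))%R.
Proof.
intros HW HH Hf HM.
assert (X : forall Q d L, (0 <= L)%R -> Cmod d = 1%R ->
  (forall t, (0 <= t <= L)%R -> in_rect P W H (Q + RtoC t * d)) ->
  (Cmod (path_int f Q d L) <= 2 * M * L)%R).
{ intros Q d L HL Hd Hin. unfold path_int.
  pose proof (cint_bound 0 L HL (fun t => f (Q + RtoC t * d)) M) as X.
  rewrite Rminus_0_r in X. apply X; auto. intros t Ht. apply rcont_line; auto. }
unfold rect_int. unfold Cminus.
assert (X1 : (Cmod (path_int f P 1 W) <= 2 * M * W)%R).
{ apply X; auto using Cmod_1. intros t Ht; destruct P; inrect. }
assert (X2 : (Cmod (path_int f (P + W) Ci H) <= 2 * M * H)%R).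
{ apply X; auto using Cmod_Ci. intros t Ht; destruct P; inrect. }
assert (X3 : (Cmod (path_int f (P + H * Ci) 1 W) <= 2 * M * W)%R).
{ apply X; auto using Cmod_1. intros t Ht; destruct P; inrect. }
assert (X4 : (Cmod (path_int f P Ci H) <= 2 * M * H)%R).
{ apply X; auto using Cmod_Ci. intros t Ht; destruct P; inrect. }
eapply Rle_trans; [apply Cmod_triangle |].
eapply Rle_trans; [apply Rplus_le_compat_r, Cmod_triangle |].
eapply Rle_trans; [apply Rplus_le_compat_r, Rplus_le_compat_r, Cmod_triangle |].
rewrite !Cmod_opp, !Cmod_mult, Cmod_Ci. lra.
Qed.

Lemma half_pow_pos W n : (0 < W)%R -> (0 < W / 2 ^ n)%R.
Proof. intros. apply Rdiv_lt_0_compat; auto. apply pow_lt; lra. Qed.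

Lemma half_pow_S W n : (W / 2 ^ n = W / 2 ^ S n + W / 2 ^ S n)%R.
Proof. simpl. field. apply pow_nonzero; lra. Qed.

Lemma nested_intervals (u : nat -> R) W : (0 < W)%R ->
  (forall n, u n <= u (S n) <= u n + W / 2 ^ S n)%R ->
  exists X, forall n, (u n <= X <= u n + W / 2 ^ n)%R.
Proof.
intros HW Hu.
assert (M : forall n k, (u n <= u (n + k)%nat /\
   u (n + k)%nat + W / 2 ^ (n + k) <= u n + W / 2 ^ n)%R).
{ intros n k. induction k as [| k IH]; [rewrite Nat.add_0_r; lra |].
  rewrite Nat.add_succ_r. pose proof (Hu (n + k)%nat).
  pose proof (half_pow_S W (n + k)). lra. }
assert (U : forall m n, (u m <= u n + W / 2 ^ n)%R).
{ intros m n. destruct (Nat.le_gt_cases n m) as [L | L].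
  - replace m with (n + (m - n))%nat by lia. destruct (M n (m - n)%nat).
    pose proof (half_pow_pos W (n + (m - n)) HW). lra.
  - replace n with (m + (n - m))%nat by lia. destruct (M m (n - m)%nat).
    pose proof (half_pow_pos W (m + (n - m)) HW). lra. }
destruct (completeness (fun x => exists n, x = u n)) as [X [H1 H2]].
- exists (u 0%nat + W / 2 ^ 0)%R. intros x [n ->]. apply U.
- now exists (u 0%nat), 0%nat.
- exists X. intros n. split.
  + apply H1. now exists n.
  + apply H2. intros x [m ->]. apply U.
Qed.

(** Dependent choice gives the successive lower left corners, and their coordinates converge by
    [nested_intervals]. The condition on [p'] says that the half-size rectangle at [p'] fits into
    the one at [p]. *)
Lemma nested_rectangles (P : nat -> C -> Prop) p0 W H : (0 < W)%R -> (0 < H)%R ->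
  P 0%nat p0 ->
  (forall n p, P n p -> exists p', P (S n) p' /\
     in_rect p (W / 2 ^ S n) (H / 2 ^ S n) p') ->
  exists q, forall n, exists p, P n p /\ in_rect p (W / 2 ^ n) (H / 2 ^ n) q.
Proof.
intros HW HH H0 HS.
set (next n (s : {p | P n p}) :=
  constructive_indefinite_description _ (HS n (proj1_sig s) (proj2_sig s))).
set (s := fix s (n : nat) : {p | P n p} :=
  match n with
  | O => exist _ p0 H0
  | S n => exist _ (proj1_sig (next n (s n))) (proj1 (proj2_sig (next n (s n))))
  end).
assert (Hs : forall n, in_rect (proj1_sig (s n)) (W / 2 ^ S n) (H / 2 ^ S n)
                         (proj1_sig (s (S n)))).
{ intros n. simpl. exact (proj2 (proj2_sig (next n (s n)))). }
destruct (nested_intervals (fun n => Re (proj1_sig (s n))) W HW) as [X HX].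
{ intros n. apply (Hs n). }
destruct (nested_intervals (fun n => Im (proj1_sig (s n))) H HH) as [Y HY].
{ intros n. apply (Hs n). }
exists (X, Y). intros n. exists (proj1_sig (s n)). split; [apply proj2_sig |].
split; [apply HX | apply HY].
Qed.

Lemma Goursat f P W H : (0 < W)%R -> (0 < H)%R ->
  (forall w, in_rect P W H w -> cdiff f w) -> rect_int f P W H = 0.
Proof.
intros HW HH Hf. apply Cmod_eq_0.
assert (Hc : forall w, in_rect P W H w -> ccont f w).
{ intros w Hw. now apply cdiff_ccont, Hf. }
destruct (Rle_lt_dec (Cmod (rect_int f P W H)) 0) as [L | L].
{ pose proof (Cmod_ge_0 (rect_int f P W H)). lra. }
exfalso. set (J := Cmod (rect_int f P W H)) in *.
destruct (nested_rectangles (fun n p =>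
   (forall w, in_rect p (W / 2 ^ n) (H / 2 ^ n) w -> in_rect P W H w) /\
   (J / 4 ^ n <= Cmod (rect_int f p (W / 2 ^ n) (H / 2 ^ n)))%R) P W H)
  as [q Hq]; auto.
- rewrite !pow_O, !Rdiv_1_r. split; [auto | apply Rle_refl].
- intros n p [I B].
  set (w := (W / 2 ^ S n)%R). set (h := (H / 2 ^ S n)%R).
  assert (w0 : (0 < w)%R) by now apply half_pow_pos.
  assert (h0 : (0 < h)%R) by now apply half_pow_pos.
  rewrite (half_pow_S W n), (half_pow_S H n) in I, B. fold w h in I, B.
  rewrite rect_int_split in B by (lra || (intros; apply Hc, I; auto)).
  assert (I1 : forall p', (p' = p \/ p' = p + w \/ p' = p + h * Ci \/ p' = p + w + h * Ci) ->
    (forall v, in_rect p' w h v -> in_rect P W H v) /\ in_rect p w h p').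
  { intros p' Hp'. split.
    - intros v Hv. apply I. destruct p, p', v.
      destruct Hp' as [E | [E | [E | E]]]; injection E; intros; subst; inrect.
    - destruct p, p'.
      destruct Hp' as [E | [E | [E | E]]]; injection E; intros; subst; inrect. }
  assert (EJ : (J / 4 ^ n = 4 * (J / 4 ^ S n))%R).
  { simpl. field. apply pow_nonzero; lra. }
  rewrite EJ in B. set (K := (J / 4 ^ S n)%R) in *.
  destruct (Rle_dec K (Cmod (rect_int f p w h))) as [Y1 | N1].
  { exists p. destruct (I1 p); auto. }
  destruct (Rle_dec K (Cmod (rect_int f (p + w) w h))) as [Y2 | N2].
  { exists (p + w). destruct (I1 (p + w)); auto. }
  destruct (Rle_dec K (Cmod (rect_int f (p + h * Ci) w h))) as [Y3 | N3].
  { exists (p + h * Ci). destruct (I1 (p + h * Ci)); auto. }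
  exists (p + w + h * Ci). destruct (I1 (p + w + h * Ci)); auto. split; auto. split; auto.
  apply Rnot_lt_le. intros N4.
  assert (B' := B).
  pose proof (Cmod_triangle (rect_int f p w h + rect_int f (p + w) w h + rect_int f (p + h * Ci) w h) (rect_int f (p + w + h * Ci) w h)).
  pose proof (Cmod_triangle (rect_int f p w h + rect_int f (p + w) w h) (rect_int f (p + h * Ci) w h)).
  pose proof (Cmod_triangle (rect_int f p w h) (rect_int f (p + w) w h)). lra.
- assert (Hq0 : in_rect P W H q).
  { destruct (Hq 0%nat) as [p [[I _] Hp]]. now apply I. }
  destruct (Hf q Hq0) as [l Hl].
  (* The lower bound J / 4^n becomes 8 eps (w + h)^2 for the sides w, h of the n-th rectangle,
     against the upper bound 4 eps (w + h)^2 obtained below. *)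
  set (eps := (J / (8 * ((W + H) * (W + H))))%R).
  assert (Heps : (0 < eps)%R) by (apply Rdiv_lt_0_compat; nra).
  destruct (cder_small _ _ _ Hl eps Heps) as [d [Hd Hs]].
  assert (Hn : exists n, ((W + H) / 2 ^ n < d)%R).
  { destruct (pow_lt_1_zero (/ 2) ltac:(rewrite Rabs_pos_eq; lra) (d / (W + H)))
      as [N HN]; [apply Rdiv_lt_0_compat; lra |].
    exists N. specialize (HN N (Nat.le_refl _)).
    rewrite Rabs_pos_eq in HN by (apply pow_le; lra).
    rewrite pow_inv in HN. apply Rlt_div_r in HN; [| lra].
    unfold Rdiv. lra. }
  destruct Hn as [n Hn]. destruct (Hq n) as [p [[I B] Hp]].
  pose proof (half_pow_pos W n HW) as w0. pose proof (half_pow_pos H n HH) as h0.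
  assert (E4 : (J / 4 ^ n = 8 * eps * ((W / 2 ^ n + H / 2 ^ n) * (W / 2 ^ n + H / 2 ^ n)))%R).
  { unfold eps. replace 4%R with (2 * 2)%R by ring. rewrite Rpow_mult_distr.
    field. split; [apply pow_nonzero; lra | lra]. }
  rewrite E4 in B.
  replace ((W + H) / 2 ^ n)%R with (W / 2 ^ n + H / 2 ^ n)%R in Hn
    by (field; apply pow_nonzero; lra).
  set (w := (W / 2 ^ n)%R) in *. set (h := (H / 2 ^ n)%R) in *.
  (* The tangent affine function at q is subtracted: its integral over a rectangle is 0, and the
     remainder is at most eps |v - q|. *)
  set (r := fun v => f v + ((l * q - f q) + - l * v)).
  assert (Hr : forall v, in_rect p w h v -> ccont r v).
  { intros v Hv. unfold r. apply ccont_plus; [now apply Hc, I |].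
    apply cdiff_ccont.
    apply (cdiff_ext (fun v => - l * v + (l * q - f q))); [| apply cdiff_lin].
    apply near_all. intros; ring. }
  assert (Er : rect_int r p w h = rect_int f p w h).
  { unfold r. rewrite rect_int_plus; try lra.
    - rewrite rect_int_affine by lra. ring.
    - intros v Hv. now apply Hc, I.
    - intros v Hv. apply cdiff_ccont.
      apply (cdiff_ext (fun v => - l * v + (l * q - f q))); [| apply cdiff_lin].
      apply near_all. intros; ring. }
  rewrite <- Er in B.
  assert (Hb : (Cmod (rect_int r p w h) <= 4 * (eps * (w + h)) * (w + h))%R).
  { apply rect_int_bound; try lra; auto. intros v Hv.
    assert (Hvq : (Cmod (v - q) <= w + h)%R).
    { eapply Rle_trans; [apply Cmod_le_Re_Im |].
      apply Rplus_le_compat; apply Rabs_le; destruct p, q, v; inrect. }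
    unfold r. replace (f v + (l * q - f q + - l * v)) with (f v - f q - l * (v - q)) by ring.
    eapply Rle_trans; [apply Hs; lra |]. apply Rmult_le_compat_l; lra. }
  assert (0 < eps * ((w + h) * (w + h)))%R by (apply Rmult_lt_0_compat; nra).
  nra.
Qed.

(** * Periodic functions on horizontal strips *)

Lemma Csum_ext {A} (l : list A) f g :
  (forall a, In a l -> f a = g a) -> Csum l f = Csum l g.
Proof.
induction l as [| a l IH]; intros H; simpl; auto.
rewrite H by now left. f_equal. apply IH. intros b Hb. apply H. now right.
Qed.

Lemma Csum_plus {A} (l : list A) f g :
  Csum l (fun a => f a + g a) = Csum l f + Csum l g.
Proof. induction l as [| a l IH]; simpl; [ring | rewrite IH; ring]. Qed.

Lemma Csum_scal {A} (l : list A) c f : Csum l (fun a => c * f a) = c * Csum l f.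
Proof. induction l as [| a l IH]; simpl; [ring | rewrite IH; ring]. Qed.

(** One period of the horizontal line through [P]; for 1-periodic continuous [F] only [Im P]
    matters, by [lint_Im]. *)
Definition lint (F : C -> C) (P : C) : C := path_int F P 1 1.

Lemma lint_ext F G P : (forall t : R, F (P + RtoC t) = G (P + RtoC t)) -> lint F P = lint G P.
Proof.
intros H. unfold lint, path_int. apply cint_ext; [lra |].
intros t _. replace (t * 1) with (RtoC t) by ring. apply H.
Qed.

Lemma rcont_lint F P (t : R) :
  (forall t : R, ccont F (P + RtoC t)) -> rcont (fun s => F (P + RtoC s * 1)) t.
Proof.
intros H. apply rcont_line; [apply Cmod_1 |].
replace (t * 1) with (RtoC t) by ring. apply H.
Qed.

Lemma lint_plus F G P :
  (forall t : R, ccont F (P + RtoC t)) -> (forall t : R, ccont G (P + RtoC t)) ->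
  lint (fun w => F w + G w) P = lint F P + lint G P.
Proof.
intros HF HG. apply cint_plus; [lra | |]; intros t _; now apply rcont_lint.
Qed.

Lemma lint_scal c F P : (forall t : R, ccont F (P + RtoC t)) ->
  lint (fun w => c * F w) P = c * lint F P.
Proof.
intros HF. unfold lint, path_int.
apply (cint_scal 0 1 ltac:(lra) c (fun t => F (P + RtoC t * 1))).
intros t _; now apply rcont_lint.
Qed.

Lemma lint_const c P : lint (fun _ => c) P = c.
Proof.
unfold lint, path_int. rewrite (cint_ext 0 1 ltac:(lra) _ (fun t => c + RtoC t * 0))
  by (intros; ring).
rewrite cint_affine by lra. replace (1 - 0)%R with 1%R by ring. ring.
Qed.

Lemma lint_bound F P M : (forall t : R, ccont F (P + RtoC t)) ->
  (forall t : R, (0 <= t <= 1)%R -> (Cmod (F (P + RtoC t)%C) <= M)%R) ->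
  (Cmod (lint F P) <= 2 * M)%R.
Proof.
intros HF HM. unfold lint, path_int.
replace (2 * M)%R with (2 * M * (1 - 0))%R by ring.
apply cint_bound; [lra | |].
- intros t _. now apply rcont_lint.
- intros t Ht. replace (t * 1) with (RtoC t) by ring. now apply HM.
Qed.

(** A segment of length 1 + r is cut after 1 and after r; the two pieces of length r agree by
    periodicity. For negative r the two base points exchange their roles. *)
Lemma lint_real_shift F P (r : R) :
  (forall t : R, ccont F (P + RtoC t)) ->
  (forall t : R, F (P + RtoC t + 1) = F (P + RtoC t)) ->
  lint F (P + RtoC r) = lint F P.
Proof.
assert (X : forall P (r : R), (0 <= r)%R -> (forall t : R, ccont F (P + RtoC t)) ->
  (forall t : R, F (P + RtoC t + 1) = F (P + RtoC t)) ->
  lint F (P + RtoC r) = lint F P).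
{ clear P r. intros P r Hr Hc Hp. unfold lint.
  assert (Hc' : forall t, ccont F (P + RtoC t * 1)).
  { intros t. replace (t * 1) with (RtoC t) by ring. apply Hc. }
  pose proof (path_int_split F P 1 1 r Cmod_1 ltac:(lra) Hr (fun t _ => Hc' t)) as E1.
  pose proof (path_int_split F P 1 r 1 Cmod_1 Hr ltac:(lra) (fun t _ => Hc' t)) as E2.
  rewrite Rplus_comm, E1 in E2.
  assert (E3 : path_int F (P + 1 * 1) 1 r = path_int F P 1 r).
  { apply cint_ext; auto. intros t _.
    replace (P + 1 * 1 + t * 1) with (P + t + 1) by ring. rewrite Hp. f_equal. ring. }
  rewrite E3 in E2. replace (r * 1) with (RtoC r) in E2 by ring.
  replace (path_int F P 1 1)
    with (path_int F P 1 1 + path_int F P 1 r - path_int F P 1 r) by ring.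
  rewrite E2. ring. }
intros Hc Hp. destruct (Rle_lt_dec 0 r) as [Hr | Hr]; [now apply X |].
rewrite <- (X (P + RtoC r) (- r)%R); [| lra | |].
- f_equal. rewrite RtoC_opp. ring.
- intros t. replace (P + r + t) with (P + RtoC (r + t)) by (rewrite RtoC_plus; ring). auto.
- intros t. replace (P + r + t) with (P + RtoC (r + t)) by (rewrite RtoC_plus; ring). auto.
Qed.

Lemma lint_Im F P Q :
  (forall t : R, ccont F (P + RtoC t)) ->
  (forall t : R, F (P + RtoC t + 1) = F (P + RtoC t)) ->
  Im P = Im Q -> lint F Q = lint F P.
Proof.
intros Hc Hp E. rewrite <- (lint_real_shift F P (Re Q - Re P)); auto.
f_equal. apply C_eq; unfold Re, Im in *; simpl; lra.
Qed.

(** In Goursat's theorem for a rectangle of width 1 the vertical sides cancel by periodicity. *)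
Lemma lint_up F P h : (0 < h)%R ->
  (forall w, (Im P <= Im w <= Im P + h)%R -> cdiff F w) ->
  (forall w, (Im P <= Im w <= Im P + h)%R -> F (w + 1) = F w) ->
  lint F (P + RtoC h * Ci) = lint F P.
Proof.
intros Hh Hd Hp.
pose proof (Goursat F P 1 h ltac:(lra) Hh (fun w Hw => Hd w (proj2 Hw))) as G.
unfold rect_int in G. unfold lint.
assert (E : path_int F (P + 1) Ci h = path_int F P Ci h).
{ apply cint_ext; [lra |]. intros t Ht. rewrite <- (Hp (P + RtoC t * Ci)).
  - f_equal. ring.
  - destruct P; unfold Im; simpl; lra. }
rewrite E in G.
replace (path_int F P 1 1) with (path_int F P 1 1 + Ci * path_int F P Ci h -
  path_int F (P + h * Ci) 1 1 - Ci * path_int F P Ci h + path_int F (P + h * Ci) 1 1) by ring.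
rewrite G. ring.
Qed.

Lemma lint_decay G P :
  (forall eps : R, (0 < eps)%R -> exists Q, lint G Q = lint G P /\
     forall t : R, ccont G (Q + RtoC t) /\ (Cmod (G (Q + RtoC t)%C) <= eps)%R) ->
  lint G P = 0.
Proof.
intros H. apply Cmod_eq_0.
destruct (Rle_lt_dec (Cmod (lint G P)) 0) as [L | L].
{ pose proof (Cmod_ge_0 (lint G P)). lra. }
exfalso. destruct (H (Cmod (lint G P) / 4)%R ltac:(lra)) as [Q [E HQ]].
pose proof (lint_bound G Q (Cmod (lint G P) / 4) (fun t => proj1 (HQ t))
  (fun t _ => proj2 (HQ t))) as B. rewrite E in B. lra.
Qed.

(** The 1-periodic model of a simple pole at p. It tends to 0 as Im w goes to minus infinity and to
    -1 as Im w goes to plus infinity, so its period integral is 0 below p and -1 above. *)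
Definition pole_fun (p w : C) : C := / (e (w - p) - 1).

Lemma cdiff_e_minus p w : cdiff (fun v => e (v - p)) w.
Proof.
apply (cdiff_ext (fun v => e (1 * v + - p))); [| apply cdiff_e_lin].
apply near_all. intros v. f_equal. ring.
Qed.

Lemma cdiff_pole_fun p w : e (w - p) <> 1 -> cdiff (pole_fun p) w.
Proof.
intros H. apply (cdiff_inv (fun v => e (v - p) - 1)).
- apply cdiff_plus; [apply cdiff_e_minus | apply cdiff_const].
- intros E. now apply H, Ceq_minus.
Qed.

Lemma e_minus_Im p w : Im w <> Im p -> e (w - p) <> 1.
Proof.
intros H E. apply (f_equal Cmod) in E. rewrite Cmod_e, Cmod_1, <- exp_0 in E.
apply exp_inv in E. pose proof PI_RGT_0.
replace (Im (w - p)) with (Im w - Im p)%R in E by reflexivity. apply H. nra.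
Qed.

Lemma e_add_1 w : e (w + 1) = e w.
Proof. rewrite e_plus, e_1. ring. Qed.

Lemma pole_fun_add_1 p w : pole_fun p (w + 1) = pole_fun p w.
Proof.
unfold pole_fun. replace (w + 1 - p) with (w - p + 1) by ring. now rewrite e_add_1.
Qed.

Lemma inv_minus_1_bound u d : (0 < d)%R -> (1 + d <= Cmod u)%R -> (Cmod (/ (u - 1)) <= / d)%R.
Proof.
intros Hd Hu.
assert (L : (d <= Cmod (u - 1))%R).
{ pose proof (Cmod_triangle (u - 1) 1) as T. rewrite Cmod_1 in T.
  replace (u - 1 + 1) with u in T by ring. lra. }
rewrite Cmod_inv.
- apply Rinv_le_contravar; auto.
- intros E. rewrite E, Cmod_0 in L. lra.
Qed.

Lemma pole_fun_below p P : (Im P < Im p)%R -> lint (pole_fun p) P = 0.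
Proof.
intros HP. apply lint_decay. intros eps He.
assert (Hh : (0 < / eps)%R) by now apply Rinv_0_lt_compat.
(* At this depth exp x >= 1 + x makes |e(w - p)| at least 1 + 1 / eps. *)
exists (P - RtoC (/ eps) * Ci). split.
- rewrite <- (lint_up _ (P - RtoC (/ eps) * Ci) (/ eps)); auto.
  + f_equal. ring.
  + intros w Hw. apply cdiff_pole_fun, e_minus_Im. unfold Im in *; simpl in *; lra.
  + intros w _. apply pole_fun_add_1.
- intros t.
  assert (EI : Im (P - RtoC (/ eps) * Ci + RtoC t) = (Im P - / eps)%R)
    by (unfold Im; simpl; ring).
  split.
  + apply cdiff_ccont, cdiff_pole_fun, e_minus_Im. lra.
  + apply Rle_trans with (/ / eps)%R; [| rewrite Rinv_inv; lra]. apply inv_minus_1_bound; auto.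
    rewrite Cmod_e.
    replace (Im (P - RtoC (/ eps) * Ci + t - p)) with (Im P - / eps - Im p)%R
      by (unfold Im; simpl; ring).
    pose proof PI_RGT_0. pose proof (PI2_1).
    eapply Rle_trans; [| apply exp_ineq1_le]. nra.
Qed.

(** After adding 1 the argument of [pole_fun_below] works upwards, because 1 / (u - 1) + 1 = - 1 /
    (1 / u - 1). *)
Lemma pole_fun_above p P : (Im p < Im P)%R -> lint (pole_fun p) P = -1.
Proof.
intros HP.
assert (Hc : forall w, Im w <> Im p -> ccont (pole_fun p) w).
{ intros w Hw. now apply cdiff_ccont, cdiff_pole_fun, e_minus_Im. }
assert (E0 : lint (fun w => pole_fun p w + 1) P = 0).
{ apply lint_decay. intros eps He.
  assert (Hh : (0 < / eps)%R) by now apply Rinv_0_lt_compat.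
  exists (P + RtoC (/ eps) * Ci). split.
  - apply lint_up; auto.
    + intros w Hw. apply cdiff_plus; [| apply cdiff_const].
      apply cdiff_pole_fun, e_minus_Im. lra.
    + intros w _. now rewrite pole_fun_add_1.
  - intros t.
    assert (EI : Im (P + RtoC (/ eps) * Ci + RtoC t) = (Im P + / eps)%R)
      by (unfold Im; simpl; ring).
    split.
    + apply ccont_plus; [| apply ccont_const]. apply Hc. lra.
    + assert (En : e (P + RtoC (/ eps) * Ci + t - p) <> 1) by (apply e_minus_Im; lra).
      unfold pole_fun. set (x := P + RtoC (/ eps) * Ci + t - p) in *.
      assert (Ex : / (e x - 1) + 1 = - / (e (- x) - 1)).
      { rewrite e_opp. field. repeat split.
        - apply e_neq_0.
        - intros E. apply En. symmetry. now apply Ceq_minus.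
        - intros E. now apply En, Ceq_minus. }
      rewrite Ex, Cmod_opp. apply Rle_trans with (/ / eps)%R; [| rewrite Rinv_inv; lra].
      apply inv_minus_1_bound; auto. rewrite Cmod_e.
      replace (Im (- x)) with (- (Im P + / eps - Im p))%R
        by (unfold x, Im; simpl; ring).
      pose proof PI_RGT_0. pose proof (PI2_1).
      eapply Rle_trans; [| apply exp_ineq1_le]. nra. }
rewrite lint_plus in E0.
- rewrite lint_const in E0.
  replace (lint (pole_fun p) P) with (lint (pole_fun p) P + 1 - 1) by ring.
  rewrite E0. ring.
- intros t. apply Hc. unfold Im in *; simpl; lra.
- intros t. apply ccont_const.
Qed.

(* By uniform continuity of [F] near the compact segment of integration. *)
Lemma lint_continuous F A B y : (A < y < B)%R ->
  (forall w, (A < Im w < B)%R -> ccont F w) ->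
  rcont (fun y => lint F (0, y)%R) y.
Proof.
intros Hy Hc eps He.
assert (Hx : forall x : R, exists d : posreal,
  forall w, (Cmod (w - (x, y)%R) < 2 * d)%R -> (Cmod (F w - F (x, y)%R) < eps / 8)%R).
{ intros x. destruct (Hc (x, y)%R Hy (eps / 8)%R ltac:(lra)) as [d [Hd H]].
  assert (Hd2 : (0 < d / 2)%R) by lra. exists (mkposreal _ Hd2). simpl.
  intros w Hw. apply H. lra. }
set (del := fun x => proj1_sig (constructive_indefinite_description _ (Hx x))).
assert (Hdel : forall x w, (Cmod (w - (x, y)%R) < 2 * del x)%R ->
  (Cmod (F w - F (x, y)%R) < eps / 8)%R).
{ intros x. apply (proj2_sig (constructive_indefinite_description _ (Hx x))). }
(* A Lebesgue number: up to a double negation, every t in [0, 1] has some x with |t - x| < del x and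
   d <= del x. *)
destruct (compactness_value_1d 0 1 del) as [d Hd].
exists (Rmin d (Rmin (y - A) (B - y))). split.
{ repeat apply Rmin_glb_lt; try lra. apply cond_pos. }
intros s Hs.
assert (Hs1 : (Rabs (s - y) < d)%R) by (eapply Rlt_le_trans; [apply Hs | apply Rmin_l]).
assert (Hs2 : (A < s < B)%R).
{ pose proof (Rmin_r d (Rmin (y - A) (B - y))). pose proof (Rmin_l (y - A) (B - y)).
  pose proof (Rmin_r (y - A) (B - y)). apply Rabs_lt_between in Hs. lra. }
assert (Hcl : forall u t : R, (A < u < B)%R -> rcont (fun t => F ((0, u)%R + RtoC t * 1)) t).
{ intros u t Hu. apply rcont_lint. intros t'. apply Hc. simpl. lra. }
assert (E : lint F (0, s)%R - lint F (0, y)%R =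
  cint (fun t => F ((0, s)%R + RtoC t * 1) + (- (1)) * F ((0, y)%R + RtoC t * 1)) 0 1).
{ rewrite cint_plus, cint_scal; try lra.
  - unfold lint, path_int. ring.
  - intros t _. apply Hcl; lra.
  - intros t _. apply Hcl; lra.
  - intros t _ e1 He1. destruct (Hcl y t Hy e1 He1) as [d1 [Hd1 H1]].
    exists d1. split; auto. intros s' Hs'.
    replace (_ - _) with (- (F ((0, y)%R + s' * 1) - F ((0, y)%R + t * 1))) by ring.
    rewrite Cmod_opp. now apply H1. }
rewrite E. apply Rle_lt_trans with (2 * (eps / 4) * (1 - 0))%R; [| lra].
apply cint_bound; try lra.
- intros t _ e1 He1. destruct (Hcl y t Hy (e1 / 2)%R ltac:(lra)) as [d1 [Hd1 H1]].
  destruct (Hcl s t Hs2 (e1 / 2)%R ltac:(lra)) as [d2 [Hd2 H2]].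
  exists (Rmin d1 d2). split; [now apply Rmin_glb_lt |]. intros s' Hs'.
  specialize (H1 s' ltac:(eapply Rlt_le_trans; [apply Hs' | apply Rmin_l])).
  specialize (H2 s' ltac:(eapply Rlt_le_trans; [apply Hs' | apply Rmin_r])).
  replace (_ - _) with ((F ((0, s)%R + s' * 1) - F ((0, s)%R + t * 1)) +
    - (F ((0, y)%R + s' * 1) - F ((0, y)%R + t * 1))) by ring.
  eapply Rle_lt_trans; [apply Cmod_triangle |]. rewrite Cmod_opp. lra.
- intros t Ht.
  destruct (Rle_lt_dec (Cmod (F ((0, s)%R + RtoC t * 1) + (- (1)) * F ((0, y)%R + RtoC t * 1))%C)
              (eps / 4)) as [ok | bad]; auto.
  exfalso. apply (Hd t Ht). intros [x [Hx1 [Hx2 Hx3]]].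
  assert (B1 : (Cmod (F ((0, s)%R + t * 1) - F (x, y)%R)%C < eps / 8)%R).
  { apply Hdel. eapply Rle_lt_trans; [apply Cmod_le_Re_Im |].
    unfold Re, Im; simpl.
    replace (0 + (t * 1 - 0 * 0) + - x)%R with (t - x)%R by ring.
    replace (s + (t * 0 + 0 * 1) + - y)%R with (s - y)%R by ring. lra. }
  assert (B2 : (Cmod (F ((0, y)%R + t * 1) - F (x, y)%R)%C < eps / 8)%R).
  { apply Hdel. eapply Rle_lt_trans; [apply Cmod_le_Re_Im |].
    unfold Re, Im; simpl.
    replace (0 + (t * 1 - 0 * 0) + - x)%R with (t - x)%R by ring.
    replace (y + (t * 0 + 0 * 1) + - y)%R with 0%R by ring. rewrite Rabs_R0.
    pose proof (cond_pos (del x)). lra. }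
  apply (Rlt_not_le _ _ bad).
  replace (F ((0, s)%R + t * 1) + (- (1)) * F ((0, y)%R + t * 1)) with
    ((F ((0, s)%R + t * 1) - F (x, y)%R) + - (F ((0, y)%R + t * 1) - F (x, y)%R)) by ring.
  eapply Rle_trans; [apply Cmod_triangle |]. rewrite Cmod_opp. lra.
Qed.

Lemma rcont_eq (f : R -> C) (y : R) c :
  rcont f y ->
  (forall d : R, (0 < d)%R -> exists v, (Rabs (v - y) < d)%R /\ f v = c) -> f y = c.
Proof.
intros Hf H. apply Ceq_minus, Cmod_eq_0.
destruct (Rle_lt_dec (Cmod (f y - c)) 0) as [L | L].
{ pose proof (Cmod_ge_0 (f y - c)). lra. }
exfalso. destruct (Hf _ L) as [d [Hd H1]]. destruct (H d Hd) as [v [Hv E]].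
specialize (H1 v Hv). rewrite E in H1.
rewrite <- Cmod_opp in H1. replace (- (c - f y)) with (f y - c) in H1 by ring. lra.
Qed.

(** Induction on the exceptional points: a point y inside the interval cuts it in two, and the
    constancy on either side extends to y by continuity. *)
Lemma piecewise_constant (f : R -> C) (Ys : list R) : forall y1 y2, (y1 <= y2)%R ->
  (forall y, (y1 <= y <= y2)%R -> rcont f y) ->
  (forall u v, (y1 <= u)%R -> (u < v)%R -> (v <= y2)%R ->
     (forall y, In y Ys -> ~ (u <= y <= v)%R) -> f u = f v) ->
  f y1 = f y2.
Proof.
induction Ys as [| y Ys IH]; intros y1 y2 L Hc Hf.
- destruct (Rle_lt_or_eq_dec _ _ L) as [L' | ->]; auto.
  apply Hf; try lra. intros y [].
- destruct (Rlt_le_dec y y1) as [Ly | Ly];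
  [| destruct (Rlt_le_dec y2 y) as [Ly' | Ly']].
  + apply IH; auto. intros u v Hu Huv Hv H. apply Hf; auto.
    intros y' [-> | Hy']; [lra | auto].
  + apply IH; auto. intros u v Hu Huv Hv H. apply Hf; auto.
    intros y' [-> | Hy']; [lra | auto].
  + transitivity (f y).
    * destruct (Rle_lt_or_eq_dec _ _ Ly) as [L' | ->]; auto. symmetry.
      apply rcont_eq; [apply Hc; lra |]. intros d Hd.
      assert (Hm : (0 < Rmin (d / 2) (y - y1))%R) by (apply Rmin_glb_lt; lra).
      pose proof (Rmin_l (d / 2) (y - y1)). pose proof (Rmin_r (d / 2) (y - y1)).
      exists (y - Rmin (d / 2) (y - y1))%R. split.
      { apply Rabs_lt_between. lra. }
      symmetry. apply IH; [lra | intros; apply Hc; lra |].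
      intros u v Hu Huv Hv H1. apply Hf; try lra. intros y' [-> | Hy']; [lra | auto].
    * destruct (Rle_lt_or_eq_dec _ _ Ly') as [L' | ->]; auto.
      apply rcont_eq; [apply Hc; lra |]. intros d Hd.
      assert (Hm : (0 < Rmin (d / 2) (y2 - y))%R) by (apply Rmin_glb_lt; lra).
      pose proof (Rmin_l (d / 2) (y2 - y)). pose proof (Rmin_r (d / 2) (y2 - y)).
      exists (y + Rmin (d / 2) (y2 - y))%R. split.
      { apply Rabs_lt_between. lra. }
      apply IH; [lra | intros; apply Hc; lra |].
      intros u v Hu Huv Hv H1. apply Hf; try lra. intros y' [-> | Hy']; [lra | auto].
Qed.

(** [H] will be the extension of a regular part; at the heights [Ys] of the poles only its
    continuity is available. *)
Lemma lint_strip_constant H Ys A B :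
  (forall w, (A < Im w < B)%R -> H (w + 1) = H w) ->
  (forall w, (A < Im w < B)%R -> ccont H w) ->
  (forall w, (A < Im w < B)%R -> ~ In (Im w) Ys -> cdiff H w) ->
  forall P Q, (A < Im P < B)%R -> (A < Im Q < B)%R -> lint H P = lint H Q.
Proof.
intros Hp Hc Hd.
assert (X : forall y1 y2, (A < y1)%R -> (y1 <= y2)%R -> (y2 < B)%R ->
  lint H (0, y1)%R = lint H (0, y2)%R).
{ intros y1 y2 L1 L L2.
  apply (piecewise_constant (fun y => lint H (0, y)%R) Ys); auto.
  - intros y Hy. apply (lint_continuous H A B); auto. lra.
  - intros u v Hu Huv Hv HY.
    replace ((0, v)%R : C) with ((0, u)%R + RtoC (v - u) * Ci)
      by (apply C_eq; unfold Re, Im; simpl; ring).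
    symmetry. apply lint_up; [lra | |]; simpl; intros w Hw.
    + apply Hd; [lra |]. intros Hin. apply (HY _ Hin). lra.
    + apply Hp; lra. }
assert (Y : forall P, (A < Im P < B)%R -> lint H P = lint H (0, Im P)%R).
{ intros P HP. apply lint_Im; auto.
  - intros t. apply Hc. simpl. lra.
  - intros t. apply Hp. simpl. lra. }
intros P Q HP HQ. rewrite (Y P HP), (Y Q HQ).
destruct (Rle_lt_dec (Im P) (Im Q)) as [L | L].
- apply X; lra.
- symmetry. apply X; lra.
Qed.

(** * Removable singularities and the residue theorem on a strip *)

(** [L] is the limit of [Q] at [w]. The value [Q w] is ignored, since functions take arbitrary
    values at their poles. *)
Definition removable (Q : C -> C) (w L : C) : Prop :=
  exists h : C -> C, ccont h w /\ h w = L /\ near w (fun v => v <> w -> Q v = h v).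

Lemma removable_near Q w L : removable Q w L ->
  forall eps : R, (0 < eps)%R ->
  near w (fun v => v <> w -> (Cmod (Q v - L) < eps)%R).
Proof.
intros [h [Hh [E H]]] eps He. generalize (near_and _ _ _ (Hh eps He) H).
apply near_imp. intros v [H1 H2] n. now rewrite H2, <- E by auto.
Qed.

Lemma near_limit_le Q w L M eps : removable Q w L ->
  near w (fun v => v <> w -> (Cmod (Q v - M) < eps)%R) -> (Cmod (L - M) <= eps)%R.
Proof.
intros HL HM. apply Rnot_lt_le. intros Hlt.
assert (He : (0 < Cmod (L - M) - eps)%R) by lra.
destruct (near_pt w _ 1 ltac:(lra) (near_and _ _ _ (removable_near _ _ _ HL _ He) HM))
  as [v [n [_ [H1 H2]]]].
specialize (H1 n). specialize (H2 n).
pose proof (Cmod_triangle (- (Q v - L)) (Q v - M)) as T. rewrite Cmod_opp in T.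
replace (- (Q v - L) + (Q v - M)) with (L - M) in T by ring. lra.
Qed.

Lemma removable_unique Q w L M : removable Q w L -> removable Q w M -> L = M.
Proof.
intros HL HM. apply Ceq_minus, Cmod_eq_0.
destruct (Rle_lt_dec (Cmod (L - M)) 0) as [l | l].
{ pose proof (Cmod_ge_0 (L - M)). lra. }
exfalso. assert (He : (0 < Cmod (L - M) / 2)%R) by lra.
pose proof (near_limit_le Q w L M _ HL (removable_near _ _ _ HM _ He)). lra.
Qed.

Lemma removable_shift Q w L a :
  near w (fun v => v <> w -> Q (v + a) = Q v) -> removable Q w L -> removable Q (w + a) L.
Proof.
intros HQ [h [Hh [E H]]]. exists (fun v => h (v - a)). split; [| split].
- apply (ccont_comp h).
  + apply (ccont_plus (fun w => w) (fun _ => - a)); [apply ccont_id | apply ccont_const].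
  + now replace (w + a - a) with w by ring.
- now replace (w + a - a) with w by ring.
- generalize (near_shift _ a _ (near_and _ _ _ HQ H)). apply near_imp.
  intros v [H1 H2] n.
  assert (n' : v - a <> w) by (intros E'; apply n; rewrite <- E'; ring).
  rewrite <- H2, <- H1 by auto. f_equal. ring.
Qed.

(** Near w all values of [Q] off w are within eps/2 of [H w], hence so are their limits [H v]. *)
Lemma extension_ccont Q H w :
  near w (fun v => removable Q v (H v)) -> ccont H w.
Proof.
intros HQ eps He. pose proof (near_self _ _ HQ) as Hw.
assert (He2 : (0 < eps / 2)%R) by lra.
pose proof (near_near _ _ (removable_near _ _ _ Hw _ He2)) as N.
generalize (near_and _ _ _ HQ N). apply near_imp. intros v [Hv N'].
assert (Hle : (Cmod (H v - H w) <= eps / 2)%R); [| lra].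
destruct (Ceq_dec v w) as [-> | n].
- replace (H w - H w) with (RtoC 0) by ring. rewrite Cmod_0. lra.
- apply (near_limit_le Q v); auto.
  generalize (near_and _ _ _ N' (near_neq _ _ n)). apply near_imp. tauto.
Qed.

Definition polar_part (Ps : list (C * C)) (w : C) : C :=
  Csum Ps (fun p => snd p * pole_fun (fst p) w).

Lemma cdiff_polar_part (Ps : list (C * C)) w :
  (forall p, In p Ps -> e (w - fst p) = 1 -> snd p = 0) -> cdiff (polar_part Ps) w.
Proof.
induction Ps as [| p Ps IH]; intros H; simpl.
- apply cdiff_const.
- apply cdiff_plus; [| apply IH; intros q Hq; apply H; now right].
  destruct (Ceq_dec (e (w - fst p)) 1) as [E | n].
  + rewrite (H p) by (auto; now left).
    apply (cdiff_ext (fun _ => RtoC 0)); [| apply cdiff_const].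
    apply near_all. intros; ring.
  + apply cdiff_mult; [apply cdiff_const | now apply cdiff_pole_fun].
Qed.

Lemma lint_polar_part (Ps : list (C * C)) P :
  (forall p, In p Ps -> Im (fst p) = Im P -> snd p = 0) ->
  lint (polar_part Ps) P =
  - Csum Ps (fun p => if Rlt_dec (Im (fst p)) (Im P) then snd p else 0).
Proof.
intros H.
assert (Hc : forall Ps : list (C * C), (forall p, In p Ps -> Im (fst p) = Im P -> snd p = 0) ->
  forall t : R, ccont (polar_part Ps) (P + RtoC t)).
{ intros Qs HQ t. apply cdiff_ccont, cdiff_polar_part. intros p Hp E. apply HQ; auto.
  destruct (Req_dec (Im (P + t)) (Im (fst p))) as [E' | n].
  - rewrite <- E'. unfold Im; simpl; ring.
  - now elim (e_minus_Im _ _ n). }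
induction Ps as [| p Ps IH]; simpl.
- change (lint (fun _ => RtoC 0) P = - 0). rewrite lint_const. ring.
- change (lint (polar_part (p :: Ps)) P) with
    (lint (fun w => snd p * pole_fun (fst p) w + polar_part Ps w) P).
  rewrite lint_plus.
  + rewrite IH by (intros q Hq; apply H; now right).
    assert (E : lint (fun w => snd p * pole_fun (fst p) w) P =
       - (if Rlt_dec (Im (fst p)) (Im P) then snd p else 0)).
    { destruct (Req_dec (Im (fst p)) (Im P)) as [E | n].
      - rewrite (H p) by (auto; now left).
        rewrite (lint_ext _ (fun _ => 0)), lint_const by (intros; ring).
        destruct Rlt_dec; ring.
      - rewrite lint_scal.
        + destruct Rlt_dec.
          * rewrite pole_fun_above by auto. ring.
          * rewrite pole_fun_below by lra. ring.
        + intros t. apply cdiff_ccont, cdiff_pole_fun, e_minus_Im.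
          unfold Im in *; simpl; lra. }
    rewrite E. ring.
  + intros t. apply (ccont_ext (polar_part (p :: nil))).
    * apply near_all. intros w. unfold polar_part; simpl. ring.
    * apply Hc. intros q [<- | []]. apply H. now left.
  + apply Hc. intros q Hq. apply H. now right.
Qed.

(** Several listed points may agree with w modulo 1, so their coefficients are added. *)
Definition residue_sum (Ps : list (C * C)) (w : C) : C :=
  Csum Ps (fun p => if Ceq_dec (e (w - fst p)) 1 then snd p else 0).

(** In the second case differentiability of [g] at the one point [w] is enough for a continuous
    regular part. Requiring a listed point there makes [F] differentiable at every height without
    listed points. *)
Definition has_simple_poles (F : C -> C) (Ps : list (C * C)) (w : C) : Prop :=
  (cdiff F w /\ forall p, In p Ps -> e (w - fst p) = 1 -> snd p = 0) \/
  ((exists p, In p Ps /\ e (w - fst p) = 1) /\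
   exists g, cdiff g w /\ g w = residue_sum Ps w /\
     near w (fun v => v <> w -> F v * (e (v - w) - 1) = g v)).

Lemma polar_part_split Ps w v :
  polar_part Ps v =
  residue_sum Ps w * pole_fun w v +
  polar_part (map (fun p => (fst p, if Ceq_dec (e (w - fst p)) 1 then RtoC 0 else snd p)) Ps) v.
Proof.
unfold polar_part, residue_sum.
induction Ps as [| p Ps IH]; simpl; [ring |]. rewrite IH.
destruct (Ceq_dec (e (w - fst p)) 1) as [E | n]; [| ring].
replace (pole_fun (fst p) v) with (pole_fun w v); [ring |].
unfold pole_fun. replace (v - fst p) with ((v - w) + (w - fst p)) by ring.
rewrite e_plus, E. now rewrite Cmult_1_r.
Qed.

Lemma regular_part_removable F Ps w : has_simple_poles F Ps w ->
  exists L, removable (fun v => F v - polar_part Ps v) w L.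
Proof.
intros [[Hd H] | [_ [g [[l [phi [Hphi [_ Eg]]]] [Eres Hn]]]]].
- exists (F w - polar_part Ps w), (fun v => F v - polar_part Ps v).
  split; [| split; auto].
  + apply ccont_plus; [now apply cdiff_ccont |].
    apply (ccont_ext (fun v => (- (1)) * polar_part Ps v)).
    * apply near_all. intros; ring.
    * apply ccont_mult; [apply ccont_const |]. now apply cdiff_ccont, cdiff_polar_part.
  + apply near_all. auto.
- destruct e_factor as [k [Hk [Ek0 Ek]]].
  set (T := polar_part (map (fun p => (fst p, if Ceq_dec (e (w - fst p)) 1
     then RtoC 0 else snd p)) Ps)).
  assert (HT : ccont T w).
  { apply cdiff_ccont, cdiff_polar_part. intros p Hp E.
    apply in_map_iff in Hp. destruct Hp as [q [<- Hq]]. simpl in *.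
    destruct Ceq_dec; auto. now elim n. }
  assert (Hkw : ccont (fun v => k (v - w)) w).
  { apply (ccont_comp k).
    - apply (ccont_plus (fun v => v) (fun _ => - w)); [apply ccont_id | apply ccont_const].
    - replace (w - w) with (RtoC 0) by ring. now apply cdiff_ccont. }
  assert (Ekw : k (w - w) <> 0).
  { replace (w - w) with (RtoC 0) by ring. rewrite Ek0. unfold tpi.
    pose proof PI_RGT_0. intros E. apply (f_equal Im) in E.
    unfold Im in E; simpl in E. lra. }
  (* Since g v - g w = (v - w) phi v and e (v - w) - 1 = (v - w) k (v - w), removing the polar term
     at w leaves phi / k. *)
  set (h v := phi v * / k (v - w) + (- (1)) * T v).
  exists (h w), h. split; [| split; auto].
  + apply ccont_plus.
    * apply ccont_mult; auto. now apply (ccont_inv (fun v => k (v - w))).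
    * apply ccont_mult; auto. apply ccont_const.
  + generalize (near_and _ _ _ Hn (near_nonzero _ _ Hkw Ekw)). apply near_imp.
    intros v [H1 H2] n. specialize (H1 n).
    assert (Hvw : v - w <> 0) by (intros E; apply n, Ceq_minus, E).
    assert (He : e (v - w) - 1 <> 0).
    { rewrite Ek. now apply Cmult_neq_0. }
    unfold h. rewrite (polar_part_split Ps w v). fold T. rewrite <- Eres.
    replace (F v) with (g v * / (e (v - w) - 1)) by (rewrite <- H1; field; auto).
    unfold pole_fun. rewrite Ek, (Eg v). field. auto.
Qed.

(** The constant is the period integral of the regular part, the same at every height; each pole
    below the line then contributes minus its coefficient. *)
Lemma strip_residues F (Ps : list (C * C)) A B :
  (forall w, (A < Im w < B)%R -> near w (fun v => v <> w -> F (v + 1) = F v)) ->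
  (forall w, (A < Im w < B)%R -> has_simple_poles F Ps w) ->
  exists C0, forall P, (A < Im P < B)%R ->
    (forall t : R, cdiff F (P + RtoC t)) ->
    (forall p, In p Ps -> Im (fst p) = Im P -> snd p = 0) ->
    lint F P = C0 - Csum Ps (fun p => if Rlt_dec (Im (fst p)) (Im P) then snd p else 0).
Proof.
intros Hper Hs.
set (Q v := F v - polar_part Ps v).
(* The limit of [Q], chosen by [epsilon], replaces the arbitrary values of [F] at its poles. *)
set (H w := epsilon (inhabits (RtoC 0)) (fun L => removable Q w L)).
assert (HH : forall w, (A < Im w < B)%R -> removable Q w (H w)).
{ intros w Hw. apply epsilon_spec. now apply regular_part_removable, Hs. }
assert (HQ : forall w, (A < Im w < B)%R -> ccont Q w -> H w = Q w).
{ intros w Hw Hc. apply (removable_unique Q w); auto.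
  exists Q. split; auto. split; auto. apply near_all; auto. }
assert (Qd : forall w, cdiff F w ->
  (forall p, In p Ps -> e (w - fst p) = 1 -> snd p = 0) -> cdiff Q w).
{ intros w Hd Hp. apply cdiff_plus; auto.
  apply (cdiff_ext (fun v => (- (1)) * polar_part Ps v)).
  - apply near_all; intros; ring.
  - apply cdiff_mult; [apply cdiff_const | now apply cdiff_polar_part]. }
exists (lint H (0, (A + B) / 2)%R). intros P HP Hd Hz.
rewrite <- (lint_strip_constant H (map (fun p => Im (fst p)) Ps) A B) with (P := P); auto.
- rewrite (lint_ext F (fun w => H w + polar_part Ps w)).
  + rewrite lint_plus.
    * rewrite lint_polar_part by auto. ring.
    * intros t. apply (extension_ccont Q).
      apply near_imp with (P := fun w => (A < Im w < B)%R); auto.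
      apply near_Im. unfold Im in *; simpl in *; lra.
    * intros t. apply cdiff_ccont, cdiff_polar_part. intros p Hp E. apply Hz; auto.
      destruct (Req_dec (Im (P + t)) (Im (fst p))) as [E' | n].
      -- rewrite <- E'. unfold Im; simpl; ring.
      -- now elim (e_minus_Im _ _ n).
  + intros t. rewrite HQ.
    * unfold Q. ring.
    * unfold Im in *; simpl in *; lra.
    * apply cdiff_ccont, Qd; auto. intros p Hp E. apply Hz; auto.
      destruct (Req_dec (Im (P + t)) (Im (fst p))) as [E' | n].
      -- rewrite <- E'. unfold Im; simpl; ring.
      -- now elim (e_minus_Im _ _ n).
- intros w Hw. apply (removable_unique Q (w + 1)).
  + apply HH. unfold Im in *; simpl in *; lra.
  + apply removable_shift; auto.
    generalize (Hper w Hw). apply near_imp. intros v Hv n. unfold Q.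
    assert (E : polar_part Ps (v + 1) = polar_part Ps v).
    { apply Csum_ext. intros p _. now rewrite pole_fun_add_1. }
    now rewrite Hv, E.
- intros w Hw. apply (extension_ccont Q).
  apply near_imp with (P := fun w => (A < Im w < B)%R); auto. now apply near_Im.
- intros w Hw Hn.
  assert (N : near w (fun v => (A < Im v < B)%R /\ ~ In (Im v) (map (fun p => Im (fst p)) Ps))).
  { apply near_and; [now apply near_Im |]. clear - Hn.
    induction Ps as [| p Ps IH]; simpl in *.
    - apply near_all. auto.
    - assert (Np : near w (fun v => Im v <> Im (fst p))).
      { destruct (Rtotal_order (Im (fst p)) (Im w)) as [L | [E | L]].
        - generalize (near_Im w (Im (fst p)) (Im w + 1) ltac:(lra)). apply near_imp.
          intros v Hv E. lra.
        - elim Hn. now left.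
        - generalize (near_Im w (Im w - 1) (Im (fst p)) ltac:(lra)). apply near_imp.
          intros v Hv E. lra. }
      generalize (near_and _ _ _ Np (IH ltac:(tauto))). apply near_imp.
      intros v [H1 H2] [E | Hin]; [now apply H1 | auto]. }
  assert (R0 : forall v, (A < Im v < B)%R -> ~ In (Im v) (map (fun p => Im (fst p)) Ps) ->
     cdiff Q v).
  { intros v Hv Hnv.
    assert (Hne : forall p, In p Ps -> e (v - fst p) <> 1).
    { intros p Hp. apply e_minus_Im. intros E. apply Hnv. rewrite E.
      now apply (in_map (fun p => Im (fst p))). }
    destruct (Hs v Hv) as [[H1 H2] | [[p [Hp E]] _]]; [now apply Qd |].
    now elim (Hne p Hp). }
  apply (cdiff_ext Q); [| now apply R0].
  revert N. apply near_imp. intros v [H1 H2]. symmetry. apply HQ; auto.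
  now apply cdiff_ccont, R0.
- unfold Im in *; simpl in *; lra.
Qed.

(** * Series indexed by the integers *)

Definition tends (s : nat -> C) (l : C) : Prop :=
  forall eps : R, (0 < eps)%R ->
  exists N, forall n, (N <= n)%nat -> (Cmod (s n - l) < eps)%R.

Fixpoint psum (a : nat -> C) (n : nat) : C :=
  match n with O => 0 | S n => psum a n + a n end.

Definition cser (a : nat -> C) (l : C) : Prop := tends (psum a) l.

Lemma tends_plus s t l m : tends s l -> tends t m -> tends (fun n => s n + t n) (l + m).
Proof.
intros H1 H2 eps He. destruct (H1 (eps / 2)%R ltac:(lra)) as [N1 K1].
destruct (H2 (eps / 2)%R ltac:(lra)) as [N2 K2].
exists (max N1 N2). intros n Hn.
specialize (K1 n ltac:(lia)). specialize (K2 n ltac:(lia)).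
replace (s n + t n - (l + m)) with ((s n - l) + (t n - m)) by ring.
eapply Rle_lt_trans; [apply Cmod_triangle | lra].
Qed.

Lemma tends_scal c s l : tends s l -> tends (fun n => c * s n) (c * l).
Proof.
intros H eps He. pose proof (Cmod_ge_0 c) as Hc.
destruct (H (eps / (Cmod c + 1))%R ltac:(apply Rdiv_lt_0_compat; lra)) as [N K].
exists N. intros n Hn. specialize (K n Hn).
apply Rlt_div_r in K; [| lra].
replace (c * s n - c * l) with (c * (s n - l)) by ring. rewrite Cmod_mult.
pose proof (Cmod_ge_0 (s n - l)). nra.
Qed.

Lemma tends_ext s t l : (forall n, s n = t n) -> tends s l -> tends t l.
Proof. intros E H eps He. destruct (H eps He) as [N K]. exists N. intros. rewrite <- E; auto. Qed.

Lemma tends_const c : tends (fun _ => c) c.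
Proof.
intros eps He. exists O. intros n _. replace (c - c) with (RtoC 0) by ring.
now rewrite Cmod_0.
Qed.

Lemma tends_reindex s l (f : nat -> nat) :
  (forall N, exists N', forall n, (N' <= n)%nat -> (N <= f n)%nat) ->
  tends s l -> tends (fun n => s (f n)) l.
Proof.
intros Hf H eps He. destruct (H eps He) as [N K]. destruct (Hf N) as [N' K'].
exists N'. auto.
Qed.

Lemma psum_ext a b n : (forall k, a k = b k) -> psum a n = psum b n.
Proof. intros H. induction n as [| n IH]; simpl; auto. now rewrite IH, H. Qed.

Lemma psum_plus a b n : psum (fun k => a k + b k) n = psum a n + psum b n.
Proof. induction n as [| n IH]; simpl; [ring | rewrite IH; ring]. Qed.

Lemma psum_scal c a n : psum (fun k => c * a k) n = c * psum a n.
Proof. induction n as [| n IH]; simpl; [ring | rewrite IH; ring]. Qed.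

Lemma psum_shift a n : psum a (S n) = a O + psum (fun k => a (S k)) n.
Proof. induction n as [| n IH]; simpl in *; [ring |]. rewrite IH. ring. Qed.

Lemma cser_ext a b l : (forall k, a k = b k) -> cser a l -> cser b l.
Proof. intros E. apply tends_ext. intros n. now apply psum_ext. Qed.

Lemma cser_plus a b l m : cser a l -> cser b m -> cser (fun k => a k + b k) (l + m).
Proof.
intros H1 H2. apply (tends_ext (fun n => psum a n + psum b n)).
- intros n. now rewrite psum_plus.
- now apply tends_plus.
Qed.

Lemma cser_scal c a l : cser a l -> cser (fun k => c * a k) (c * l).
Proof.
intros H. apply (tends_ext (fun n => c * psum a n)).
- intros n. now rewrite psum_scal.
- now apply tends_scal.
Qed.

Lemma cser_tail a l : cser a l -> cser (fun k => a (S k)) (l - a O).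
Proof.
intros H. apply (tends_ext (fun n => psum a (S n) + - a O)).
- intros n. rewrite psum_shift. ring.
- apply tends_plus; [| apply tends_const]. apply (tends_reindex (psum a) l S); auto.
  intros N. exists N. lia.
Qed.

Lemma cser_untail a l : cser (fun k => a (S k)) l -> cser a (a O + l).
Proof.
intros H eps He. destruct (H eps He) as [N K]. exists (S N). intros n Hn.
destruct n as [| n]; [lia |]. rewrite psum_shift.
replace (_ - _) with (psum (fun k => a (S k)) n - l) by ring. apply K. lia.
Qed.

Lemma psum_sum_n (a : nat -> C) n :
  sum_n (G := C_R_NormedModule) a n = psum a (S n).
Proof.
induction n as [| n IH].
- rewrite sum_O. simpl. ring.
- rewrite sum_Sn, IH. reflexivity.
Qed.

Lemma cser_is_series a l :
  cser a l <-> is_series (K := R_AbsRing) (V := C_R_NormedModule) a l.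
Proof.
split.
- intros H P HP. apply near_locally in HP. destruct HP as [d [Hd HP]].
  destruct (H d Hd) as [N K]. exists N. intros n Hn. rewrite psum_sum_n. apply HP, K. lia.
- intros H eps He.
  assert (HP : locally (T := C_UniformSpace) l (fun w => Cmod (w - l) < eps)%R).
  { apply near_locally. exists eps. auto. }
  destruct (H _ HP) as [N K]. exists (S N). intros n Hn.
  destruct n as [| n]; [lia |]. rewrite <- psum_sum_n. apply K. lia.
Qed.

Lemma CSeries_eq a l : cser a l -> CSeries a = l.
Proof.
intros H. apply cser_is_series in H.
apply (iota_filterlim_locally (V := C_R_CompleteNormedModule)
  (sum_n (G := C_R_NormedModule) a)). exact H.
Qed.

Lemma cser_comparison a (b : nat -> R) :
  (forall n, (Cmod (a n) <= b n)%R) -> ex_series b -> exists l, cser a l.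
Proof.
intros H Hb.
destruct (ex_series_le (V := C_R_CompleteNormedModule) a b) as [l Hl]; auto.
- intros n. eapply Rle_trans; [| apply H]. right. symmetry. apply Cmod_norm.
- exists l. now apply cser_is_series.
Qed.

(** Completing the square dominates the Gaussian by a multiple of exp (- n). The induction on [N]
    removes the terms that the bound does not cover; passing from n to n + 1 changes x into x - 2 t
    and K into K exp (x - t). *)
Lemma cser_gauss a (K t x : R) N : (0 < t)%R -> (0 <= K)%R ->
  (forall n, (N <= n)%nat ->
     (Cmod (a n) <= K * exp (- t * (INR n * INR n) + x * INR n))%R) ->
  exists l, cser a l.
Proof.
intros Ht HK. revert a x K HK. induction N as [| N IH]; intros a x K HK H.
- apply cser_comparison
    with (b := fun n => (K * exp ((x + 1) * (x + 1) / (4 * t)) * exp (-1) ^ n)%R).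
  + intros n. eapply Rle_trans; [apply H; lia |].
    rewrite Rmult_assoc. apply Rmult_le_compat_l; auto.
    assert (E : (exp (-1) ^ n = exp (- INR n))%R).
    { clear. induction n as [| n IH]; [change (INR 0) with 0%R; now rewrite Ropp_0, exp_0 |].
      rewrite S_INR. simpl. rewrite IH, <- exp_plus. f_equal. ring. }
    rewrite E, <- exp_plus.
    assert (L : (- t * (INR n * INR n) + x * INR n <=
                 (x + 1) * (x + 1) / (4 * t) + - INR n)%R).
    { set (u := INR n).
      assert (Q : ((x + 1) * (x + 1) / (4 * t) + - u - (- t * (u * u) + x * u) =
        t * ((u - (x + 1) / (2 * t)) * (u - (x + 1) / (2 * t))))%R) by (field; lra).
      assert (0 <= t * ((u - (x + 1) / (2 * t)) * (u - (x + 1) / (2 * t))))%R.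
      { apply Rmult_le_pos; [lra |]. apply Rle_0_sqr. }
      lra. }
    destruct L as [L | L]; [left; now apply exp_increasing | rewrite L; apply Rle_refl].
  + apply (ex_series_scal_l (V := R_NormedModule)). apply ex_series_geom.
    rewrite Rabs_pos_eq by (left; apply exp_pos).
    rewrite <- exp_0. apply exp_increasing. lra.
- destruct (IH (fun n => a (S n)) (x - 2 * t)%R (K * exp (x - t))%R) as [l Hl].
  + apply Rmult_le_pos; auto. left; apply exp_pos.
  + intros n Hn. eapply Rle_trans; [apply H; lia |]. right.
    rewrite Rmult_assoc, <- exp_plus. do 2 f_equal. rewrite S_INR. ring.
  + exists (a O + l). now apply cser_untail.
Qed.

(** [ZSeries] is a sum of two definite descriptions and is informative only if both halves converge;
    this relation carries the convergence along with the value. *)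
Definition is_zs (a : Z -> C) (l : C) : Prop :=
  exists l1 l2, cser (fun n => a (Z.of_nat n)) l1 /\
    cser (fun n => a (- Z.of_nat (S n))%Z) l2 /\ l = l1 + l2.

Lemma ZSeries_eq a l : is_zs a l -> ZSeries a = l.
Proof.
intros [l1 [l2 [H1 [H2 ->]]]]. unfold ZSeries.
now rewrite (CSeries_eq _ _ H1), (CSeries_eq _ _ H2).
Qed.

Lemma is_zs_unique a l m : is_zs a l -> is_zs a m -> l = m.
Proof. intros H1 H2. now rewrite <- (ZSeries_eq _ _ H1), <- (ZSeries_eq _ _ H2). Qed.

Lemma is_zs_ext a b l : (forall n, a n = b n) -> is_zs a l -> is_zs b l.
Proof.
intros E [l1 [l2 [H1 [H2 ->]]]]. exists l1, l2. split; [| split; auto].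
- revert H1. now apply cser_ext.
- revert H2. now apply cser_ext.
Qed.

Lemma is_zs_plus a b l m : is_zs a l -> is_zs b m -> is_zs (fun n => a n + b n) (l + m).
Proof.
intros [l1 [l2 [H1 [H2 ->]]]] [m1 [m2 [K1 [K2 ->]]]].
exists (l1 + m1), (l2 + m2). split; [now apply cser_plus |].
split; [now apply (cser_plus (fun n => a (- Z.of_nat (S n))%Z) _ l2 m2) | ring].
Qed.

Lemma is_zs_scal c a l : is_zs a l -> is_zs (fun n => c * a n) (c * l).
Proof.
intros [l1 [l2 [H1 [H2 ->]]]]. exists (c * l1), (c * l2).
split; [now apply cser_scal |].
split; [now apply (cser_scal c (fun n => a (- Z.of_nat (S n))%Z)) | ring].
Qed.

Lemma is_zs_0 : is_zs (fun _ => 0) 0.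
Proof.
assert (H : cser (fun _ => 0) 0).
{ apply (tends_ext (fun _ => 0)); [| apply tends_const].
  intros n. induction n as [| n IH]; simpl; auto. rewrite <- IH. ring. }
exists 0, 0. split; auto. split; auto. ring.
Qed.

Lemma is_zs_Csum {A} (l : list A) (a : A -> Z -> C) (L : A -> C) :
  (forall i, In i l -> is_zs (a i) (L i)) ->
  is_zs (fun n => Csum l (fun i => a i n)) (Csum l L).
Proof.
induction l as [| i l IH]; intros H; simpl; [apply is_zs_0 |].
apply is_zs_plus; [apply H; now left |]. apply IH. intros j Hj. apply H. now right.
Qed.

Lemma is_zs_succ a l : is_zs a l -> is_zs (fun n => a (n + 1)%Z) l.
Proof.
intros [l1 [l2 [H1 [H2 ->]]]]. exists (l1 - a 0%Z), (a 0%Z + l2).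
split; [| split; [| ring]].
- generalize (cser_tail _ _ H1). apply cser_ext. intros n. f_equal. lia.
- apply (cser_untail (fun n => a (- Z.of_nat (S n) + 1)%Z)). revert H2.
  apply cser_ext. intros n. f_equal. lia.
Qed.

Lemma is_zs_pred a l : is_zs a l -> is_zs (fun n => a (n - 1)%Z) l.
Proof.
intros [l1 [l2 [H1 [H2 ->]]]]. exists (a (-1)%Z + l1), (l2 - a (-1)%Z).
split; [| split; [| ring]].
- apply (cser_untail (fun n => a (Z.of_nat n - 1)%Z)). revert H1.
  apply cser_ext. intros n. f_equal. lia.
- generalize (cser_tail _ _ H2). apply cser_ext. intros n. f_equal. lia.
Qed.

Lemma is_zs_shift k a l : is_zs a l -> is_zs (fun n => a (n + k)%Z) l.
Proof.
intros H. destruct (Z_le_gt_dec 0 k) as [Hk | Hk].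
- revert k Hk. apply natlike_ind.
  + revert H. apply is_zs_ext. intros n. f_equal. lia.
  + intros k _ IH. generalize (is_zs_succ _ _ IH). apply is_zs_ext.
    intros n. f_equal. lia.
- replace k with (- (- k))%Z by lia. assert (Hk' : (0 <= - k)%Z) by lia.
  revert Hk'. generalize (- k)%Z. clear k Hk. apply natlike_ind.
  + revert H. apply is_zs_ext. intros n. f_equal. lia.
  + intros k _ IH. generalize (is_zs_pred _ _ IH). apply is_zs_ext.
    intros n. f_equal. lia.
Qed.

Lemma is_zs_single k c : is_zs (fun n => if Z.eq_dec n k then c else 0) c.
Proof.
assert (H0 : is_zs (fun n => if Z.eq_dec n 0 then c else 0) c).
{ assert (Z0 : cser (fun _ => 0) 0).
  { apply (tends_ext (fun _ => 0)); [| apply tends_const].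
    intros n. induction n as [| n IH]; simpl; auto. rewrite <- IH. ring. }
  exists (c + 0), 0. split; [| split; [| ring]].
  - apply (cser_untail (fun n => if Z.eq_dec (Z.of_nat n) 0 then c else 0)).
    revert Z0. apply cser_ext. intros n. destruct Z.eq_dec; auto. lia.
  - revert Z0. apply cser_ext. intros n. destruct Z.eq_dec; auto. lia. }
generalize (is_zs_shift (- k) _ _ H0). apply is_zs_ext. intros n.
destruct (Z.eq_dec (n + - k) 0), (Z.eq_dec n k); auto; lia.
Qed.

(** Meant for the integrals over the bottom edge, [b l] being that of the l-th term of the
    kernel. *)
Lemma is_zs_telescope (b : Z -> C) l : is_zs b l ->
  is_zs (fun n => b (n - 1)%Z - b n) 0.
Proof.
intros H. replace (RtoC 0) with (l + (- (1)) * l) by ring.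
apply (is_zs_ext (fun n => b (n - 1)%Z + (- (1)) * b n)); [intros; ring |].
apply is_zs_plus; [now apply is_zs_pred | now apply is_zs_scal].
Qed.

Lemma is_zs_gauss (a : Z -> C) (K t x : R) (N : Z) : (0 < t)%R -> (0 <= K)%R ->
  (forall n, (N <= Z.abs n)%Z ->
     (Cmod (a n) <= K * exp (- t * (IZR n * IZR n) + x * IZR n))%R) ->
  exists l, is_zs a l.
Proof.
intros Ht HK H.
destruct (cser_gauss (fun n => a (Z.of_nat n)) K t x (Z.to_nat N) Ht HK) as [l1 H1].
{ intros n Hn. rewrite INR_IZR_INZ. apply H. lia. }
destruct (cser_gauss (fun n => a (- Z.of_nat (S n))%Z) (K * exp (- t - x))%R t
  (- 2 * t - x)%R (Z.to_nat N) Ht) as [l2 H2].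
{ apply Rmult_le_pos; auto. left; apply exp_pos. }
{ intros n Hn. eapply Rle_trans; [apply H; lia |]. right.
  rewrite Rmult_assoc, <- exp_plus. do 2 f_equal.
  rewrite opp_IZR, <- INR_IZR_INZ, S_INR. ring. }
now exists (l1 + l2), l1, l2.
Qed.

Lemma cser_spread b l (M j : nat) : (j < M)%nat -> cser b l ->
  cser (fun n => if Nat.eqb (n mod M) j then b (n / M)%nat else 0) l.
Proof.
(* [f n] counts the indices k < n with k mod M = j, so the first n terms of the spread series sum to
   [psum b (f n)]. *)
intros Hj Hb. set (f n := ((n + (M - 1 - j)) / M)%nat).
apply (tends_ext (fun n => psum b (f n))).
- intros n. induction n as [| n IH]; simpl.
  + unfold f. rewrite Nat.div_small by lia. reflexivity.
  + rewrite <- IH. set (q := (n / M)%nat). set (r := (n mod M)%nat).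
    assert (En : n = (M * q + r)%nat) by apply Nat.div_mod_eq.
    assert (Hr : (r < M)%nat) by (apply Nat.mod_upper_bound; lia).
    assert (Ef : forall k d s, (k + (M - 1 - j) = M * d + s)%nat -> (s < M)%nat -> f k = d).
    { intros k d s E Hs. symmetry. unfold f. now apply (Nat.div_unique _ _ _ s). }
    destruct (Nat.eqb_spec r j) as [E | n0].
    * rewrite (Ef n q (M - 1)%nat) by lia. rewrite (Ef (S n) (S q) 0%nat) by lia. simpl. ring.
    * destruct (Nat.lt_ge_cases r j) as [L | L].
      -- rewrite (Ef n q (r + (M - 1 - j))%nat) by lia.
         rewrite (Ef (S n) q (r + 1 + (M - 1 - j))%nat) by lia. ring.
      -- rewrite (Ef n (S q) (r - 1 - j)%nat) by lia.
         rewrite (Ef (S n) (S q) (r - j)%nat) by lia. ring.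
- apply (tends_reindex (psum b) l f); auto.
  intros N. exists (M * N)%nat. intros n Hn. unfold f.
  apply Nat.div_le_lower_bound; lia.
Qed.

(** Turns a sum over l into a sum over r = M l + j, that is over r congruent to j modulo M, the form
    in which [theta] is defined. *)
Lemma is_zs_spread b l (M j : Z) : (0 <= j < M)%Z -> is_zs b l ->
  is_zs (fun r => if Z.eqb ((r - j) mod M) 0 then b ((r - j) / M)%Z else 0) l.
Proof.
intros Hj [l1 [l2 [H1 [H2 ->]]]].
assert (X : forall r q s, (r = M * q + s)%Z -> (0 <= s < M)%Z ->
  (if Z.eqb ((r - j) mod M) 0 then b ((r - j) / M)%Z else 0) =
  (if Z.eqb s j then b q else 0)).
{ intros r q s -> Hs. destruct (Z.eqb_spec s j) as [-> | n].
  - replace (M * q + j - j)%Z with (q * M)%Z by ring.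
    rewrite Z_mod_mult, Z_div_mult by lia. reflexivity.
  - destruct (Z.eqb_spec ((M * q + s - j) mod M) 0) as [E | _]; auto.
    exfalso. replace (M * q + s - j)%Z with ((s - j) + q * M)%Z in E by ring.
    rewrite Z_mod_plus_full in E.
    destruct (Z_le_gt_dec 0 (s - j)) as [L | L].
    + rewrite Z.mod_small in E; lia.
    + rewrite <- (Z_mod_plus_full _ 1), Z.mod_small in E; lia. }
exists l1, l2. split; [| split; auto].
- generalize (cser_spread _ _ (Z.to_nat M) (Z.to_nat j) ltac:(lia) H1). apply cser_ext.
  intros n. set (q := (n / Z.to_nat M)%nat). set (s := (n mod Z.to_nat M)%nat).
  assert (En : n = (Z.to_nat M * q + s)%nat) by apply Nat.div_mod_eq.
  assert (Hs : (s < Z.to_nat M)%nat) by (apply Nat.mod_upper_bound; lia).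
  rewrite (X _ (Z.of_nat q) (Z.of_nat s)) by lia.
  destruct (Nat.eqb_spec s (Z.to_nat j)), (Z.eqb_spec (Z.of_nat s) j); auto; lia.
(* Here r = -(n + 1): if n has quotient q and remainder s by M, then r has quotient -(q + 1) and
   remainder M - 1 - s. *)
- generalize (cser_spread _ _ (Z.to_nat M) (Z.to_nat (M - 1 - j)) ltac:(lia) H2).
  apply cser_ext.
  intros n. set (q := (n / Z.to_nat M)%nat). set (s := (n mod Z.to_nat M)%nat).
  assert (En : n = (Z.to_nat M * q + s)%nat) by apply Nat.div_mod_eq.
  assert (Hs : (s < Z.to_nat M)%nat) by (apply Nat.mod_upper_bound; lia).
  rewrite (X _ (- Z.of_nat (S q))%Z (M - 1 - Z.of_nat s)%Z) by lia.
  destruct (Nat.eqb_spec s (Z.to_nat (M - 1 - j))),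
    (Z.eqb_spec (M - 1 - Z.of_nat s) j); auto; lia.
Qed.

(** * Simple poles and residues *)

Lemma ccont_minus_const a w : ccont (fun v => v - a) w.
Proof. apply (ccont_plus (fun v => v) (fun _ => - a)); [apply ccont_id | apply ccont_const]. Qed.

Lemma cdiff_minus_const a w : cdiff (fun v => v - a) w.
Proof. apply (cdiff_plus (fun v => v) (fun _ => - a)); [apply cdiff_id | apply cdiff_const]. Qed.

Lemma near_punctured_locally' z (P : C -> Prop) :
  locally' (T := C_UniformSpace) z P <-> near z (fun v => v <> z -> P v).
Proof. unfold locally', within. apply near_locally. Qed.

(** At a pole of order n, g v = f v (v - z)^n off z; for f continuous at z this would force g z =
    0. *)
Lemma holomorphic_not_pole f z : near z (fun w => cdiff f w) -> ~ is_pole f z.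
Proof.
intros Hf [n [Hn [g [Hg [g0 H]]]]].
apply holomorphic_at_near, near_self, cdiff_ccont in Hg.
apply near_self, cdiff_ccont in Hf.
apply near_punctured_locally' in H. apply g0.
apply (removable_unique g z).
- exists g. split; auto. split; auto. now apply near_all.
- destruct n as [| n]; [lia |].
  exists (fun v => f v * ((v - z) * (v - z) ^ n)). split; [| split].
  + apply ccont_mult; auto. apply ccont_mult; [apply ccont_minus_const |].
    clear. induction n as [| n IH]; simpl; [apply ccont_const |].
    apply (ccont_mult (fun v => v - z)); auto. apply ccont_minus_const.
  + ring.
  + revert H. apply near_imp. intros v H n'. rewrite H by auto.
    assert (v - z <> 0) by (intros E; apply n', Ceq_minus, E).
    rewrite Cpow_S. field. split; auto. now apply Cpow_nz.
Qed.

Lemma rcont_ext p q t : (forall s, p s = q s) -> rcont p t -> rcont q t.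
Proof.
intros E H eps He. destruct (H eps He) as [d [Hd K]]. exists d. split; auto.
intros s Hs. rewrite <- !E. now apply K.
Qed.

Lemma rcont_comp g p t : rcont p t -> ccont g (p t) -> rcont (fun s => g (p s)) t.
Proof.
intros Hp Hg eps He. destruct (Hg eps He) as [d [Hd K]].
destruct (Hp d Hd) as [d' [Hd' K']]. exists d'. split; auto.
Qed.

Lemma rcont_circle z r t : rcont (fun s => z + RtoC r * e (RtoC s)) t.
Proof.
apply (rcont_ext (fun s => z + RtoC r * e (0 + RtoC s * 1))).
- intros s. do 3 f_equal. ring.
- apply (rcont_line (fun v => z + RtoC r * e v)); [apply Cmod_1 |].
  apply ccont_plus; [apply ccont_const |]. apply ccont_mult; [apply ccont_const |].
  apply cdiff_ccont, cdiff_e.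
Qed.

Lemma Cmod_e_R t : Cmod (e (RtoC t)) = 1%R.
Proof. rewrite Cmod_e. unfold Im; simpl. now rewrite Rmult_0_r, Ropp_0, exp_0. Qed.

Lemma tpi_neq_0 : tpi <> 0.
Proof.
unfold tpi. pose proof PI_RGT_0. intros E. apply (f_equal Im) in E.
unfold Im in E; simpl in E. lra.
Qed.

(** The factor 1 / (v - z) cancels against the derivative of the circle, which leaves 2 pi i times
    the mean of g on the circle, and g is continuous at z. *)
Lemma circle_integral_limit f g z :
  near z (fun v => cdiff g v) ->
  near z (fun v => v <> z -> f v = g v / (v - z)) ->
  forall eps : R, (0 < eps)%R -> exists d : R, (0 < d)%R /\
  forall r, (0 < r < d)%R ->
    (Cmod (circle_integral f z r / (2 * RtoC PI * Ci) - g z) < eps)%R.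
Proof.
intros Hg Hf eps He.
pose proof (cdiff_ccont _ _ (near_self _ _ Hg) (eps / 4)%R ltac:(lra)) as Hc.
destruct (near_and _ _ _ Hg (near_and _ _ _ Hf Hc)) as [d [Hd H]].
exists d. split; auto. intros r Hr.
assert (Hv : forall t : R, (Cmod (z + RtoC r * e (RtoC t) - z) < d)%R).
{ intros t. replace (z + r * e t - z) with (r * e t) by ring.
  rewrite Cmod_mult, Cmod_R, Cmod_e_R, Rabs_pos_eq; lra. }
assert (Hr0 : RtoC r <> 0) by (intros E; apply RtoC_inj in E; lra).
assert (Hgc : forall t : R, rcont (fun t => g (z + RtoC r * e (RtoC t))) t).
{ intros t. apply (rcont_comp g (fun t => z + RtoC r * e (RtoC t))).
  - apply rcont_circle.
  - now apply cdiff_ccont, H. }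
assert (E : forall t : R, tpi * g (z + RtoC r * e (RtoC t)) =
  f (z + RtoC r * e (RtoC t)) * (2 * RtoC PI * Ci * RtoC r * e (RtoC t))).
{ intros t. destruct (H _ (Hv t)) as [_ [H2 _]]. rewrite H2.
  - replace (z + r * e t - z) with (r * e t) by ring. unfold tpi.
    field. split; auto. apply e_neq_0.
  - intros E. assert (X : r * e t = 0).
    { replace (r * e t) with (z + r * e t - z) by ring. rewrite E. ring. }
    revert X. apply Cmult_neq_0; auto. apply e_neq_0. }
assert (Hs : forall t : R, rcont (fun t => tpi * g (z + RtoC r * e (RtoC t))) t).
{ intros t. apply (rcont_comp (fun v => tpi * v) (fun t => g (z + RtoC r * e (RtoC t)))).
  - apply Hgc.
  - apply ccont_mult; [apply ccont_const | apply ccont_id]. }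
unfold circle_integral. rewrite RInt_cint; [| lra |].
2: { intros t _. exact (rcont_ext _ _ t E (Hs t)). }
rewrite <- (cint_ext 0 1 ltac:(lra) _ _ (fun t _ => E t)).
rewrite (cint_scal 0 1 ltac:(lra)) by (intros t _; apply Hgc).
fold tpi. replace (tpi * _ / tpi) with (cint (fun t => g (z + RtoC r * e (RtoC t))) 0 1)
  by (field; apply tpi_neq_0).
replace (cint (fun t => g (z + RtoC r * e (RtoC t))) 0 1 - g z)
  with (cint (fun t => g (z + RtoC r * e (RtoC t)) + - g z) 0 1).
- apply Rle_lt_trans with (2 * (eps / 4) * (1 - 0))%R; [| lra].
  apply cint_bound; [lra | |].
  + intros t _. apply (rcont_comp (fun v => v + - g z) (fun t => g (z + RtoC r * e (RtoC t)))).
    * apply Hgc.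
    * apply ccont_plus; [apply ccont_id | apply ccont_const].
  + intros t _. left. apply H, Hv.
- rewrite cint_plus; [| lra | intros t _; apply Hgc |].
  + rewrite (cint_ext 0 1 ltac:(lra) (fun _ => - g z) (fun t => - g z + RtoC t * 0))
      by (intros; ring).
    rewrite cint_affine by lra. replace (1 - 0)%R with 1%R by ring. ring.
  + intros t _ e1 He1. exists 1%R. split; [lra |]. intros s _.
    replace (- g z - - g z) with (RtoC 0) by ring. now rewrite Cmod_0.
Qed.

Lemma residue_eq f g z :
  near z (fun v => cdiff g v) ->
  near z (fun v => v <> z -> f v = g v / (v - z)) ->
  residue f z = g z.
Proof.
intros Hg Hf. unfold residue.
apply (iota_filterlim_locally (V := C_R_CompleteNormedModule)
  (fun r => circle_integral f z r / (2 * RtoC PI * Ci))).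
intros P HP. apply near_locally in HP. destruct HP as [eps [He HP]].
destruct (circle_integral_limit f g z Hg Hf eps He) as [d [Hd H]].
exists (mkposreal d Hd). intros r Hr Hr0. apply HP, H.
change (Rabs (r - 0) < d)%R in Hr. rewrite Rminus_0_r, Rabs_pos_eq in Hr; lra.
Qed.

(* The residue scaled so that [/ (e (v - w) - 1)] has scaled residue 1 at [w]. *)
Definition scaled_residue (f : C -> C) (w : C) : C := tpi * residue f w.

(** With f = g0 / (v - w), take g0 times the quotient (e(v - w) - 1) / (v - w), whose value at w is
    2 pi i. A regular point is covered by g0 = f (v - w), which vanishes at w. *)
Lemma scaled_residue_spec f w :
  (near w (fun v => cdiff f v) \/ simple_pole f w) ->
  exists g, cdiff g w /\ g w = scaled_residue f w /\
    near w (fun v => v <> w -> f v * (e (v - w) - 1) = g v).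
Proof.
intros Hf.
assert (H0 : exists g0, near w (fun v => cdiff g0 v) /\
   near w (fun v => v <> w -> f v = g0 v / (v - w))).
{ destruct Hf as [Hf | [g0 [Hg [_ H]]]].
  - exists (fun v => f v * (v - w)). split.
    + revert Hf. apply near_imp. intros v Hv. apply cdiff_mult; auto.
      apply cdiff_minus_const.
    + apply near_all. intros v n.
      assert (v - w <> 0) by (intros E; apply n, Ceq_minus, E). field; auto.
  - exists g0. split; [now apply holomorphic_at_near |].
    apply near_punctured_locally' in H. revert H. apply near_imp.
    intros v H n. rewrite H by auto. now rewrite Cpow_1_r. }
destruct H0 as [g0 [Hg H]]. destruct e_factor as [k [Hk [Ek0 Ek]]].
exists (fun v => g0 v * k (v - w)). split; [| split].
- apply cdiff_mult; [now apply near_self |].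
  apply (cdiff_comp k); [apply cdiff_minus_const |].
  now replace (w - w) with (RtoC 0) by ring.
- replace (w - w) with (RtoC 0) by ring. unfold scaled_residue.
  rewrite (residue_eq f g0) by auto. rewrite Ek0. ring.
- revert H. apply near_imp. intros v H n. rewrite H by auto.
  assert (v - w <> 0) by (intros E; apply n, Ceq_minus, E).
  rewrite Ek. field; auto.
Qed.

(** * Functions with the elliptic transformation law *)

Record elliptic_slice (m : nat) (tau : C) (f : C -> C) : Prop := {
  es_H : (0 < Im tau)%R;
  es_holomorphic : forall w, ~ is_pole f w -> near w (fun v => cdiff f v);
  es_simple : forall w, is_pole f w -> simple_pole f w;
  es_elliptic : forall (l mu : Z) w, ~ is_pole f w ->
    f (w + RtoC (IZR l) * tau + RtoC (IZR mu)) =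
    e (- (RtoC (INR m) * (RtoC (IZR l) ^ 2 * tau + 2 * RtoC (IZR l) * w))) * f w
}.

Section Slice.

Variables (m : nat) (tau : C) (f : C -> C).
Hypothesis (Hf : elliptic_slice m tau f).

Lemma slice_alternative w : near w (fun v => cdiff f v) \/ simple_pole f w.
Proof.
destruct (classic (is_pole f w)) as [H | H].
- right. now apply (es_simple _ _ _ Hf).
- left. now apply (es_holomorphic _ _ _ Hf).
Qed.

Lemma slice_residue w : exists g, cdiff g w /\ g w = scaled_residue f w /\
  near w (fun v => v <> w -> f v * (e (v - w) - 1) = g v).
Proof. apply scaled_residue_spec, slice_alternative. Qed.

(** Characterizes the scaled residue as a limit; identities between residues then follow from the
    uniqueness of limits. *)
Lemma scaled_residue_removable w :
  removable (fun v => f v * (e (v - w) - 1)) w (scaled_residue f w).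
Proof.
destruct (slice_residue w) as [g [Hg [E H]]]. exists g.
split; [now apply cdiff_ccont |]. auto.
Qed.

(** The elliptic law is imposed off the poles; their isolation lets it be applied in a punctured
    neighbourhood of a pole. *)
Lemma near_not_pole w : near w (fun v => v <> w -> ~ is_pole f v).
Proof.
assert (H : near w (fun v => v <> w -> cdiff f v)).
{ destruct (slice_alternative w) as [H | [g [Hg [_ H]]]].
  - revert H. apply near_imp. auto.
  - apply near_punctured_locally' in H. apply holomorphic_at_near in Hg.
    generalize (near_and _ _ _ Hg (near_near _ _ H)). apply near_imp.
    intros v [H1 H2] n.
    apply (cdiff_ext (fun u => g u * / (u - w))).
    + generalize (near_and _ _ _ H2 (near_neq _ _ n)). apply near_imp.
      intros u [H3 H4]. rewrite H3 by auto. now rewrite Cpow_1_r.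
    + apply cdiff_mult; auto. apply (cdiff_inv (fun u => u - w)).
      * apply cdiff_minus_const.
      * intros E. now apply n, Ceq_minus. }
generalize (near_near _ _ H). apply near_imp. intros v Hv n.
apply holomorphic_not_pole.
generalize (near_and _ _ _ Hv (near_neq _ _ n)). apply near_imp. tauto.
Qed.

Lemma scaled_residue_not_pole w : ~ is_pole f w -> scaled_residue f w = 0.
Proof.
intros H. apply (removable_unique _ _ _ _ (scaled_residue_removable w)).
exists (fun v => f v * (e (v - w) - 1)). split; [| split].
- apply ccont_mult.
  + apply cdiff_ccont, near_self. now apply (es_holomorphic _ _ _ Hf).
  + apply ccont_plus; [| apply ccont_const]. apply cdiff_ccont, cdiff_e_minus.
- replace (w - w) with (RtoC 0) by ring. rewrite e_0. ring.
- now apply near_all.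
Qed.

Definition elliptic_factor (l : Z) (w : C) : C :=
  e (- (RtoC (INR m) * (RtoC (IZR l) ^ 2 * tau + 2 * RtoC (IZR l) * w))).

Lemma cdiff_elliptic_factor l w : cdiff (elliptic_factor l) w.
Proof.
apply (cdiff_ext (fun v => e ((- (RtoC (INR m) * (2 * RtoC (IZR l)))) * v +
  - (RtoC (INR m) * (RtoC (IZR l) ^ 2 * tau))))).
- apply near_all. intros v. unfold elliptic_factor. f_equal. ring.
- apply cdiff_e_lin.
Qed.

Lemma not_pole_translate l mu w : ~ is_pole f w ->
  ~ is_pole f (w + RtoC (IZR l) * tau + RtoC (IZR mu)).
Proof.
intros H. apply holomorphic_not_pole.
set (a := RtoC (IZR l) * tau + RtoC (IZR mu)).
replace (w + RtoC (IZR l) * tau + RtoC (IZR mu)) with (w + a) by (unfold a; ring).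
assert (N : near w (fun v => cdiff f v /\ ~ is_pole f v)).
{ apply near_and; [now apply (es_holomorphic _ _ _ Hf) |].
  generalize (near_not_pole w). apply near_imp. intros v Hv.
  destruct (Ceq_dec v w) as [-> | n]; auto. }
generalize (near_near _ _ (near_shift _ a _ N)). apply near_imp. intros v Hv.
apply (cdiff_ext (fun u => elliptic_factor l (u - a) * f (u - a))).
- revert Hv. apply near_imp. intros u [_ Hu].
  unfold elliptic_factor. rewrite <- (es_elliptic _ _ _ Hf l mu) by auto.
  f_equal. unfold a. ring.
- apply cdiff_mult.
  + apply (cdiff_comp (elliptic_factor l)); [apply cdiff_minus_const |].
    apply cdiff_elliptic_factor.
  + apply (cdiff_comp f); [apply cdiff_minus_const |]. now apply (near_self v) in Hv.
Qed.

Lemma scaled_residue_translate l mu w :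
  scaled_residue f (w + RtoC (IZR l) * tau + RtoC (IZR mu)) =
  elliptic_factor l w * scaled_residue f w.
Proof.
set (a := RtoC (IZR l) * tau + RtoC (IZR mu)).
replace (w + RtoC (IZR l) * tau + RtoC (IZR mu)) with (w + a) by (unfold a; ring).
apply (removable_unique _ _ _ _ (scaled_residue_removable (w + a))).
destruct (slice_residue w) as [g [Hg [E H]]].
exists (fun v => elliptic_factor l (v - a) * g (v - a)).
assert (Ew : w + a - a = w) by ring.
split; [| split].
- apply cdiff_ccont. apply cdiff_mult.
  + apply (cdiff_comp (elliptic_factor l)); [apply cdiff_minus_const |].
    apply cdiff_elliptic_factor.
  + apply (cdiff_comp g); [apply cdiff_minus_const |]. now rewrite Ew.
- now rewrite Ew, E.
- generalize (near_shift _ a _ (near_and _ _ _ H (near_not_pole w))).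
  apply near_imp. intros v [H1 H2] n.
  assert (n' : v - a <> w) by (intros E'; apply n; rewrite <- E'; ring).
  rewrite <- H1 by auto.
  replace (v - (w + a)) with (v - a - w) by ring.
  assert (Ev : f v = elliptic_factor l (v - a) * f (v - a)).
  { unfold elliptic_factor. rewrite <- (es_elliptic _ _ _ Hf l mu) by auto.
    f_equal. unfold a. ring. }
  rewrite Ev. ring.
Qed.

Lemma slice_add_Z n w : ~ is_pole f w -> f (w + RtoC (IZR n)) = f w.
Proof.
intros H. pose proof (es_elliptic _ _ _ Hf 0 n w H) as E.
replace (w + RtoC (IZR 0) * tau + RtoC (IZR n)) with (w + RtoC (IZR n)) in E by ring.
rewrite E. replace (- _) with (RtoC 0) by ring. rewrite e_0. ring.
Qed.

Lemma scaled_residue_add_Z n w : scaled_residue f (w + RtoC (IZR n)) = scaled_residue f w.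
Proof.
pose proof (scaled_residue_translate 0 n w) as E.
replace (w + RtoC (IZR 0) * tau + RtoC (IZR n)) with (w + RtoC (IZR n)) in E by ring.
rewrite E. unfold elliptic_factor. replace (- _) with (RtoC 0) by ring. rewrite e_0. ring.
Qed.

End Slice.

(** * Finite sums and the functions R_c *)

Lemma Csum_cons {A} a (l : list A) f : Csum (a :: l) f = f a + Csum l f.
Proof. reflexivity. Qed.

Lemma Csum_app {A} (l l' : list A) f : Csum (l ++ l') f = Csum l f + Csum l' f.
Proof.
induction l as [| a l IH]; simpl; [ring |]. fold (Csum (l ++ l') f). rewrite IH. 
fold (Csum l f). ring.
Qed.

Lemma Csum_map {A B} (g : A -> B) l f : Csum (map g l) f = Csum l (fun a => f (g a)).
Proof. induction l as [| a l IH]; simpl; auto. now f_equal. Qed.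

Lemma Csum_0 {A} (l : list A) (f : A -> C) : (forall a, In a l -> f a = 0) -> Csum l f = 0.
Proof.
intros H. rewrite (Csum_ext l f (fun _ => RtoC 0) H). clear H.
induction l as [| a l IH]; simpl; auto. fold (Csum l (fun _ : A => RtoC 0)).
rewrite IH. ring.
Qed.

Lemma Csum_single {A} (l : list A) (f : A -> C) a : NoDup l -> In a l ->
  (forall b, In b l -> b <> a -> f b = 0) -> Csum l f = f a.
Proof.
induction l as [| b l IH]; intros Hn Hin H; [elim Hin |].
apply NoDup_cons_iff in Hn. destruct Hn as [Hb Hn]. simpl. fold (Csum l f).
destruct Hin as [-> | Hin].
- rewrite Csum_0; [ring |]. intros c Hc. apply H; [now right |].
  intros ->. contradiction.
- rewrite IH; auto.
  + rewrite (H b); [ring | now left | intros ->; contradiction].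
  + intros c Hc. apply H. now right.
Qed.

Lemma Csum_swap {A B} (l : list A) (l' : list B) (f : A -> B -> C) :
  Csum l (fun a => Csum l' (fun b => f a b)) = Csum l' (fun b => Csum l (fun a => f a b)).
Proof.
induction l as [| a l IH]; simpl.
- symmetry. now apply Csum_0.
- fold (Csum l (fun a => Csum l' (fun b => f a b))).
  rewrite IH, <- Csum_plus. reflexivity.
Qed.

Lemma ccont_Csum {A} (l : list A) (F : A -> C -> C) w :
  (forall i, In i l -> ccont (F i) w) -> ccont (fun v => Csum l (fun i => F i v)) w.
Proof.
induction l as [| i l IH]; intros H; simpl; [apply ccont_const |].
apply ccont_plus; [apply H; now left |]. apply IH. intros j Hj. apply H. now right.
Qed.

Lemma lint_Csum {A} (l : list A) (F : A -> C -> C) P :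
  (forall i, In i l -> forall t : R, ccont (F i) (P + RtoC t)) ->
  lint (fun w => Csum l (fun i => F i w)) P = Csum l (fun i => lint (F i) P).
Proof.
induction l as [| i l IH]; intros H; simpl; [apply lint_const |].
rewrite lint_plus.
- f_equal. apply IH. intros j Hj. apply H. now right.
- apply H. now left.
- intros t. apply ccont_Csum. intros j Hj. apply H. now right.
Qed.

Lemma lint_translate F P a : lint F (P + a) = lint (fun w => F (w + a)) P.
Proof.
unfold lint, path_int. apply cint_ext; [lra |]. intros t _. f_equal. ring.
Qed.

Lemma RInt_lint (g : R -> C) (F : C -> C) (k P : C) :
  (forall t : R, ccont F (P + RtoC t)) ->
  (forall x : R, g x = k * F (P + RtoC x)) ->
  RInt (V := C_R_CompleteNormedModule) g 0 1 = k * lint F P.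
Proof.
intros HF HG.
assert (E : forall x, k * F (P + RtoC x * 1) = g x).
{ intros x. rewrite HG. do 2 f_equal. ring. }
rewrite RInt_cint; [| lra |].
- rewrite <- (cint_ext 0 1 ltac:(lra) _ _ (fun t _ => E t)).
  apply (cint_scal 0 1 ltac:(lra) k (fun t => F (P + RtoC t * 1))).
  intros t _. now apply rcont_lint.
- intros t _. apply (rcont_ext _ _ _ E).
  apply (rcont_comp (fun v => k * v) (fun x => F (P + RtoC x * 1))).
  + now apply rcont_lint.
  + apply ccont_mult; [apply ccont_const | apply ccont_id].
Qed.

Lemma e_minus_eq_1 a b : e (a - b) = 1 -> exists n : Z, b = a + RtoC (IZR n).
Proof.
intros E. apply e_eq_1 in E. destruct E as [n E]. exists (- n)%Z.
rewrite opp_IZR, RtoC_opp, <- E. ring.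
Qed.

Lemma e_geometric (n : nat) x : e x <> 1 ->
  / (e x - 1) + Csum (map Z.of_nat (seq 0 n)) (fun j => e (RtoC (IZR j) * x)) =
  e (RtoC (INR n) * x) / (e x - 1).
Proof.
intros Hx. assert (Hx' : e x - 1 <> 0) by (intros E; now apply Hx, Ceq_minus).
induction n as [| n IH].
- simpl. replace (0 * x) with (RtoC 0) by ring. rewrite e_0. field; auto.
- rewrite seq_S, map_app, Csum_app, Cplus_assoc, IH. simpl map.
  rewrite S_INR, RtoC_plus.
  replace ((INR n + 1) * x) with (INR n * x + x) by ring. rewrite e_plus.
  simpl Csum. rewrite <- INR_IZR_INZ. field; auto.
Qed.

(** The value 1/2 has two sources that match: the average of the paths above and below a pole, and
    the factor [/ 2] in [Rc] at an integer. *)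
Definition chi (x y : R) : C :=
  if Rlt_dec x y then 1 else if Req_dec_T x y then / 2 else 0.

Lemma chi_lt x y : (x < y)%R -> chi x y = 1.
Proof. intros H. unfold chi. destruct Rlt_dec; [auto | contradiction]. Qed.

Lemma chi_eq x : chi x x = / 2.
Proof.
unfold chi. destruct Rlt_dec; [lra |]. destruct Req_dec_T; [auto | contradiction].
Qed.

Lemma chi_gt x y : (y < x)%R -> chi x y = 0.
Proof.
intros H. unfold chi. destruct Rlt_dec; [lra |]. destruct Req_dec_T; [lra | auto].
Qed.

(** Let n be the ceiling of c; the bounds on c give 0 <= n <= M. The terms j < n have weight 1 and
    turn 1 / (u - 1) into u^n / (u - 1). The term j = n has weight 1/2 if c is an integer, and 1 /
    (u - 1) + 1/2 = (u + 1) / (2 (u - 1)); otherwise its weight is 0, as are all later ones. *)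
Lemma Rc_expand (M : nat) (c : R) x : (-1 < c < INR M)%R -> e x <> 1 ->
  Rc c (e x) = / (e x - 1) +
    Csum (map Z.of_nat (seq 0 M)) (fun j => chi (IZR j) c * e (RtoC (IZR j) * x)).
Proof.
intros Hc Hx. assert (Hx' : e x - 1 <> 0) by (intros E; now apply Hx, Ceq_minus).
set (n := Zceil c).
assert (Hn : (IZR n - 1 < c <= IZR n)%R) by apply Zceil_bound.
assert (n0 : (0 <= n)%Z).
{ assert (-1 < n)%Z; [| lia]. apply lt_IZR. lra. }
assert (nM : (n <= Z.of_nat M)%Z).
{ assert (n - 1 < Z.of_nat M)%Z; [| lia]. apply lt_IZR. rewrite minus_IZR.
  rewrite <- INR_IZR_INZ. lra. }
assert (EnZ : forall k : nat, Z.of_nat k = n -> RtoC (INR k) = RtoC (IZR n)).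
{ intros k E. now rewrite INR_IZR_INZ, E. }
assert (X : forall k : nat,
  ((Z.of_nat k <= n)%Z -> / (e x - 1) +
    Csum (map Z.of_nat (seq 0 k)) (fun j => chi (IZR j) c * e (RtoC (IZR j) * x)) =
    e (RtoC (INR k) * x) / (e x - 1)) /\
  ((n < Z.of_nat k)%Z -> / (e x - 1) +
    Csum (map Z.of_nat (seq 0 k)) (fun j => chi (IZR j) c * e (RtoC (IZR j) * x)) =
    Rc c (e x))).
{ assert (X1 : forall k : nat, (Z.of_nat k <= n)%Z -> / (e x - 1) +
    Csum (map Z.of_nat (seq 0 k)) (fun j => chi (IZR j) c * e (RtoC (IZR j) * x)) =
    e (RtoC (INR k) * x) / (e x - 1)).
  { intros k Hk. rewrite <- e_geometric by auto. f_equal. apply Csum_ext.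
    intros j Hj. apply in_map_iff in Hj. destruct Hj as [i [<- Hi]]. apply in_seq in Hi.
    rewrite chi_lt; [ring |].
    assert (Hi' : (Z.of_nat i <= n - 1)%Z) by lia. apply IZR_le in Hi'.
    rewrite minus_IZR in Hi'. lra. }
  induction k as [| k [_ IH]]; split; intros Hk; try lia; [now apply X1 | now apply X1 |].
  rewrite seq_S, map_app, Csum_app, Cplus_assoc. simpl (map Z.of_nat _). simpl (Csum (_ :: nil) _).
  destruct (Z.eq_dec (Z.of_nat k) n) as [E | ne].
  - rewrite X1 by lia. rewrite (EnZ k E), E. unfold Rc. fold n.
    rewrite !e_Z_mult. destruct Req_dec_T as [Ec | nc].
    + rewrite Ec at 1. rewrite chi_eq. field; auto.
    + rewrite chi_gt by lra. field; auto.
  - rewrite IH by lia. rewrite chi_gt; [ring |].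
    assert (Hk' : (n + 1 <= Z.of_nat k)%Z) by lia. apply IZR_le in Hk'.
    rewrite plus_IZR in Hk'. lra. }
destruct (Z_lt_le_dec n (Z.of_nat M)) as [L | L].
- symmetry. now apply X.
(* The sum stops before j = n; as c < M, this c is not an integer, and the missing term would have
   weight 0. *)
- assert (En : n = Z.of_nat M) by lia. destruct (X M) as [X1 _].
  rewrite X1 by lia. rewrite (EnZ M) by lia. unfold Rc. fold n.
  destruct Req_dec_T as [Ec | nc].
  + rewrite Ec, En, <- INR_IZR_INZ in Hc. lra.
  + rewrite e_Z_mult. field; auto.
Qed.

Lemma Rc_shift c (k : Z) x : Rc (c + IZR k) (e x) = e (RtoC (IZR k) * x) * Rc c (e x).
Proof.
unfold Rc. rewrite Zceil_addz, <- !e_Z_mult, plus_IZR.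
assert (E : e (RtoC (IZR (Zceil c) + IZR k) * x) =
  e (RtoC (IZR k) * x) * e (RtoC (IZR (Zceil c)) * x)).
{ rewrite <- e_plus. f_equal. rewrite RtoC_plus. ring. }
rewrite E. destruct (Req_dec_T (c + IZR k) (IZR (Zceil c) + IZR k)),
  (Req_dec_T c (IZR (Zceil c))); try lra; ring.
Qed.

(** For each point of the list, keep a half of the current interval that avoids it. *)
Lemma avoid_list (X : list R) lo hi : (lo < hi)%R ->
  exists a d, (0 < d)%R /\ (lo <= a - d)%R /\ (a + d <= hi)%R /\
    forall x, In x X -> ~ (a - d < x < a + d)%R.
Proof.
intros H. induction X as [| x X IH].
- exists ((lo + hi) / 2)%R, ((hi - lo) / 2)%R. repeat split; try lra. intros x [].
- destruct IH as [a [d [Hd [H1 [H2 H3]]]]].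
  destruct (Rle_lt_dec x a) as [L | L].
  + exists (a + d / 2)%R, (d / 2)%R. repeat split; try lra.
    intros y [<- | Hy]; [lra |]. intros Hy'. apply (H3 y Hy). lra.
  + exists (a - d / 2)%R, (d / 2)%R. repeat split; try lra.
    intros y [<- | Hy]; [lra |]. intros Hy'. apply (H3 y Hy). lra.
Qed.

Lemma list_gap (X : list R) : exists d, (0 < d)%R /\
  forall x, In x X -> x = 0%R \/ (d <= Rabs x)%R.
Proof.
induction X as [| x X [d [Hd H]]].
- exists 1%R. split; [lra | intros x []].
- destruct (Req_dec x 0) as [E | n].
  + exists d. split; auto. intros y [<- | Hy]; auto.
  + exists (Rmin d (Rabs x)). pose proof (Rabs_pos_lt x n). split.
    * now apply Rmin_glb_lt.
    * intros y [<- | Hy]; [right; apply Rmin_r |].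
      destruct (H y Hy); auto. right. eapply Rle_trans; [apply Rmin_l | auto].
Qed.

(* For small |e x|, use 1 / (e x - 1) = - 1 - 1 / (e (- x) - 1). *)
Lemma inv_e_minus_1_bound x d : (0 < d)%R -> (d <= Rabs (Im x))%R ->
  (Cmod (/ (e x - 1)) <= 1 + / d)%R.
Proof.
intros Hd Hx. pose proof PI_RGT_0. pose proof PI2_1.
assert (Hi : (0 < / d)%R) by now apply Rinv_0_lt_compat.
assert (X : forall y, (d <= - Im y)%R -> (Cmod (/ (e y - 1)) <= / d)%R).
{ intros y Hy. apply inv_minus_1_bound; auto. rewrite Cmod_e.
  eapply Rle_trans; [| apply exp_ineq1_le]. nra. }
unfold Rabs in Hx. destruct Rcase_abs.
- specialize (X x Hx). lra.
- assert (En : e x <> 1).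
  { intros E. apply (f_equal Cmod) in E. rewrite Cmod_e, Cmod_1, <- exp_0 in E.
    apply exp_inv in E. nra. }
  assert (Ex : / (e x - 1) = - (1) + - / (e (- x) - 1)).
  { rewrite e_opp. field. repeat split.
    - apply e_neq_0.
    - intros E. apply En. symmetry. now apply Ceq_minus.
    - intros E. now apply En, Ceq_minus. }
  rewrite Ex. eapply Rle_trans; [apply Cmod_triangle |].
  rewrite !Cmod_opp, Cmod_1. apply Rplus_le_compat_l. apply X.
  unfold Im in *; simpl. lra.
Qed.

(** * Poles in a strip slightly higher than a period parallelogram *)

Lemma Im_zpt s tau : Im (zpt s tau) = (fst s * Im tau)%R.
Proof. unfold zpt, Im; simpl; ring. Qed.

(* The strip [(a - d) Im tau < Im w < (a + 1 + d) Im tau] contains a period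
   parallelogram with margin [d]; [n s] translates the representative [s] into it. *)
Record pole_representatives (tau : C) (f : C -> C) (reps : list (R * R))
    (n : R * R -> Z) (a d : R) : Prop := {
  pr_nodup : NoDup reps;
  pr_distinct : forall s t, In s reps -> In t reps -> eqmodZ2 s t -> s = t;
  pr_cover : forall w, is_pole f w ->
    exists s t, w = zpt s tau /\ In t reps /\ eqmodZ2 s t;
  pr_margin : (0 < d)%R;
  pr_range : forall s, In s reps -> (a + d <= fst s + IZR (n s) <= a + 1 - d)%R
}.

Section Strip.

Variables (m : nat) (tau : C) (f : C -> C).
Hypothesis (Hf : elliptic_slice m tau f).
Variables (reps : list (R * R)) (n : R * R -> Z) (a d : R).
Hypothesis (Hr : pole_representatives tau f reps n a d).

Definition pt (s : R * R) : C := zpt (fst s + IZR (n s), snd s)%R tau.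

Definition in_strip (w : C) : Prop :=
  ((a - d) * Im tau < Im w < (a + 1 + d) * Im tau)%R.

Let T0 : (0 < Im tau)%R := es_H _ _ _ Hf.

Lemma pt_eq s : pt s = zpt s tau + RtoC (IZR (n s)) * tau.
Proof. unfold pt, zpt. simpl. rewrite RtoC_plus. ring. Qed.

Lemma Im_pt s : Im (pt s) = ((fst s + IZR (n s)) * Im tau)%R.
Proof. apply Im_zpt. Qed.

Lemma e_minus_pt_Im s w : e (w - pt s) = 1 -> Im w = Im (pt s).
Proof.
intros E. destruct (Req_dec (Im w) (Im (pt s))) as [E' | ne]; auto.
now elim (e_minus_Im _ _ ne).
Qed.

(** The level of w lies in (a - d, a + 1 + d), that of the translated representative in
    [a + d, a + 1 - d]. They differ by an integer strictly between -1 and 1, so they agree. *)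
Lemma pole_in_strip w : in_strip w -> is_pole f w ->
  exists s, In s reps /\ e (w - pt s) = 1.
Proof.
intros Hw Hp. destruct (pr_cover _ _ _ _ _ _ Hr w Hp) as [s [t [E [Ht [l [mu [E1 E2]]]]]]].
exists t. split; auto.
pose proof (pr_range _ _ _ _ _ _ Hr t Ht) as Hn.
unfold in_strip in Hw. rewrite E, Im_zpt in Hw.
assert (Hl : (l + n t = 0)%Z).
{ rewrite E1 in Hn.
  assert (H1 : (a - d < fst s < a + 1 + d)%R) by nra.
  assert (X1 : (IZR (l + n t) < 1)%R) by (rewrite plus_IZR; lra).
  assert (X2 : (-1 < IZR (l + n t))%R) by (rewrite plus_IZR; lra).
  apply lt_IZR in X1. apply lt_IZR in X2. lia. }
assert (Hl' : (fst t + IZR (n t) = fst s)%R).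
{ rewrite E1, Rplus_assoc, <- plus_IZR, Hl. ring. }
unfold pt. rewrite Hl', E2, E. unfold zpt; simpl.
replace (_ - _) with (RtoC (IZR (- mu))); [apply e_IZR |].
rewrite opp_IZR, RtoC_opp, RtoC_plus. ring.
Qed.

Lemma pt_distinct s t w : In s reps -> In t reps ->
  e (w - pt s) = 1 -> e (w - pt t) = 1 -> s = t.
Proof.
intros Hs Ht E1 E2. apply (pr_distinct _ _ _ _ _ _ Hr); auto.
pose proof (e_minus_pt_Im _ _ E1) as I1. pose proof (e_minus_pt_Im _ _ E2) as I2.
apply e_minus_eq_1 in E1. destruct E1 as [k1 E1].
apply e_minus_eq_1 in E2. destruct E2 as [k2 E2].
rewrite I1, !Im_pt in I2.
assert (I3 : (fst s + IZR (n s) = fst t + IZR (n t))%R) by nra.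
exists (n s - n t)%Z, (k2 - k1)%Z. rewrite !minus_IZR. split; [lra |].
apply (f_equal Re) in E1. apply (f_equal Re) in E2.
unfold pt, zpt, Re in E1, E2; simpl in E1, E2. rewrite I3 in E1. lra.
Qed.

Lemma residue_sum_pt (r : R * R -> C) t w : In t reps -> e (w - pt t) = 1 ->
  residue_sum (map (fun s => (pt s, r s)) reps) w = r t.
Proof.
intros Ht E. unfold residue_sum. rewrite Csum_map. simpl.
rewrite (Csum_single _ _ t).
- destruct Ceq_dec; [auto | contradiction].
- apply (pr_nodup _ _ _ _ _ _ Hr).
- auto.
- intros s Hs ne. destruct Ceq_dec as [E' |]; auto. elim ne.
  now apply (pt_distinct s t w).
Qed.

Lemma scaled_residue_pt s w : e (w - pt s) = 1 ->
  scaled_residue f (pt s) = scaled_residue f w.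
Proof.
intros E. apply e_minus_eq_1 in E. destruct E as [k ->].
now apply (scaled_residue_add_Z m tau f Hf).
Qed.

Definition pole_data (c : C -> C) : list (C * C) :=
  map (fun s => (pt s, scaled_residue f (pt s) * c (pt s))) reps.

(** All representatives are listed, including any at which f is regular; their scaled residue is
    0. *)
Lemma product_has_simple_poles (c : C -> C) w : in_strip w -> cdiff c w ->
  (forall k : Z, c (w + RtoC (IZR k)) = c w) ->
  has_simple_poles (fun v => f v * c v) (pole_data c) w.
Proof.
intros Hw Hc Hper.
destruct (classic (exists s, In s reps /\ e (w - pt s) = 1)) as [[s [Hs E]] | H].
- right. split.
  { exists (pt s, scaled_residue f (pt s) * c (pt s)). split; auto.
    apply (in_map (fun s => (pt s, scaled_residue f (pt s) * c (pt s)))), Hs. }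
  destruct (slice_residue m tau f Hf w) as [g [Hg [Eg Hn]]].
  exists (fun v => g v * c v). split; [now apply cdiff_mult |]. split.
  + unfold pole_data. rewrite (residue_sum_pt _ s) by auto.
    rewrite (scaled_residue_pt s w E), Eg. f_equal.
    apply e_minus_eq_1 in E. destruct E as [k ->]. now rewrite Hper.
  + revert Hn. apply near_imp. intros v Hv ne. rewrite <- Hv by auto. ring.
- left. split.
  + apply cdiff_mult; auto. apply near_self, (es_holomorphic _ _ _ Hf).
    intros Hp. apply H. now apply pole_in_strip.
  + intros p Hp E. apply in_map_iff in Hp. destruct Hp as [s [<- Hs]].
    elim H. now exists s.
Qed.

Lemma has_simple_poles_cons F Ps w p r :
  has_simple_poles F Ps w -> e (w - p) <> 1 -> has_simple_poles F ((p, r) :: Ps) w.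
Proof.
intros [[H1 H2] | [[q [Hq Eq]] [g [Hg [E Hn]]]]] ne.
- left. split; auto. intros q [<- | Hq]; [now intros E | auto].
- right. split; [exists q; split; auto; now right |].
  exists g. split; auto. split; auto. rewrite E. unfold residue_sum. simpl.
  destruct Ceq_dec; [contradiction | ring].
Qed.

Lemma product_periodic (c : C -> C) w : (forall v, c (v + 1) = c v) ->
  near w (fun v => v <> w -> f (v + 1) * c (v + 1) = f v * c v).
Proof.
intros Hc. generalize (near_not_pole m tau f Hf w). apply near_imp. intros v Hv ne.
rewrite Hc. f_equal. apply (slice_add_Z m tau f Hf 1). auto.
Qed.

Definition clear_line (P : C) : Prop :=
  in_strip P /\ forall t : R, ~ is_pole f (P + RtoC t).

Lemma in_strip_line P (t : R) : in_strip P -> in_strip (P + RtoC t).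
Proof. unfold in_strip, Im; simpl. intros H. lra. Qed.

Lemma clear_line_intro P : in_strip P ->
  (forall s, In s reps -> Im (pt s) <> Im P) -> clear_line P.
Proof.
intros HP H. split; auto. intros t Hp.
destruct (pole_in_strip _ (in_strip_line P t HP) Hp) as [s [Hs E]].
apply (H s Hs). rewrite <- (e_minus_pt_Im _ _ E). unfold Im; simpl; ring.
Qed.

Lemma clear_line_residue P s : clear_line P -> Im (pt s) = Im P ->
  scaled_residue f (pt s) = 0.
Proof.
intros [_ H] E. apply (scaled_residue_not_pole m tau f Hf).
replace (pt s) with (P + RtoC (Re (pt s) - Re P)); [apply H |].
apply C_eq; unfold Re, Im in *; simpl in *; lra.
Qed.

Lemma clear_line_cdiff P t : clear_line P -> cdiff f (P + RtoC t).
Proof. intros [_ H]. apply near_self. now apply (es_holomorphic _ _ _ Hf). Qed.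

Definition fourier_integrand (j : Z) (w : C) : C := f w * e (- (RtoC (IZR j) * w)).

Lemma cdiff_fourier_factor (j : Z) w : cdiff (fun v => e (- (RtoC (IZR j) * v))) w.
Proof.
apply (cdiff_ext (fun v => e ((- RtoC (IZR j)) * v + 0))); [| apply cdiff_e_lin].
apply near_all. intros v. f_equal. ring.
Qed.

Lemma fourier_factor_add_Z (j k : Z) w :
  e (- (RtoC (IZR j) * (w + RtoC (IZR k)))) = e (- (RtoC (IZR j) * w)).
Proof.
replace (- (IZR j * (w + IZR k))) with (- (IZR j * w) + RtoC (IZR (- (j * k)))).
- rewrite e_plus, e_IZR. ring.
- rewrite opp_IZR, mult_IZR, RtoC_opp, RtoC_mult. ring.
Qed.

Lemma fourier_integrand_ccont j P t : clear_line P ->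
  ccont (fourier_integrand j) (P + RtoC t).
Proof.
intros HP. apply cdiff_ccont. apply cdiff_mult.
- now apply clear_line_cdiff.
- apply cdiff_fourier_factor.
Qed.

Definition below (P : C) (r : R * R -> C) : C :=
  Csum reps (fun s => if Rlt_dec (Im (pt s)) (Im P) then r s else 0).

Lemma fourier_strip (j : Z) : exists C0, forall P, clear_line P ->
  lint (fourier_integrand j) P =
  C0 - below P (fun s => scaled_residue f (pt s) * e (- (RtoC (IZR j) * pt s))).
Proof.
destruct (strip_residues (fourier_integrand j)
  (pole_data (fun v => e (- (RtoC (IZR j) * v))))
  ((a - d) * Im tau) ((a + 1 + d) * Im tau)) as [C0 HC].
- intros w _. apply (product_periodic (fun v => e (- (RtoC (IZR j) * v)))).
  intros v. apply (fourier_factor_add_Z j 1).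
- intros w Hw. apply (product_has_simple_poles (fun v => e (- (RtoC (IZR j) * v)))); auto.
  + apply cdiff_fourier_factor.
  + intros k. apply fourier_factor_add_Z.
- exists C0. intros P HP. rewrite HC; auto.
  + f_equal. f_equal. unfold pole_data, below. now rewrite Csum_map.
  + apply HP.
  + intros t. apply cdiff_mult; [now apply clear_line_cdiff | apply cdiff_fourier_factor].
  + intros p Hp E. apply in_map_iff in Hp. destruct Hp as [s [<- Hs]]. simpl in *.
    rewrite (clear_line_residue P) by auto. ring.
Qed.

(** * The canonical Fourier coefficients *)

Let d0 : (0 < d)%R := pr_margin _ _ _ _ _ _ Hr.

Hypothesis (Hm : (0 < m)%nat).
Hypothesis (Ha1 : (-1 <= a - d)%R).
Hypothesis (Ha2 : (a + d <= -1 + 1 / (2 * INR m))%R).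

(** The index -2 m alpha of [Rc] for the translated representative [pt s]. *)
Definition exponent (s : R * R) : R := (- (2 * INR m * (fst s + IZR (n s))))%R.

Lemma m_pos : (1 <= INR m)%R.
Proof. change 1%R with (INR 1). apply le_INR. lia. Qed.

(** The levels of the [pt s] lie in [a + d, a + 1 - d], which the bounds on [a] place strictly
    between -1 and 1/2m. This is the range that [Rc_expand] requires. *)
Lemma exponent_range s : In s reps -> (-1 < exponent s < INR (2 * m))%R.
Proof.
intros Hs. pose proof (pr_range _ _ _ _ _ _ Hr s Hs) as H. pose proof m_pos as Hm1.
unfold exponent. rewrite mult_INR. simpl (INR 2).
assert (H2 : (2 * INR m * (a + d) <= - (2 * INR m) + 1)%R).
{ apply Rle_trans with (2 * INR m * (-1 + 1 / (2 * INR m)))%R.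
  - apply Rmult_le_compat_l; lra.
  - right. field. lra. }
split; nra.
Qed.

Definition fourier_line (j : Z) : C := - (RtoC (IZR j) * tau / (2 * RtoC (INR m))).

Lemma Im_fourier_line j : (2 * INR m * Im (fourier_line j) = - (IZR j * Im tau))%R.
Proof.
pose proof m_pos.
assert (E : 2 * RtoC (INR m) * fourier_line j = - (RtoC (IZR j) * tau)).
{ unfold fourier_line. field. intros E. apply RtoC_inj in E. lra. }
apply (f_equal Im) in E. unfold Im in *. simpl in *. lra.
Qed.

(** The levels -j / 2m run from -1 + 1/2m >= a + d to 0 <= a + 1 - d, and the strip extends 2 d
    further on both sides. *)
Lemma fourier_line_in_strip j h : (0 <= j < 2 * Z.of_nat m)%Z ->
  (Rabs h < 2 * d * Im tau)%R -> in_strip (fourier_line j + RtoC h * Ci).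
Proof.
intros [J1 J2] Hh. apply Rabs_lt_between in Hh. pose proof m_pos as Hm1.
pose proof (Im_fourier_line j) as E.
assert (J2' : (j <= 2 * Z.of_nat m - 1)%Z) by lia.
apply IZR_le in J1. apply IZR_le in J2'.
rewrite minus_IZR, mult_IZR, <- INR_IZR_INZ in J2'.
assert (H2 : (2 * INR m * (a + d) <= - (2 * INR m) + 1)%R).
{ apply Rle_trans with (2 * INR m * (-1 + 1 / (2 * INR m)))%R.
  - apply Rmult_le_compat_l; lra.
  - right. field. lra. }
unfold in_strip.
replace (Im (fourier_line j + RtoC h * Ci)) with (Im (fourier_line j) + h)%R
  by (unfold Im; simpl; ring).
assert (U : (Im (fourier_line j) <= 0)%R) by nra.
assert (L : ((a + d) * Im tau <= Im (fourier_line j))%R).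
{ apply Rmult_le_reg_l with (2 * INR m)%R; [lra |]. rewrite E. nra. }
split; nra.
Qed.

(** The difference c - j is a positive multiple of the height of the j-th line over [pt s], so [chi]
    counts a pole below the line fully and a pole on it by half. *)
Lemma chi_level j s :
  chi (IZR j) (exponent s) =
  (if Rlt_dec (Im (pt s)) (Im (fourier_line j)) then 1 else 0) +
  / 2 * (if Req_dec_T (Im (pt s)) (Im (fourier_line j)) then 1 else 0).
Proof.
pose proof (Im_fourier_line j) as E. pose proof m_pos as Hm1.
assert (Ec : ((exponent s - IZR j) * Im tau =
  2 * INR m * (Im (fourier_line j) - Im (pt s)))%R).
{ unfold exponent. rewrite Im_pt. lra. }
destruct (Rtotal_order (Im (pt s)) (Im (fourier_line j))) as [L | [Eq | L]].
- rewrite chi_lt by nra. destruct Rlt_dec; [| contradiction].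
  destruct Req_dec_T; [lra |]. ring.
- replace (exponent s) with (IZR j) by nra. rewrite chi_eq.
  destruct Rlt_dec; [lra |]. destruct Req_dec_T; [ring | contradiction].
- rewrite chi_gt by nra. destruct Rlt_dec; [lra |].
  destruct Req_dec_T; [lra |]. ring.
Qed.

Lemma is_pole_shift b c w : is_pole f (w - b) ->
  is_pole (fun v => f (v - b) * e (- (c * v))) w.
Proof.
intros [k [Hk [g [Hg [g0 H]]]]]. exists k. split; auto.
exists (fun v => g (v - b) * e (- (c * v))).
apply holomorphic_at_near in Hg. apply near_punctured_locally' in H.
assert (Ew : w - b + b = w) by ring. split; [| split].
- apply holomorphic_at_near. rewrite <- Ew.
  generalize (near_shift _ b _ Hg). apply near_imp. intros v Hv.
  apply cdiff_mult.
  + apply (cdiff_comp g); [apply cdiff_minus_const | exact Hv].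
  + apply (cdiff_ext (fun v => e ((- c) * v + 0))); [| apply cdiff_e_lin].
    apply near_all. intros u. f_equal. ring.
- apply Cmult_neq_0; auto. apply e_neq_0.
- apply near_punctured_locally'. rewrite <- Ew.
  generalize (near_shift _ b _ H). apply near_imp. intros v Hv ne.
  rewrite Hv by (intros E; apply ne; rewrite <- E; ring).
  rewrite Ew. replace (v - b - (w - b)) with (v - w) by ring. unfold Cdiv. ring.
Qed.

(** A line slightly above counts the poles on the j-th line, a line slightly below does not, and the
    average counts them by half. [C0] is in effect the integral along the bottom edge. *)
Lemma fourier_period_integral j C0 : (0 <= j < 2 * Z.of_nat m)%Z ->
  (forall P, clear_line P -> lint (fourier_integrand j) P =
     C0 - below P (fun s => scaled_residue f (pt s) * e (- (RtoC (IZR j) * pt s)))) ->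
  period_integral (fun w => f (w - RtoC (IZR j) * tau / (2 * RtoC (INR m))) *
                            e (- (RtoC (IZR j) * w))) =
  e (RtoC (IZR j) * fourier_line j) *
  (C0 - Csum reps (fun s => chi (IZR j) (exponent s) *
     (scaled_residue f (pt s) * e (- (RtoC (IZR j) * pt s))))).
Proof.
intros Hj HC.
set (b := RtoC (IZR j) * tau / (2 * RtoC (INR m))).
set (Q := fourier_line j). assert (EQ : Q = - b) by reflexivity.
set (r s := scaled_residue f (pt s) * e (- (RtoC (IZR j) * pt s))) in *.
set (k := e (RtoC (IZR j) * Q)).
set (F := fun w => f (w - b) * e (- (RtoC (IZR j) * w))).
assert (EF : forall w, F w = k * fourier_integrand j (Q + w)).
{ intros w. unfold F, k, fourier_integrand. rewrite EQ.
  replace (- b + w) with (w - b) by ring.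
  replace (e (- (IZR j * w))) with (e (IZR j * - b) * e (- (IZR j * (w - b)))); [ring |].
  rewrite <- e_plus. f_equal. ring. }
set (S2 := Csum reps (fun s => (if Req_dec_T (Im (pt s)) (Im Q) then 1 else 0) * r s)).
assert (ES : Csum reps (fun s => chi (IZR j) (exponent s) * r s) = below Q r + / 2 * S2).
{ unfold S2, below. rewrite <- Csum_scal, <- Csum_plus. apply Csum_ext.
  intros s _. rewrite chi_level. fold Q. destruct Rlt_dec; ring. }
change (Csum reps (fun s => chi (IZR j) (exponent s) *
  (scaled_residue f (pt s) * e (- (RtoC (IZR j) * pt s)))))
  with (Csum reps (fun s => chi (IZR j) (exponent s) * r s)).
rewrite ES. unfold period_integral.
assert (HT : (0 < d * Im tau)%R) by nra.
destruct excluded_middle_informative as [Hp | Hnp].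
- destruct (list_gap (map (fun s => Im (pt s) - Im Q)%R reps)) as [g [Hg Hgap]].
  assert (Hgap' : forall s, In s reps -> Im (pt s) = Im Q \/ (g <= Rabs (Im (pt s) - Im Q))%R).
  { intros s Hs. destruct (Hgap (Im (pt s) - Im Q)%R) as [H | H]; auto; [| left; lra].
    now apply (in_map (fun s => Im (pt s) - Im Q)%R). }
  (* For 0 < |h| < h0 the shifted line stays in the strip and meets no height of a [pt s]. *)
  set (h0 := Rmin g (d * Im tau)).
  assert (Hh0 : (0 < h0)%R) by now apply Rmin_glb_lt.
  assert (L1 : (h0 <= g)%R) by apply Rmin_l.
  assert (L2 : (h0 <= d * Im tau)%R) by apply Rmin_r.
  assert (EI : forall h, Im (Q + RtoC h * Ci) = (Im Q + h)%R)
    by (intros h; unfold Im; simpl; ring).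
  assert (Hsh : forall h, h <> 0%R -> (Rabs h < h0)%R ->
    shifted_integral F h = k * (C0 - below (Q + RtoC h * Ci) r)).
  { intros h h1 h2.
    assert (Hcl : clear_line (Q + RtoC h * Ci)).
    { apply clear_line_intro; [apply fourier_line_in_strip; auto; lra |].
      intros s Hs E. rewrite EI in E. destruct (Hgap' s Hs) as [E' | E']; [lra |].
      rewrite E in E'. replace (Im Q + h - Im Q)%R with h in E' by ring. lra. }
    unfold shifted_integral. rewrite <- HC by auto. apply RInt_lint.
    - intros t. now apply fourier_integrand_ccont.
    - intros x. rewrite EF. do 2 f_equal. ring. }
  assert (Habove : integral_above F = k * (C0 - (below Q r + S2))).
  { apply (iota_filterlim_locally (V := C_R_CompleteNormedModule) (shifted_integral F)).
    intros P HP. exists (mkposreal _ Hh0). intros h Hh Hpos.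
    change (Rabs (h - 0) < h0)%R in Hh. rewrite Rminus_0_r in Hh.
    rewrite Hsh; [| lra | auto].
    replace (below (Q + RtoC h * Ci) r) with (below Q r + S2); [now apply locally_singleton |].
    unfold below, S2. rewrite <- Csum_plus. apply Csum_ext. intros s Hs. rewrite EI.
    rewrite Rabs_pos_eq in Hh by lra.
    destruct (Hgap' s Hs) as [E | E].
    - destruct Rlt_dec; [lra |]. destruct Req_dec_T; [| contradiction].
      destruct Rlt_dec; [ring | lra].
    - destruct Req_dec_T as [E' | _]; [rewrite E', Rminus_diag, Rabs_R0 in E; lra |].
      unfold Rabs in E. destruct Rcase_abs; do 2 destruct Rlt_dec; try lra; ring. }
  assert (Hbelow : integral_below F = k * (C0 - below Q r)).
  { apply (iota_filterlim_locally (V := C_R_CompleteNormedModule) (shifted_integral F)).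
    intros P HP. exists (mkposreal _ Hh0). intros h Hh Hneg.
    change (Rabs (h - 0) < h0)%R in Hh. rewrite Rminus_0_r in Hh.
    rewrite Hsh; [| lra | auto].
    replace (below (Q + RtoC h * Ci) r) with (below Q r); [now apply locally_singleton |].
    unfold below. apply Csum_ext. intros s Hs. rewrite EI.
    rewrite Rabs_left in Hh by lra.
    destruct (Hgap' s Hs) as [E | E].
    - do 2 destruct Rlt_dec; try lra; ring.
    - unfold Rabs in E. destruct Rcase_abs; do 2 destruct Rlt_dec; try lra; ring. }
  rewrite Habove, Hbelow. field.
- assert (Hcl : clear_line Q).
  { split.
    - replace Q with (Q + RtoC 0 * Ci) by ring. apply fourier_line_in_strip; auto.
      rewrite Rabs_R0. lra.
    - intros t Ht. apply Hnp. exists t. apply is_pole_shift.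
      replace (t - b) with (Q + t) by (rewrite EQ; ring). exact Ht. }
  (* A representative at the height of this line is a regular point of f, so its half weight
     multiplies a zero residue. *)
  assert (E2 : S2 = 0).
  { apply Csum_0. intros s Hs. destruct Req_dec_T as [E |]; [| ring].
    unfold r. rewrite (clear_line_residue Q) by auto. ring. }
  rewrite E2. replace (below Q r + / 2 * 0) with (below Q r) by ring.
  rewrite <- HC by auto. apply RInt_lint.
  + intros t. now apply fourier_integrand_ccont.
  + intros x. apply EF.
Qed.

(** * The kernel *)

(* The kernel; [gauss_factor l] is q^(m l^2) y^(2 m l) and [e (z + l tau - w)] is
   q^l y / e(w). *)
Variables (z : C).
Hypothesis (Hz : ~ is_pole f z).

Definition gauss_factor (l : Z) : C :=
  e (RtoC (INR m) * (RtoC (IZR l) ^ 2 * tau + 2 * RtoC (IZR l) * z)).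

Definition kernel (l : Z) (w : C) : C :=
  gauss_factor l * / (e (z + RtoC (IZR l) * tau - w) - 1).

Lemma kernel_add_Z l k w : kernel l (w + RtoC (IZR k)) = kernel l w.
Proof.
unfold kernel. do 3 f_equal.
replace (z + IZR l * tau - (w + IZR k)) with (z + IZR l * tau - w + RtoC (IZR (- k)))
  by (rewrite opp_IZR, RtoC_opp; ring).
rewrite e_plus, e_IZR. ring.
Qed.

Lemma cdiff_kernel l w : e (z + RtoC (IZR l) * tau - w) <> 1 -> cdiff (kernel l) w.
Proof.
intros H. apply cdiff_mult; [apply cdiff_const |].
apply (cdiff_inv (fun v => e (z + RtoC (IZR l) * tau - v) - 1)).
- apply cdiff_plus; [| apply cdiff_const].
  apply (cdiff_ext (fun v => e ((- (1)) * v + (z + RtoC (IZR l) * tau)))).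
  + apply near_all. intros v. f_equal. ring.
  + apply cdiff_e_lin.
- intros E. now apply H, Ceq_minus.
Qed.

Lemma gauss_factor_elliptic l mu :
  gauss_factor l * f (z + RtoC (IZR l) * tau + RtoC (IZR mu)) = f z.
Proof.
rewrite (es_elliptic _ _ _ Hf) by auto. unfold gauss_factor.
rewrite Cmult_assoc, <- e_plus.
replace (_ + _) with (RtoC 0) by ring. rewrite e_0. ring.
Qed.

(** Besides the poles of f there is the point z + l tau, where [gauss_factor l] times f has the
    value f z; then 1 / (1 / u - 1) = - u / (u - 1) gives the coefficient - f z. *)
Lemma kernel_product_has_simple_poles l w : in_strip w ->
  has_simple_poles (fun v => f v * kernel l v)
    ((z + RtoC (IZR l) * tau, - f z) :: pole_data (kernel l)) w.
Proof.
intros Hw. set (p := z + RtoC (IZR l) * tau).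
destruct (Ceq_dec (e (w - p)) 1) as [E | ne].
- right. split; [exists (p, - f z); split; [now left | exact E] |].
  destruct (e_minus_eq_1 _ _ E) as [k Ek].
  assert (Ek' : w = p + RtoC (IZR (- k))).
  { rewrite Ek, opp_IZR, RtoC_opp. ring. }
  assert (Hnp : ~ is_pole f w).
  { rewrite Ek'. now apply (not_pole_translate m tau f Hf). }
  exists (fun v => - (1) * f v * gauss_factor l * e (v - w)). split; [| split].
  + apply cdiff_mult; [| apply cdiff_e_minus]. apply cdiff_mult; [| apply cdiff_const].
    apply cdiff_mult; [apply cdiff_const |]. apply near_self, (es_holomorphic _ _ _ Hf), Hnp.
  + replace (w - w) with (RtoC 0) by ring. rewrite e_0.
    unfold residue_sum. simpl. fold (Csum (pole_data (kernel l)) (fun p0 =>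
      if Ceq_dec (e (w - fst p0)) 1 then snd p0 else 0)).
    rewrite Csum_0.
    * destruct Ceq_dec; [| contradiction].
      rewrite <- (gauss_factor_elliptic l (- k)). fold p. rewrite <- Ek'. ring.
    (* f is regular at w, so such an entry is 0 whatever default value [kernel l] takes at its own
       pole. *)
    * intros q Hq. apply in_map_iff in Hq. destruct Hq as [s [<- Hs]]. simpl.
      destruct Ceq_dec as [E' |]; auto.
      rewrite (scaled_residue_pt s w E'), (scaled_residue_not_pole m tau f Hf) by auto. ring.
  + destruct e_factor as [h [Hh [Eh0 Eh]]].
    assert (Hc : ccont (fun v => h (v - w)) w).
    { apply (ccont_comp h); [apply ccont_minus_const |].
      replace (w - w) with (RtoC 0) by ring. now apply cdiff_ccont. }
    assert (Hn0 : h (w - w) <> 0).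
    { replace (w - w) with (RtoC 0) by ring. rewrite Eh0. apply tpi_neq_0. }
    generalize (near_nonzero _ _ Hc Hn0). apply near_imp. intros v Hv ne.
    assert (X0 : e (v - w) - 1 <> 0).
    { rewrite Eh. apply Cmult_neq_0; auto. intros E0. now apply ne, Ceq_minus. }
    unfold kernel. fold p.
    replace (e (p - v)) with (/ e (v - w)).
    * field. split; [apply e_neq_0 |].
      intros E0. apply X0. replace (e (v - w) - 1) with (- (1 - e (v - w))) by ring.
      rewrite E0. ring.
    * rewrite <- e_opp. rewrite Ek.
      replace (w + IZR k - v) with (- (v - w) + RtoC (IZR k)) by ring.
      rewrite e_plus, e_IZR. ring.
- apply has_simple_poles_cons; auto. apply product_has_simple_poles; auto.
  + apply cdiff_kernel. intros E. apply ne.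
    replace (w - p) with (- (p - w)) by ring. fold p in E. rewrite e_opp, E.
    field.
  + intros k. apply kernel_add_Z.
Qed.

Lemma kernel_product_ccont l P t : clear_line P ->
  Im P <> (Im z + IZR l * Im tau)%R -> ccont (fun w => f w * kernel l w) (P + RtoC t).
Proof.
intros HP H. apply cdiff_ccont, cdiff_mult; [now apply clear_line_cdiff |].
apply cdiff_kernel, e_minus_Im. intros E. apply H. revert E.
unfold Im; simpl; lra.
Qed.

Lemma kernel_strip (l : Z) : exists C0, forall P, clear_line P ->
  Im P <> (Im z + IZR l * Im tau)%R ->
  lint (fun w => f w * kernel l w) P =
  C0 - ((if Rlt_dec (Im z + IZR l * Im tau) (Im P) then - f z else 0) +
        below P (fun s => scaled_residue f (pt s) * kernel l (pt s))).
Proof.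
assert (EI : Im (z + RtoC (IZR l) * tau) = (Im z + IZR l * Im tau)%R)
  by (unfold Im; simpl; ring).
destruct (strip_residues (fun w => f w * kernel l w)
  ((z + RtoC (IZR l) * tau, - f z) :: pole_data (kernel l))
  ((a - d) * Im tau) ((a + 1 + d) * Im tau)) as [C0 HC].
- intros w _. apply (product_periodic (kernel l)). intros v. apply (kernel_add_Z l 1).
- intros w Hw. now apply kernel_product_has_simple_poles.
- exists C0. intros P HP HI. rewrite HC; auto.
  + f_equal. rewrite Csum_cons. cbn [fst snd]. rewrite EI. f_equal. f_equal.
    unfold below, pole_data. now rewrite Csum_map.
  + apply HP.
  + intros t. apply cdiff_mult; [now apply clear_line_cdiff |].
    apply cdiff_kernel, e_minus_Im. rewrite EI. intros E. apply HI. rewrite E.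
    unfold Im; simpl; ring.
  + intros p [<- | Hp] E; simpl in *.
    * rewrite EI in E. now elim HI.
    * apply in_map_iff in Hp. destruct Hp as [s [<- Hs]]. simpl in *.
      rewrite (clear_line_residue P) by auto. ring.
Qed.

(** With r = 2 m l + j this is q^(- j^2 / 4m) q^(r^2 / 4m) y^r, so its sum over l is q^(- j^2 / 4m)
    times the theta function; see [theta_eq]. *)
Definition theta_term (j l : Z) : C :=
  gauss_factor l * e (RtoC (IZR j) * (z + RtoC (IZR l) * tau)).

Definition residues_mod : list Z := map Z.of_nat (seq 0 (2 * m)).

(* u^(2m) / (u - 1) = 1 / (u - 1) + 1 + u + ... + u^(2m-1) for u = e (z + l tau - w). *)
Lemma kernel_translate l w : ~ is_pole f w -> e (z + RtoC (IZR l) * tau - w) <> 1 ->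
  f (w + tau) * kernel (l + 1) (w + tau) =
  f w * kernel l w + Csum residues_mod (fun j => theta_term j l * fourier_integrand j w).
Proof.
intros Hw Hu.
set (x := z + RtoC (IZR l) * tau - w) in *.
assert (Hx : e x - 1 <> 0) by (intros E; now apply Hu, Ceq_minus).
pose proof (es_elliptic _ _ _ Hf 1 0 w Hw) as E.
replace (w + RtoC (IZR 1) * tau + RtoC (IZR 0)) with (w + tau) in E by ring.
rewrite E.
rewrite (Csum_ext _ _ (fun j => f w * gauss_factor l * e (RtoC (IZR j) * x))).
2: { intros j _. unfold theta_term, fourier_integrand.
     replace (e (RtoC (IZR j) * x)) with (e (RtoC (IZR j) * (z + RtoC (IZR l) * tau)) *
       e (- (RtoC (IZR j) * w))); [ring |].
     rewrite <- e_plus. f_equal. unfold x. ring. }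
rewrite Csum_scal. unfold kernel.
replace (z + RtoC (IZR (l + 1)) * tau - (w + tau)) with x
  by (unfold x; rewrite plus_IZR, RtoC_plus; ring).
fold x.
replace (f w * (gauss_factor l * / (e x - 1)) +
  f w * gauss_factor l * Csum residues_mod (fun j => e (RtoC (IZR j) * x)))
  with (f w * gauss_factor l * (/ (e x - 1) +
    Csum residues_mod (fun j => e (RtoC (IZR j) * x)))) by ring.
unfold residues_mod. rewrite e_geometric by auto.
(* The elliptic factor of f turns [gauss_factor (l + 1)] into [gauss_factor l] times u^(2m). *)
assert (EN : e (- (RtoC (INR m) * (RtoC (IZR 1) ^ 2 * tau + 2 * RtoC (IZR 1) * w))) *
  gauss_factor (l + 1) = gauss_factor l * e (RtoC (INR (2 * m)) * x)).
{ unfold gauss_factor. rewrite <- !e_plus. f_equal. unfold x.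
  rewrite mult_INR, RtoC_mult, plus_IZR, RtoC_plus. simpl INR. rewrite RtoC_plus. ring. }
transitivity (f w * (e (- (RtoC (INR m) * (RtoC (IZR 1) ^ 2 * tau + 2 * RtoC (IZR 1) * w))) *
  gauss_factor (l + 1)) * / (e x - 1)); [ring |].
rewrite EN. field; auto.
Qed.

(** * Summation over the lattice *)

Variables (l0 : Z).
Hypothesis (Hl0 : ((a + d) * Im tau <= Im z + IZR l0 * Im tau <= (a + 1 - d) * Im tau)%R).

Let bottom : C := RtoC a * tau.

Lemma Im_bottom : Im bottom = (a * Im tau)%R.
Proof. unfold bottom, Im; simpl; ring. Qed.

Lemma Im_top : Im (bottom + tau) = ((a + 1) * Im tau)%R.
Proof. unfold bottom, Im; simpl; ring. Qed.

(** The levels of the z + l tau differ by integers, so when one of them keeps the margin d inside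
    the parallelogram, all others keep it outside. *)
Lemma level_gap l :
  (Im z + IZR l * Im tau <= (a - d) * Im tau \/
   l = l0 \/ (a + 1 + d) * Im tau <= Im z + IZR l * Im tau)%R.
Proof.
destruct (Z.lt_trichotomy l l0) as [L | [E | L]]; auto.
- left. assert (L' : (l <= l0 - 1)%Z) by lia. apply IZR_le in L'.
  rewrite minus_IZR in L'. nra.
- right; right. assert (L' : (l0 + 1 <= l)%Z) by lia. apply IZR_le in L'.
  rewrite plus_IZR in L'. nra.
Qed.

Lemma pt_range s : In s reps -> (a * Im tau < Im (pt s) < (a + 1) * Im tau)%R.
Proof.
intros Hs. pose proof (pr_range _ _ _ _ _ _ Hr s Hs). rewrite Im_pt. nra.
Qed.

Lemma clear_bottom : clear_line bottom.
Proof.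
apply clear_line_intro.
- unfold in_strip. rewrite Im_bottom. nra.
- intros s Hs. pose proof (pt_range s Hs). rewrite Im_bottom. lra.
Qed.

Lemma clear_top : clear_line (bottom + tau).
Proof.
apply clear_line_intro.
- unfold in_strip. rewrite Im_top. nra.
- intros s Hs. pose proof (pt_range s Hs). rewrite Im_top. lra.
Qed.

Lemma below_bottom r : below bottom r = 0.
Proof.
apply Csum_0. intros s Hs. pose proof (pt_range s Hs). rewrite Im_bottom.
destruct Rlt_dec; auto. lra.
Qed.

Lemma below_top r : below (bottom + tau) r = Csum reps r.
Proof.
apply Csum_ext. intros s Hs. pose proof (pt_range s Hs). rewrite Im_top.
destruct Rlt_dec; auto. lra.
Qed.

(** The residue theorem for the l-th term, with z + l tau between the two edges only for l = l0. The
    left-hand side is written as a sequence in l whose sum is f z. *)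
Lemma kernel_jump l :
  (if Z.eq_dec l l0 then f z else 0) =
  lint (fun w => f w * kernel l w) (bottom + tau) - lint (fun w => f w * kernel l w) bottom +
  Csum reps (fun s => scaled_residue f (pt s) * kernel l (pt s)).
Proof.
assert (Hd : (0 < d * Im tau)%R) by nra.
destruct (kernel_strip l) as [C0 HC].
rewrite !HC; auto using clear_top, clear_bottom.
- rewrite below_top, below_bottom, Im_bottom, Im_top.
  destruct (Z.eq_dec l l0) as [-> | ne].
  + do 2 destruct Rlt_dec; try nra; ring.
  + destruct (level_gap l) as [H | [H | H]]; [| contradiction |];
    do 2 destruct Rlt_dec; try nra; ring.
- rewrite Im_bottom. destruct (level_gap l) as [H | [-> | H]]; nra.
- rewrite Im_top. destruct (level_gap l) as [H | [-> | H]]; nra.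
Qed.

Lemma bottom_level l : (d * Im tau <= Rabs (Im z + IZR l * Im tau - a * Im tau))%R.
Proof.
destruct (level_gap l) as [H | [-> | H]].
- rewrite Rabs_left1; nra.
- rewrite Rabs_pos_eq; nra.
- rewrite Rabs_pos_eq; nra.
Qed.

Lemma bottom_not_one l (t : R) : e (z + RtoC (IZR l) * tau - (bottom + RtoC t)) <> 1.
Proof.
apply e_minus_Im. pose proof (bottom_level l) as H.
replace (Im (z + IZR l * tau)) with (Im z + IZR l * Im tau)%R by (unfold Im; simpl; ring).
replace (Im (bottom + t)) with (a * Im tau)%R by (rewrite <- Im_bottom; unfold Im; simpl; ring).
intros E. rewrite E, Rminus_diag, Rabs_R0 in H. nra.
Qed.

Lemma kernel_bottom_ccont l (t : R) : ccont (fun w => f w * kernel l w) (bottom + RtoC t).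
Proof.
apply kernel_product_ccont; [apply clear_bottom |]. rewrite Im_bottom.
intros E. pose proof (bottom_level l) as H.
rewrite <- E, Rminus_diag, Rabs_R0 in H. nra.
Qed.

(** Translation by tau brings the top edge down to the bottom edge and lowers the index by one, up
    to the 2m Fourier integrals. *)
Lemma kernel_top l :
  lint (fun w => f w * kernel (l + 1) w) (bottom + tau) =
  lint (fun w => f w * kernel l w) bottom +
  Csum residues_mod (fun j => theta_term j l * lint (fourier_integrand j) bottom).
Proof.
rewrite lint_translate.
rewrite (lint_ext _ (fun w => f w * kernel l w +
  Csum residues_mod (fun j => theta_term j l * fourier_integrand j w))).
- assert (Hc : forall j (t : R),
    ccont (fun w => theta_term j l * fourier_integrand j w) (bottom + RtoC t)).
  { intros j t. apply ccont_mult; [apply ccont_const |].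
    apply fourier_integrand_ccont, clear_bottom. }
  rewrite lint_plus.
  + f_equal. rewrite lint_Csum by auto. apply Csum_ext. intros j _.
    apply lint_scal. intros t. apply fourier_integrand_ccont, clear_bottom.
  + apply kernel_bottom_ccont.
  + intros t. apply ccont_Csum. auto.
- intros t. apply kernel_translate; [apply clear_bottom | apply bottom_not_one].
Qed.

Lemma Cmod_gauss_factor l : Cmod (gauss_factor l) =
  exp (- (2 * PI * INR m * Im tau) * (IZR l * IZR l) + - (4 * PI * INR m * Im z) * IZR l).
Proof.
unfold gauss_factor. rewrite Cmod_e. f_equal. unfold Im; simpl; ring.
Qed.

Lemma gauss_rate : (0 < 2 * PI * INR m * Im tau)%R.
Proof.
pose proof PI_RGT_0. pose proof (lt_0_INR m Hm).
apply Rmult_lt_0_compat; [| exact T0].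
apply Rmult_lt_0_compat; [lra | assumption].
Qed.

Lemma theta_term_summable j : exists L, is_zs (theta_term j) L.
Proof.
apply (is_zs_gauss _ (exp (- (2 * PI * IZR j * Im z))) (2 * PI * INR m * Im tau)
  (- (4 * PI * INR m * Im z) - 2 * PI * IZR j * Im tau) 0).
- apply gauss_rate.
- left; apply exp_pos.
- intros l _. unfold theta_term. rewrite Cmod_mult, Cmod_gauss_factor, Cmod_e.
  rewrite <- !exp_plus. right. f_equal. unfold Im; simpl; ring.
Qed.

Lemma kernel_summable p : exists L, is_zs (fun l => kernel l p) L.
Proof.
(* For |l| > N the heights of z + l tau and p differ by at least Im tau. The finitely many other
   terms, where the denominator might vanish, are exempt from the bound. *)
set (N := up (Rabs (Im z - Im p) / Im tau)).
apply (is_zs_gauss _ (1 + / Im tau) (2 * PI * INR m * Im tau)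
  (- (4 * PI * INR m * Im z)) (N + 1)).
- apply gauss_rate.
- pose proof (Rinv_0_lt_compat _ T0). lra.
- intros l Hl. unfold kernel. rewrite Cmod_mult, Cmod_gauss_factor, Rmult_comm.
  apply Rmult_le_compat_r; [left; apply exp_pos |].
  apply inv_e_minus_1_bound; auto.
  replace (Im (z + IZR l * tau - p)) with (IZR l * Im tau + (Im z - Im p))%R
    by (unfold Im; simpl; ring).
  assert (H1 : (Rabs (Im z - Im p) <= IZR N * Im tau)%R).
  { destruct (archimed (Rabs (Im z - Im p) / Im tau)) as [H _]. fold N in H.
    apply Rlt_gt, Rlt_le, (Rmult_le_compat_r (Im tau)) in H; [| lra].
    unfold Rdiv in H. rewrite Rmult_assoc, Rinv_l, Rmult_1_r in H; lra. }
  apply IZR_le in Hl. rewrite abs_IZR, plus_IZR in Hl.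
  pose proof (Rabs_triang_inv (IZR l * Im tau) (- (Im z - Im p))) as H2.
  rewrite Rabs_Ropp, Rabs_mult, (Rabs_pos_eq (Im tau)) in H2 by lra.
  replace (IZR l * Im tau - - (Im z - Im p))%R
    with (IZR l * Im tau + (Im z - Im p))%R in H2 by ring.
  nra.
Qed.

Lemma bounded_line F P : (forall t : R, ccont F (P + RtoC t)) ->
  exists M, forall t : R, (0 <= t <= 1)%R -> (Cmod (F (P + RtoC t)%C) <= M)%R.
Proof.
intros HF.
destruct (bounded_continuity (V := R_NormedModule) (fun t => Re (F (P + RtoC t * 1))) 0 1)
  as [M1 H1].
{ intros t _. apply rcont_Re. now apply rcont_lint. }
destruct (bounded_continuity (V := R_NormedModule) (fun t => Im (F (P + RtoC t * 1))) 0 1)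
  as [M2 H2].
{ intros t _. apply rcont_Im. now apply rcont_lint. }
exists (M1 + M2)%R. intros t Ht. specialize (H1 t Ht). specialize (H2 t Ht).
change (Rabs (Re (F (P + RtoC t * 1)%C)) < M1)%R in H1.
change (Rabs (Im (F (P + RtoC t * 1)%C)) < M2)%R in H2.
replace (RtoC t * 1) with (RtoC t) in * by ring.
eapply Rle_trans; [apply Cmod_le_Re_Im | lra].
Qed.

(** By [bottom_level] the factors 1 / (u - 1) are bounded on the bottom edge uniformly in l, so the
    Gaussian factor decides. *)
Lemma bottom_summable : exists L, is_zs (fun l => lint (fun w => f w * kernel l w) bottom) L.
Proof.
destruct (bounded_line f bottom) as [M HM].
{ intros t. apply cdiff_ccont, clear_line_cdiff, clear_bottom. }
assert (HM0 : (0 <= M)%R).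
{ eapply Rle_trans; [apply Cmod_ge_0 | apply (HM 0%R); lra]. }
assert (Hd : (0 < d * Im tau)%R) by nra.
pose proof (Rinv_0_lt_compat _ Hd) as Hd'.
apply (is_zs_gauss _ (2 * (M * (1 + / (d * Im tau)))) (2 * PI * INR m * Im tau)
  (- (4 * PI * INR m * Im z)) 0).
- apply gauss_rate.
- repeat apply Rmult_le_pos; lra.
- intros l _. rewrite <- Cmod_gauss_factor.
  rewrite Rmult_assoc. apply lint_bound; [apply kernel_bottom_ccont |].
  intros t Ht. rewrite Cmod_mult, Rmult_assoc.
  apply Rmult_le_compat; auto using Cmod_ge_0. unfold kernel.
  rewrite Cmod_mult, Rmult_comm.
  apply Rmult_le_compat_r; [apply Cmod_ge_0 |]. apply inv_e_minus_1_bound; auto.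
  replace (Im (z + IZR l * tau - (bottom + t)))
    with (Im z + IZR l * Im tau - a * Im tau)%R; [apply bottom_level |].
  unfold bottom, Im; simpl; ring.
Qed.

(** The sum of [kernel_jump] over l. At this stage all Fourier integrals are on the bottom edge and
    the poles carry the bare kernel sums. *)
Lemma slice_decomposition (th : Z -> C) (K : R * R -> C) :
  (forall j, is_zs (theta_term j) (th j)) ->
  (forall s, is_zs (fun l => kernel l (pt s)) (K s)) ->
  f z = Csum residues_mod (fun j => lint (fourier_integrand j) bottom * th j) +
        Csum reps (fun s => scaled_residue f (pt s) * K s).
Proof.
intros Hth HK. destruct bottom_summable as [L HL].
apply (is_zs_unique (fun l => if Z.eq_dec l l0 then f z else 0)); [apply is_zs_single |].
apply (is_zs_ext (fun l =>
  (lint (fun w => f w * kernel (l - 1) w) bottom - lint (fun w => f w * kernel l w) bottom) +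
  (Csum residues_mod (fun j => lint (fourier_integrand j) bottom * theta_term j (l - 1)) +
   Csum reps (fun s => scaled_residue f (pt s) * kernel l (pt s))))).
- intros l. rewrite kernel_jump.
  pose proof (kernel_top (l - 1)) as E. replace (l - 1 + 1)%Z with l in E by lia.
  rewrite E.
  rewrite (Csum_ext residues_mod (fun j => theta_term j (l - 1) * _)
    (fun j => lint (fourier_integrand j) bottom * theta_term j (l - 1))) by (intros; ring).
  ring.
- replace (Csum residues_mod _ + Csum reps _) with (0 +
    (Csum residues_mod (fun j => lint (fourier_integrand j) bottom * th j) +
     Csum reps (fun s => scaled_residue f (pt s) * K s))) by ring.
  apply is_zs_plus.
  + exact (is_zs_telescope _ _ HL).
  + apply is_zs_plus.
    * apply (is_zs_Csum residues_mod
        (fun j l => lint (fourier_integrand j) bottom * theta_term j (l - 1))).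
      intros j _. apply is_zs_scal. apply (is_zs_pred (theta_term j)), Hth.
    * apply (is_zs_Csum reps (fun s l => scaled_residue f (pt s) * kernel l (pt s))).
      intros s _. apply is_zs_scal, HK.
Qed.

End Strip.

(** * Theta functions, Appell-Lerch sums and the theorem *)

Lemma INR_neq_0 (m : nat) : (0 < m)%nat -> RtoC (INR m) <> 0.
Proof. intros H E. apply RtoC_inj in E. apply lt_0_INR in H. lra. Qed.

Lemma theta_eq (m : nat) tau z (j : Z) L : (0 < m)%nat -> (0 <= j < 2 * Z.of_nat m)%Z ->
  is_zs (theta_term m tau z j) L ->
  theta m j tau z = e (RtoC (IZR j) ^ 2 * tau / (4 * RtoC (INR m))) * L.
Proof.
intros Hm Hj H. apply ZSeries_eq.
generalize (is_zs_spread _ _ _ j Hj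
  (is_zs_scal (e (RtoC (IZR j) ^ 2 * tau / (4 * RtoC (INR m)))) _ _ H)).
apply is_zs_ext. intros r. destruct (Z.eqb_spec ((r - j) mod (2 * Z.of_nat m)) 0) as [E | _]; auto.
set (l := ((r - j) / (2 * Z.of_nat m))%Z).
assert (Er : (r = 2 * Z.of_nat m * l + j)%Z).
{ pose proof (Z_div_mod_eq_full (r - j) (2 * Z.of_nat m)) as D. fold l in D. lia. }
assert (ErC : RtoC (IZR r) = 2 * RtoC (INR m) * RtoC (IZR l) + RtoC (IZR j)).
{ rewrite Er, plus_IZR, !mult_IZR, <- INR_IZR_INZ. now rewrite RtoC_plus, !RtoC_mult. }
unfold theta_term, gauss_factor. rewrite <- !e_plus, ErC. f_equal.
field. now apply INR_neq_0.
Qed.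

(** [Rc_expand] is applied in each term: the powers of u sum up to theta series, weighted by [chi].
    These are the corrections that the shifted Fourier integrals produce. *)
Lemma Rc_series (m : nat) tau z p c th K : (-1 < c < INR (2 * m))%R ->
  (forall l, e (z + RtoC (IZR l) * tau - p) <> 1) ->
  (forall j, is_zs (theta_term m tau z j) (th j)) ->
  is_zs (fun l => kernel m tau z l p) K ->
  is_zs (fun l => gauss_factor m tau z l * Rc c (e (z + RtoC (IZR l) * tau - p)))
    (K + Csum (residues_mod m) (fun j => chi (IZR j) c * e (- (RtoC (IZR j) * p)) * th j)).
Proof.
intros Hc Hp Hth HK.
apply (is_zs_ext (fun l => kernel m tau z l p + Csum (residues_mod m)
  (fun j => chi (IZR j) c * e (- (RtoC (IZR j) * p)) * theta_term m tau z j l))).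
- intros l. rewrite (Rc_expand (2 * m) c) by auto. fold (residues_mod m).
  rewrite Cmult_plus_distr_l, <- Csum_scal. unfold kernel. f_equal.
  apply Csum_ext. intros j _. unfold theta_term.
  replace (RtoC (IZR j) * (z + RtoC (IZR l) * tau - p))
    with (RtoC (IZR j) * (z + RtoC (IZR l) * tau) + - (RtoC (IZR j) * p)) by ring.
  rewrite e_plus. ring.
- apply is_zs_plus; auto.
  apply (is_zs_Csum (residues_mod m)
    (fun j l => chi (IZR j) c * e (- (RtoC (IZR j) * p)) * theta_term m tau z j l)).
  intros j _. now apply is_zs_scal.
Qed.

(* Moving [z_s] by [k tau] lowers the exponent by [2 m k]; reindexing the sum by [k]
   gives back the same function up to the elliptic factor. *)
Lemma Av_eq (m : nat) tau z (s : R * R) (k : Z) K :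
  is_zs (fun l => gauss_factor m tau z l *
      Rc (- (2 * INR m * (fst s + IZR k)))
        (e (z + RtoC (IZR l) * tau - (zpt s tau + RtoC (IZR k) * tau)))) K ->
  Av m (e tau) (fun y => Rc (- (2 * INR m * fst s))%R (y / e (zpt s tau))) (e z) =
  elliptic_factor m tau k (zpt s tau) * K.
Proof.
intros H. apply ZSeries_eq.
generalize (is_zs_scal (elliptic_factor m tau k (zpt s tau)) _ _ (is_zs_shift k _ _ H)).
apply is_zs_ext. intros l.
set (x := z + RtoC (IZR l) * tau - zpt s tau).
replace (z + RtoC (IZR (l + k)) * tau - (zpt s tau + RtoC (IZR k) * tau)) with x
  by (unfold x; rewrite plus_IZR, RtoC_plus; ring).
replace (- (2 * INR m * (fst s + IZR k)))%R
  with (- (2 * INR m * fst s) + IZR (- (2 * Z.of_nat m * k)))%R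
  by (rewrite opp_IZR, !mult_IZR, <- INR_IZR_INZ; ring).
rewrite Rc_shift.
replace (Cpowz (e tau) l * e z / e (zpt s tau)) with (e x).
2: { rewrite <- e_Z_mult. unfold Cdiv. rewrite <- e_opp, <- !e_plus. f_equal.
     unfold x. ring. }
rewrite <- !e_Z_mult. unfold elliptic_factor, gauss_factor.
rewrite !Cmult_assoc, <- !e_plus. do 2 f_equal.
rewrite Z.pow_2_r, opp_IZR, !mult_IZR, <- INR_IZR_INZ, plus_IZR.
rewrite RtoC_opp, !RtoC_mult, !RtoC_plus. unfold x. ring.
Qed.

(** x - floor x - 1 is the representative of x in [-1, 0). If it is at least a + d it will do;
    otherwise the gap puts it at or below a - d, and adding 1 brings it into range. *)
Lemma translate_into_strip (x a d : R) : (0 < d)%R -> (-1 <= a - d)%R -> (a + d <= 0)%R ->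
  ~ (a - d < x - IZR (Zfloor x) - 1 < a + d)%R ->
  exists k : Z, (a + d <= x + IZR k <= a + 1 - d)%R.
Proof.
intros Hd H1 H2 Hx. pose proof (Zfloor_bound x) as Hf.
destruct (Rlt_le_dec (x - IZR (Zfloor x) - 1) (a + d)) as [L | L].
- exists (- Zfloor x)%Z. rewrite opp_IZR. lra.
- exists (- Zfloor x - 1)%Z. rewrite minus_IZR, opp_IZR. lra.
Qed.

Lemma Jacobi_elliptic_slice k m S phi tau :
  meromorphic_Jacobi_form k m S phi ->
  (forall tau z : C, in_H tau -> is_pole (phi tau) z -> simple_pole (phi tau) z) ->
  in_H tau -> elliptic_slice m tau (phi tau).
Proof.
intros HJ Hs HH. split; auto.
- intros w Hw. apply holomorphic_at_near.
  destruct (mjf_slices _ _ _ _ HJ tau w HH) as [H | [H _]]; [auto | contradiction].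
- intros l mu w Hw. now apply (mjf_elliptic _ _ _ _ HJ).
Qed.

Lemma Jacobi_pole_representatives k m S phi reps tau (n : R * R -> Z) a d :
  meromorphic_Jacobi_form k m S phi -> representatives S reps -> in_H tau -> (0 < d)%R ->
  (forall s, (a + d <= fst s + IZR (n s) <= a + 1 - d)%R \/ ~ In s reps) ->
  pole_representatives tau (phi tau) reps n a d.
Proof.
intros HJ [HS [Hnd Huniq]] HH Hd Hn. split; auto.
- intros s t Hs Ht E. destruct (Huniq s (HS s Hs)) as [u [_ Hu]].
  rewrite <- (Hu t) by auto. apply eq_sym, Hu. split; auto.
  exists 0%Z, 0%Z. split; ring.
- intros w Hw. destruct (mjf_slices _ _ _ _ HJ tau w HH) as [H | [_ [s [Hs E]]]].
  + elim (holomorphic_not_pole (phi tau) w); auto. now apply holomorphic_at_near.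
  + destruct (Huniq s Hs) as [t [[Ht E'] _]]. now exists s, t.
- intros s Hs. now destruct (Hn s).
Qed.

Lemma choice_function {A B} (P : A -> B -> Prop) :
  (forall a, exists b, P a b) -> exists f : A -> B, forall a, P a (f a).
Proof.
intros H. exists (fun a => proj1_sig (constructive_indefinite_description _ (H a))).
intros a. apply proj2_sig.
Qed.

Theorem theorem8p1 :
  forall (k : Z) (m : nat) (S : R * R -> Prop) (phi : C -> C -> C),
    (0 < m)%nat ->
    meromorphic_Jacobi_form k m S phi ->
    (forall tau z : C, in_H tau -> is_pole (phi tau) z ->
       simple_pole (phi tau) z) ->
    forall reps : list (R * R), representatives S reps ->
    forall tau z : C, in_H tau -> ~ is_pole (phi tau) z ->
      phi tau z = Cplus (phiF m phi tau z) (phiP m phi reps tau z).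
Proof.
intros k m S phi Hm HJ Hsimple reps Hreps tau z HH Hz.
pose proof (Jacobi_elliptic_slice k m S phi tau HJ Hsimple HH) as Hf.
pose proof HH as T0. unfold in_H in T0.
set (fl x := (x - IZR (Zfloor x) - 1)%R).
assert (Hm1 : (1 <= INR m)%R) by (apply m_pos; auto).
assert (Hlo : (0 < 1 / (2 * INR m) <= 1 / 2)%R).
{ split; [apply Rdiv_lt_0_compat; lra |].
  apply Rmult_le_compat_l; [lra |]. apply Rinv_le_contravar; lra. }
(* One gap avoids the level of z and those of all representatives, so that a single bottom edge
   serves them all. *)
destruct (avoid_list (fl (Im z / Im tau)%R :: map (fun s => fl (fst s)) reps)
  (-1) (-1 + 1 / (2 * INR m))) as [a [d [Hd [Ha1 [Ha2 Hav]]]]]; [lra |].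
destruct (translate_into_strip (Im z / Im tau) a d) as [l0 Hl0]; try lra.
{ apply Hav. now left. }
destruct (choice_function (fun (s : R * R) (j : Z) =>
  (a + d <= fst s + IZR j <= a + 1 - d)%R \/ ~ In s reps)) as [n Hn].
{ intros s. destruct (classic (In s reps)) as [Hin | Hin]; [| exists 0%Z; auto].
  destruct (translate_into_strip (fst s) a d) as [j Hj]; try lra; [| exists j; auto].
  apply Hav. right. now apply (in_map (fun s => fl (fst s))). }
pose proof (Jacobi_pole_representatives k m S phi reps tau n a d HJ Hreps HH Hd Hn) as Hr.
assert (Hl0' : ((a + d) * Im tau <= Im z + IZR l0 * Im tau <= (a + 1 - d) * Im tau)%R).
{ replace (Im z + IZR l0 * Im tau)%R with ((Im z / Im tau + IZR l0) * Im tau)%R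
    by (field; lra). split; apply Rmult_le_compat_r; lra. }
set (f := phi tau) in *.
destruct (choice_function _ (fourier_strip m tau f Hf reps n a d Hr)) as [C0 HC].
destruct (choice_function _ (theta_term_summable m tau f Hf Hm z)) as [th Hth].
destruct (choice_function _ (fun s => kernel_summable m tau f Hf Hm z (pt tau n s)))
  as [K HK].
set (r s := scaled_residue f (pt tau n s)).
(* The weighted residue at [pt s] crossed when the j-th integral moves from the bottom edge to its
   own line. *)
set (X j s := chi (IZR j) (exponent m n s) * (r s * e (- (RtoC (IZR j) * pt tau n s)))).
assert (Hdec : f z = Csum (residues_mod m) (fun j => C0 j * th j) +
  Csum reps (fun s => r s * K s)).
{ rewrite (slice_decomposition m tau f Hf reps n a d Hr Hm z Hz l0 Hl0' th K Hth HK).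
  f_equal. apply Csum_ext. intros j _.
  rewrite HC by (eapply clear_bottom; eauto).
  rewrite (below_bottom m tau f Hf reps n a d Hr). ring. }
assert (HF : phiF m phi tau z =
  Csum (residues_mod m) (fun j => (C0 j - Csum reps (X j)) * th j)).
{ apply Csum_ext. intros j Hj.
  assert (Hj' : (0 <= j < 2 * Z.of_nat m)%Z).
  { apply in_map_iff in Hj. destruct Hj as [i [<- Hi]]. apply in_seq in Hi. lia. }
  unfold fourier_coeff. fold f.
  rewrite (fourier_period_integral m tau f Hf reps n a d Hr Hm Ha1 Ha2 j (C0 j) Hj' (HC j)).
  rewrite (theta_eq m tau z j (th j)) by auto.
  change (Csum reps _) with (Csum reps (X j)) at 1.
  set (u := RtoC (IZR j) ^ 2 * tau / (4 * RtoC (INR m))).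
  transitivity ((e u * e (RtoC (IZR j) * fourier_line m tau j) * e u) *
    ((C0 j - Csum reps (X j)) * th j)); [ring |].
  rewrite <- !e_plus.
  (* The exponent - j^2 / 2m from the position of the line cancels j^2 / 4m from the coefficient and
     j^2 / 4m from the theta function. *)
  replace (u + RtoC (IZR j) * fourier_line m tau j + u) with (RtoC 0).
  - rewrite e_0. ring.
  - unfold u, fourier_line. field. now apply INR_neq_0. }
assert (HP : phiP m phi reps tau z =
  Csum reps (fun s => r s * K s + Csum (residues_mod m) (fun j => X j s * th j))).
{ apply Csum_ext. intros s Hs.
  assert (Er : r s = elliptic_factor m tau (n s) (zpt s tau) * scaled_residue f (zpt s tau)).
  { unfold r. rewrite pt_eq, <- (scaled_residue_translate m tau f Hf (n s) 0).
    f_equal. ring. }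
  assert (ED : Defs.D m phi s tau * appell m s tau z = scaled_residue f (zpt s tau) *
    Av m (e tau) (fun y => Rc (- (2 * INR m * fst s))%R (y / e (zpt s tau))) (e z)).
  { unfold Defs.D, appell, scaled_residue. fold f. fold tpi. rewrite e_opp. field.
    apply e_neq_0. }
  rewrite ED.
  (* S may contain points at which phi(tau, .) is regular, and there both sides vanish. At a true
     pole no z + l tau agrees with [pt s] modulo 1, because z is not a pole; [Rc_series] requires
     this. *)
  destruct (classic (is_pole f (pt tau n s))) as [Hp | Hp].
  - rewrite (Av_eq m tau z s (n s) (K s + Csum (residues_mod m) (fun j =>
      chi (IZR j) (exponent m n s) * e (- (RtoC (IZR j) * pt tau n s)) * th j))).
    + rewrite Cmult_assoc, (Cmult_comm (scaled_residue _ _)), <- Er.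
      rewrite Cmult_plus_distr_l, <- Csum_scal. f_equal.
      apply Csum_ext. intros j _. unfold X. ring.
    + rewrite <- pt_eq. apply Rc_series; auto.
      * eapply exponent_range; eauto.
      * intros l E. destruct (e_minus_eq_1 _ _ E) as [i Ei]. apply (not_pole_translate m tau f Hf l i z Hz).
        now rewrite <- Ei.
  - assert (Ez : r s = 0) by exact (scaled_residue_not_pole m tau f Hf _ Hp).
    assert (Ez' : scaled_residue f (zpt s tau) = 0).
    { rewrite Ez in Er. symmetry in Er. unfold elliptic_factor in Er.
      apply NNPP. intros ne. exact (Cmult_neq_0 _ _ (e_neq_0 _) ne Er). }
    rewrite Ez', Ez, Csum_0; [ring |]. intros j _. unfold X. rewrite Ez. ring. }
(* The corrections [X] are subtracted in [phiF] and added in [phiP]; exchanging the two finite sums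
   makes them cancel. *)
change (phi tau z) with (f z). rewrite Hdec, HF, HP, Csum_plus, (Csum_swap reps).
rewrite (Csum_ext (residues_mod m) (fun j => (C0 j - Csum reps (X j)) * th j)
  (fun j => C0 j * th j + - (1) * Csum reps (fun s => X j s * th j))).
- rewrite Csum_plus, Csum_scal. ring.
- intros j _.
  rewrite (Csum_ext reps (fun s => X j s * th j) (fun s => th j * X j s)) by (intros; ring).
  rewrite Csum_scal. ring.
Qed.
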